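(* Let $E_1=\{\beta_0(\xi)\;;\;\xi\in\mathbb{R}\text{ irrational and non-quadratic}\}$ and let $E_2=\{\delta(w)\;;\;w\text{ an infinite word on a finite alphabet}\}$. Then $$E_1\cap(1,2)=E_2\cap(1,2).$$
   Context: A real number $\xi$ is non-quadratic if $[\mathbb{Q}(\xi):\mathbb{Q}]\ge 3$. For $\underline{x}=(x_0,x_1,x_2)\in\mathbb{Z}^3$ put $L(\underline{x})=\max(|x_0\xi-x_1|,|x_0\xi^2-x_2|)$. For $0<\varepsilon\le 1$, $\beta_\varepsilon(\xi)$ is the infimum of the set of all $\beta$ such that for every sufficiently large $B>0$ there exists $\underline{x}\in\mathbb{Z}^3$ with $1\le|x_0|\le B$ and $L(\underline{x})\le\min(B^{-1/\beta},|x_0|^{\varepsilon-1})$ (and $\beta_\varepsilon(\xi)=+\infty$ if this set is empty). The map $\varepsilon\mapsto\beta_\varepsilon(\xi)$ is non-increasing, and $\beta_0(\xi)=\sup_{0<\varepsilon<1}\beta_\varepsilon(\xi)$. For an infinite word $w=w_1w_2\dots$, let $(n_i)_{i\ge1}$ be the increasing sequence of all $n$ such that the prefix $w_1\dots w_n$ is a palindrome; $\delta(w)=\limsup_{i\to\infty}n_{i+1}/n_i$ if this sequence is infinite, and $\delta(w)=+\infty$ otherwise. *)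

(* Defs.v *)
From HB Require Import structures.
From mathcomp Require Import all_boot all_order all_algebra.
From mathcomp Require Import all_classical all_reals all_analysis.

Set Implicit Arguments.
Unset Strict Implicit.
Unset Printing Implicit Defensive.

Import Order.TTheory GRing.Theory Num.Theory.
Import numFieldNormedType.Exports.

Local Open Scope classical_set_scope.
Local Open Scope ring_scope.

Section NumberSide.
Variable R : realType.

(* Q(xi), as the smallest subfield of R containing xi. *)
Definition Qadjoin (xi : R) : set R :=
  [set y | forall K : {pred R}, divring_closed K -> xi \in K -> y \in K].

(* [Q(xi) : Q] >= n; this includes the case where the degree is infinite. *)
Definition Qadjoin_degree_ge (xi : R) (n : nat) : Prop :=
  exists v : 'I_n -> R,
    (forall i, Qadjoin xi (v i)) /\
    (forall c : 'I_n -> rat,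
        \sum_(i < n) ratr (c i) * v i = 0 -> forall i, c i = 0).

Definition nonquadratic (xi : R) : Prop := Qadjoin_degree_ge xi 3.

Definition approx_L (xi : R) (x0 x1 x2 : int) : R :=
  Num.max `|x0%:~R * xi - x1%:~R| `|x0%:~R * xi ^+ 2 - x2%:~R|.

(* The exponents b range over positive reals: for b < 0 the bound
   B `^ (- b^-1) grows with B, and the infimum would always be -oo. *)
Definition beta_set (xi eps : R) : set R :=
  [set b | 0 < b /\
    \forall B \near +oo, exists x0 x1 x2 : int,
      1 <= `|x0%:~R : R| <= B /\
      approx_L xi x0 x1 x2 <= Num.min (B `^ (- b^-1)) (`|x0%:~R| `^ (eps - 1))].

Definition beta_eps (xi eps : R) : \bar R :=
  ereal_inf [set b%:E | b in beta_set xi eps].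

Definition beta0 (xi : R) : \bar R :=
  ereal_sup [set beta_eps xi eps | eps in [set eps : R | 0 < eps < 1]].

Definition beta0_values : set (\bar R) :=
  [set beta0 xi | xi in [set xi : R | irrational xi /\ nonquadratic xi]].

End NumberSide.

Section WordSide.
Variable A : finType.

(* The letters w_1 w_2 ... of an infinite word are w 0, w 1, ... *)
Definition pal_prefix (w : nat -> A) (n : nat) : bool :=
  mkseq w n == rev (mkseq w n).

Definition inf_pal_prefixes (w : nat -> A) : Prop :=
  forall n, exists m, (n < m)%N && pal_prefix w m.

(* The default value 0 is only reached when w has finitely many palindromic
   prefixes. *)
Definition next_pal (w : nat -> A) (n : nat) : nat :=
  if pselect (exists m, (n < m)%N && pal_prefix w m) is left h
  then ex_minn h else 0%N.

(* pal_len w i is n_(i+1); the empty prefix is not counted. *)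
Definition pal_len (w : nat -> A) (i : nat) : nat := iter i.+1 (next_pal w) 0%N.

Definition delta_word (R : realType) (w : nat -> A) : \bar R :=
  if pselect (inf_pal_prefixes w) then
    limn_esup (fun i => ((pal_len w i.+1)%:R / (pal_len w i)%:R)%:E)
  else +oo%E.

End WordSide.

Definition delta_values (R : realType) : set (\bar R) :=
  [set d | exists (A : finType) (w : nat -> A), d = delta_word R w].

Arguments beta0_values : clear implicits.
Arguments delta_values : clear implicits.

(* Main.v *)
Require Import Defs.
From HB Require Import structures.
From mathcomp Require Import all_boot all_order all_algebra.
From mathcomp Require Import all_classical all_reals all_analysis.
From mathcomp Require Import ring lra zify.

(** An integer point [(x0, x1, x2)] is read as the symmetric matrix
    [[x0, x1], [x1, x2]], so that [S(x) adj(S(y)) S(z)] is symmetric exactly when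
    [x], [y], [z] are coplanar, just as a product of symmetric matrices indexed by
    the letters of a word is symmetric when the word is a palindrome.

    From a number to a word: when [1 < beta0 < 2], the primitive points that
    approximate [(1, xi, xi^2)] well form, in order of height, a sequence [x_k]
    whose terms eventually have nonzero determinant; determinant estimates show that
    the primitive part of [S(x_k) adj(S(x_{k+1})) S(x_k)] is again in the sequence,
    say [x_(psi k)], with [k - psi k] bounded. The rule
    [pi_{k+1} = pi_k pi_(psi k)^{-1} pi_k] then builds a word whose palindromic
    prefixes are exactly the [pi_k].

    From a word to a number: take the continued fraction whose partial quotients
    encode the letters. The palindromic prefixes give unimodular symmetric matrices,
    and no other primitive point approximates [(1, xi, xi^2)] as well.

    In both cases the lengths satisfy [n_{k+1} = 2 n_k - n_(psi k)] and the
    logarithmic heights satisfy the same recursion up to a negligible error. The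
    ratio of the increments of the two sequences is then an average of its earlier
    values, so its relative oscillation over windows of bounded length tends to [0],
    and the two sequences have asymptotically the same ratios of consecutive terms. *)

Set Implicit Arguments.
Unset Strict Implicit.
Unset Printing Implicit Defensive.

Import Order.TTheory GRing.Theory Num.Theory.

Local Open Scope classical_set_scope.
Local Open Scope ring_scope.

(** * Symmetric matrices and integer points *)

(** Everything rests on a bound [b < 2] for the ratios of consecutive logarithmic heights V_k. Then
    2 V_k - V_(k+1) is at least a fixed fraction of V_k, and this margin makes nonzero integer
    determinants force geometric growth of the heights and bound k - psi k. The obstacle on the
    number side is that [beta0] is a supremum over eps, so the list of good points depends a priori
    on eps, whereas the recursion needs one list with errors negligible against the heights.
    [good_improve] removes it: for some eps0 depending only on [b], points good at level eps0 are,
    from some height on, good at every prescribed level. The same margin, in the form b (b - 1) < 2,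
    forbids foreign points: a point inserted between two neighbours of a coplanar run would force
    the first gap of the run to be at least about twice the V of the point just before the run. On
    the word side the ratios of heights are not known in advance to follow those of lengths, so [b]
    comes from crude exponential bounds on the heights, and only the final comparison brings in
    delta. *)

Record m2 := M2 { m00 : int; m01 : int; m10 : int; m11 : int }.

Definition mul2 (A B : m2) : m2 :=
  M2 (m00 A * m00 B + m01 A * m10 B) (m00 A * m01 B + m01 A * m11 B)
     (m10 A * m00 B + m11 A * m10 B) (m10 A * m01 B + m11 A * m11 B).
Definition one2 : m2 := M2 1 0 0 1.
Definition tr2 (A : m2) : m2 := M2 (m00 A) (m10 A) (m01 A) (m11 A).
Definition adj2 (A : m2) : m2 := M2 (m11 A) (- m01 A) (- m10 A) (m00 A).
Definition det2 (A : m2) : int := m00 A * m11 A - m01 A * m10 A.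
Definition scal2 (s : int) (A : m2) : m2 :=
  M2 (s * m00 A) (s * m01 A) (s * m10 A) (s * m11 A).

Lemma mul2A A B C : mul2 A (mul2 B C) = mul2 (mul2 A B) C.
Proof. by rewrite /mul2 /=; congr M2; ring. Qed.
Lemma mul21 A : mul2 A one2 = A.
Proof. by case: A => a b c d; rewrite /mul2 /=; congr M2; ring. Qed.
Lemma mul12 A : mul2 one2 A = A.
Proof. by case: A => a b c d; rewrite /mul2 /=; congr M2; ring. Qed.
Lemma tr2_mul A B : tr2 (mul2 A B) = mul2 (tr2 B) (tr2 A).
Proof. by rewrite /tr2 /mul2 /=; congr M2; ring. Qed.
Lemma adj2_mul A B : adj2 (mul2 A B) = mul2 (adj2 B) (adj2 A).
Proof. by rewrite /adj2 /mul2 /=; congr M2; ring. Qed.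
Lemma adj2K A : adj2 (adj2 A) = A.
Proof. by case: A => a b c d; rewrite /adj2 /= !opprK. Qed.
Lemma mul2_adj A : mul2 A (adj2 A) = scal2 (det2 A) one2.
Proof. by rewrite /adj2 /mul2 /scal2 /det2 /=; congr M2; ring. Qed.
Lemma mul_adj2 A : mul2 (adj2 A) A = scal2 (det2 A) one2.
Proof. by rewrite /adj2 /mul2 /scal2 /det2 /=; congr M2; ring. Qed.
Lemma det2_mul A B : det2 (mul2 A B) = det2 A * det2 B.
Proof. by rewrite /det2 /mul2 /=; ring. Qed.
Lemma scal2_mull s A B : mul2 (scal2 s A) B = scal2 s (mul2 A B).
Proof. by rewrite /scal2 /mul2 /=; congr M2; ring. Qed.
Lemma scal2_mulr s A B : mul2 A (scal2 s B) = scal2 s (mul2 A B).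
Proof. by rewrite /scal2 /mul2 /=; congr M2; ring. Qed.
Lemma scal2A s t A : scal2 s (scal2 t A) = scal2 (s * t) A.
Proof. by rewrite /scal2 /=; congr M2; ring. Qed.
Lemma scal21 A : scal2 1 A = A.
Proof. by case: A => a b c d; rewrite /scal2 /= !mul1r. Qed.
Lemma det2_adj A : det2 (adj2 A) = det2 A.
Proof. by rewrite /det2 /=; ring. Qed.

(** Equality up to a nonzero rational factor: passing to primitive parts drops contents, so matrix
    identities are kept only in this form, with the adjugate as inverse. *)
Definition proj_eq (A B : m2) :=
  exists s t : int, [/\ s != 0, t != 0 & scal2 s A = scal2 t B].

Lemma proj_eq_refl A : proj_eq A A.
Proof. by exists 1, 1. Qed.
Lemma proj_eq_sym A B : proj_eq A B -> proj_eq B A.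
Proof. by move=> [s [t [s0 t0 e]]]; exists t, s. Qed.
Lemma proj_eq_scal s A : s != 0 -> proj_eq (scal2 s A) A.
Proof. by move=> s0; exists 1, s; rewrite scal21. Qed.
Lemma proj_eq_trans B A C : proj_eq A B -> proj_eq B C -> proj_eq A C.
Proof.
move=> [s [t [s0 t0 e]]] [s' [t' [s'0 t'0 e']]].
exists (s' * s), (t * t'); rewrite !mulf_neq0//; split=> //.
rewrite -scal2A e scal2A [s' * t]mulrC -[scal2 (t * s') B]scal2A e'.
exact: scal2A.
Qed.
Lemma proj_eq_mul A A' B B' :
  proj_eq A A' -> proj_eq B B' -> proj_eq (mul2 A B) (mul2 A' B').
Proof.
move=> [s [t [s0 t0 e]]] [s' [t' [s'0 t'0 e']]].
exists (s * s'), (t * t'); rewrite !mulf_neq0//; split=> //.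
have E u v M N : scal2 (u * v) (mul2 M N) = mul2 (scal2 u M) (scal2 v N).
  by rewrite scal2_mull scal2_mulr scal2A.
by rewrite !E e e'.
Qed.
Lemma proj_eq_tr A B : proj_eq A B -> proj_eq (tr2 A) (tr2 B).
Proof.
move=> [s [t [s0 t0 e]]]; exists s, t; split=> //.
by move: e; rewrite /scal2 /tr2 /= => -[-> -> -> ->].
Qed.
Lemma proj_eq_adj A B : proj_eq A B -> proj_eq (adj2 A) (adj2 B).
Proof.
move=> [s [t [s0 t0 e]]]; exists s, t; split=> //.
by move: e; rewrite /scal2 /adj2 /= !mulrN => -[-> -> -> ->].
Qed.
Lemma proj_eq_mulrI X A B :
  det2 X != 0 -> proj_eq (mul2 A X) B -> proj_eq A (mul2 B (adj2 X)).
Proof.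
move=> dX h; apply: proj_eq_trans (proj_eq_mul h (proj_eq_refl _)).
rewrite -mul2A mul2_adj scal2_mulr mul21.
exact/proj_eq_sym/proj_eq_scal.
Qed.

Definition sym2 (A : m2) := m01 A = m10 A.

Lemma sym2P A : sym2 A <-> tr2 A = A.
Proof. by case: A => a b c d; rewrite /sym2 /tr2 /=; split=> [->//|[]]. Qed.

Lemma proj_eq_sym2 A B : proj_eq A B -> sym2 A -> sym2 B.
Proof.
move=> [s [t [s0 t0 e]]] sA.
by move: e; rewrite /scal2 => -[_ e1 e2 _]; apply: (mulfI t0); rewrite -e1 -e2 sA.
Qed.

(* An integer point (c0, c1, c2) stands for the symmetric matrix
   [[c0, c1], [c1, c2]]. *)
Record pt := Pt { c0 : int; c1 : int; c2 : int }.

Definition mx_of (p : pt) : m2 := M2 (c0 p) (c1 p) (c1 p) (c2 p).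
Definition disc (p : pt) : int := c0 p * c2 p - c1 p * c1 p.
Definition det3 (p q s : pt) : int :=
  c0 p * (c1 q * c2 s - c2 q * c1 s) - c1 p * (c0 q * c2 s - c2 q * c0 s)
  + c2 p * (c0 q * c1 s - c1 q * c0 s).

Lemma det2_mx_of p : det2 (mx_of p) = disc p. Proof. by []. Qed.

Definition trip_mx (x y z : pt) : m2 :=
  mul2 (mul2 (mx_of x) (adj2 (mx_of y))) (mx_of z).
Definition trip (x y z : pt) : pt :=
  let t := trip_mx x y z in Pt (m00 t) (m10 t) (m11 t).

Lemma trip_mx_asym x y z : m01 (trip_mx x y z) - m10 (trip_mx x y z) = - det3 x y z.
Proof. by rewrite /trip_mx /det3 /=; ring. Qed.

Lemma trip_mx_sym x y z : det3 x y z = 0 -> sym2 (trip_mx x y z).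
Proof.
by move=> h; apply/eqP; rewrite /sym2 -subr_eq0 trip_mx_asym h oppr0.
Qed.

Lemma sym_det3 x y z : sym2 (trip_mx x y z) -> det3 x y z = 0.
Proof.
by move=> h; apply/eqP; rewrite -oppr_eq0 -trip_mx_asym subr_eq0; apply/eqP.
Qed.

Lemma mx_of_trip x y z : det3 x y z = 0 -> mx_of (trip x y z) = trip_mx x y z.
Proof.
move/trip_mx_sym; rewrite /sym2 /mx_of /trip; case: (trip_mx x y z) => a b c d /=.
by move=> ->.
Qed.

Lemma disc_trip x y z : det3 x y z = 0 ->
  disc (trip x y z) = disc x * disc y * disc z.
Proof.
by move=> h; rewrite -!det2_mx_of mx_of_trip// /trip_mx !det2_mul det2_adj.
Qed.

(** By this identity, triples iterated with [b] and [a] never leave the plane of [a] and [b]. *)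
Lemma det3_trip a b y : det3 a b y = 0 -> det3 a b (trip y b a) = 0.
Proof.
move=> h; have -> : det3 a b (trip y b a) = (c0 a * c2 b - c1 a * c1 b) * det3 a b y.
  by rewrite /det3 /=; ring.
by rewrite h mulr0.
Qed.

Lemma det3_rot a b c : det3 a b c = det3 b c a.
Proof. by rewrite /det3; ring. Qed.
Lemma det3_swap a b c : det3 a b c = - det3 b a c.
Proof. by rewrite /det3; ring. Qed.
Lemma det3_swap23 a b c : det3 a b c = - det3 a c b.
Proof. by rewrite /det3; ring. Qed.
Lemma det3baa a b : det3 b a a = 0. Proof. by rewrite /det3; ring. Qed.
Lemma det3aba a b : det3 a b a = 0. Proof. by rewrite /det3; ring. Qed.

Definition collinear (p q : pt) :=
  [/\ c0 p * c1 q = c1 p * c0 q, c0 p * c2 q = c2 p * c0 q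
    & c1 p * c2 q = c2 p * c1 q].

Lemma collinearP p q : c0 p != 0 ->
  c0 p * c1 q = c1 p * c0 q -> c0 p * c2 q = c2 p * c0 q -> collinear p q.
Proof.
move=> p0 h1 h2; split=> //; apply: (mulfI p0).
by rewrite mulrCA h2 mulrCA -h1 !mulrA (mulrC (c0 p)).
Qed.

(* n det(a,b,s) = (n.a) (b x s) + (n.b) (s x a) + (n.s) (a x b) for n = u x z. *)
Lemma coplanar3 u z a b s : ~ collinear u z ->
  det3 u z a = 0 -> det3 u z b = 0 -> det3 u z s = 0 -> det3 a b s = 0.
Proof.
move=> nc ha hb hs; apply/eqP/negPn/negP => d0; apply: nc.
split; apply/eqP; rewrite -subr_eq0; apply/eqP; apply: (mulIf d0); rewrite mul0r.
- have -> : (c0 u * c1 z - c1 u * c0 z) * det3 a b s =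
    det3 u z a * (c0 b * c1 s - c1 b * c0 s) + det3 u z b * (c0 s * c1 a - c1 s * c0 a)
    + det3 u z s * (c0 a * c1 b - c1 a * c0 b) by rewrite /det3; ring.
  by rewrite ha hb hs !mul0r.
- have -> : (c0 u * c2 z - c2 u * c0 z) * det3 a b s =
    det3 u z a * (c0 b * c2 s - c2 b * c0 s) + det3 u z b * (c0 s * c2 a - c2 s * c0 a)
    + det3 u z s * (c0 a * c2 b - c2 a * c0 b) by rewrite /det3; ring.
  by rewrite ha hb hs !mul0r.
- have -> : (c1 u * c2 z - c2 u * c1 z) * det3 a b s =
    det3 u z a * (c1 b * c2 s - c2 b * c1 s) + det3 u z b * (c1 s * c2 a - c2 s * c1 a)
    + det3 u z s * (c1 a * c2 b - c2 a * c1 b) by rewrite /det3; ring.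
  by rewrite ha hb hs !mul0r.
Qed.

Definition primitive (p : pt) :=
  exists a b c : int, a * c0 p + b * c1 p + c * c2 p = 1.

(** The Bezout relations of [p] and [q] make [c0 p] and [c0 q] divide each other, and positivity
    makes them equal. *)
Lemma primitive_collinear p q : primitive p -> primitive q ->
  0 < c0 p -> 0 < c0 q -> collinear p q -> p = q.
Proof.
move=> [a [b [c hp]]] [a' [b' [c' hq]]] p0 q0 [h1 h2 h3].
have E1 : c0 q = c0 p * (a * c0 q + b * c1 q + c * c2 q).
  rewrite !mulrDr ![c0 p * (_ * _)]mulrCA h1 h2 -[LHS]mul1r -hp; ring.
have E2 : c0 p = c0 q * (a' * c0 p + b' * c1 p + c' * c2 p).
  rewrite !mulrDr ![c0 q * (_ * _)]mulrCA !(mulrC (c0 q)) -h1 -h2 -[LHS]mul1r -hq; ring.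
have e0 : c0 p = c0 q.
  set g := (X in _ = c0 p * X) in E1; set g' := (X in _ = c0 q * X) in E2.
  have g1 : 1 <= g by rewrite -gtz0_ge1 -(pmulr_rgt0 _ p0) -E1.
  have g2 : 1 <= g' by rewrite -gtz0_ge1 -(pmulr_rgt0 _ q0) -E2.
  nia.
have nq : c0 q != 0 by rewrite gt_eqF.
case: p q p0 q0 h1 h2 h3 e0 nq {hp hq E1 E2} => x0 x1 x2 [y0 y1 y2] /= _ _ h1 h2 _ e0 nq.
rewrite e0 in h1 h2 *; congr Pt; apply: (mulfI nq); lia.
Qed.

Definition scalpt (g : int) (p : pt) := Pt (g * c0 p) (g * c1 p) (g * c2 p).

Lemma disc_scalpt g p : disc (scalpt g p) = g ^+ 2 * disc p.
Proof. by rewrite /disc /=; ring. Qed.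

Lemma det3_scalpt g p q s : det3 p q (scalpt g s) = g * det3 p q s.
Proof. by rewrite /det3 /=; ring. Qed.

Lemma primitive_part t : c0 t != 0 ->
  exists g p, [/\ g != 0, 0 < c0 p, primitive p & t = scalpt g p].
Proof.
move=> t0.
set g1 := gcdz (c0 t) (c1 t); set g2 := gcdz g1 (c2 t).
have g2n : g2 != 0 by rewrite /g2 !gcdz_eq0 (negbTE t0).
have [a [b hab]] : exists u v, u * c0 t + v * c1 t = g1.
  by case: (Bezoutz (c0 t) (c1 t)) => u [v e]; exists u, v.
have [c [d hcd]] : exists u v, u * g1 + v * c2 t = g2.
  by case: (Bezoutz g1 (c2 t)) => u [v e]; exists u, v.
have d0 : (g2 %| c0 t)%Z by rewrite (dvdz_trans (dvdz_gcdl _ _))// dvdz_gcdl.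
have d1 : (g2 %| c1 t)%Z by rewrite (dvdz_trans (dvdz_gcdl _ _))// dvdz_gcdr.
have d2 : (g2 %| c2 t)%Z by rewrite dvdz_gcdr.
have /dvdzP[k0 e0] := d0; have /dvdzP[k1 e1] := d1; have /dvdzP[k2 e2] := d2.
have k0n : k0 != 0 by apply: contraNneq t0 => k00; rewrite e0 k00 mul0r.
(* The sign goes into the content, so that the primitive point has positive first coordinate. *)
set s : int := Num.sg k0.
have ss : s * s = 1 by rewrite -expr2 /s sqr_sg k0n.
have sn : s != 0 by rewrite sgr_eq0.
exists (s * g2), (Pt (s * k0) (s * k1) (s * k2)); split.
- by rewrite mulf_neq0.
- by rewrite /= /s -normrEsg normr_gt0.
- exists (s * (c * a)), (s * (c * b)), (s * d) => /=.
  have -> : s * (c * a) * (s * k0) + s * (c * b) * (s * k1) + s * d * (s * k2)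
    = (s * s) * (c * a * k0 + c * b * k1 + d * k2) by ring.
  rewrite ss mul1r; apply: (mulIf g2n); rewrite mul1r -[RHS]hcd -hab.
  rewrite [in RHS]e0 [in RHS]e1 [in RHS]e2; ring.
- have tE : t = Pt (c0 t) (c1 t) (c2 t) by case: (t).
  rewrite [LHS]tE /scalpt /=; congr Pt.
  + by rewrite {1}e0; transitivity ((s * s) * (k0 * g2)); [rewrite ss mul1r|ring].
  + by rewrite {1}e1; transitivity ((s * s) * (k1 * g2)); [rewrite ss mul1r|ring].
  + by rewrite {1}e2; transitivity ((s * s) * (k2 * g2)); [rewrite ss mul1r|ring].
Qed.

(** * Determinant estimates *)

Section Estimates.
Variables (R : realType) (xi : R).

Definition ht (p : pt) : R := (c0 p)%:~R.
(* Coordinates of a point after the unimodular shear that moves (1, xi, xi^2)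
   to (1, 0, 0); disc and det3 are invariant under this shear. *)
Definition devE (p : pt) : R := (c1 p)%:~R - xi * (c0 p)%:~R.
Definition devF (p : pt) : R :=
  (c2 p)%:~R - 2 * xi * (c1 p)%:~R + xi ^+ 2 * (c0 p)%:~R.
Definition Lp (p : pt) : R := approx_L xi (c0 p) (c1 p) (c2 p).
Definition lnht (p : pt) : R := ln (ht p).
(** [kap] is the distortion of the shear. [bigK] dominates every numerical factor of the determinant
    estimates, and its logarithm [lcst] is the uniform additive error on logarithmic heights. *)
Definition kap : R := 1 + 2 * `|xi|.
Definition bigK : R := 100 * kap ^+ 4.
Definition lcst : R := ln bigK.

Lemma htE p : ht p = (c0 p)%:~R. Proof. by []. Qed.
Lemma LpE p : Lp p = approx_L xi (c0 p) (c1 p) (c2 p). Proof. by []. Qed.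

(** The parameter [m] measures, on a logarithmic scale, the loss with respect to the bound 1 /
    [ht p]. *)
Definition qual (m : R) (p : pt) := 0 < c0 p /\ Lp p <= expR (m - lnht p).

Lemma kap_ge1 : 1 <= kap.
Proof. by rewrite /kap lerDl mulr_ge0. Qed.

Lemma kap_gt0 : 0 < kap. Proof. exact: lt_le_trans kap_ge1. Qed.

Lemma bigK_ge k : (k <= 4)%N -> 100 * kap ^+ k <= bigK.
Proof.
by move=> k4; rewrite /bigK ler_pM2l// ler_weXn2l// kap_ge1.
Qed.

Lemma bigK_gt0 : 0 < bigK.
Proof. by rewrite /bigK mulr_gt0// exprn_gt0// kap_gt0. Qed.

Lemma lcst_ge0 : 0 <= lcst.
Proof.
rewrite /lcst ln_ge0// (le_trans _ (bigK_ge (leq0n 4)))// expr0; lra.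
Qed.

(** Used with 1 bounded by a nonzero integer determinant: an upper estimate of the determinant
    becomes a linear inequality between logarithmic heights. *)
Lemma lcst_le t : 1 <= bigK * expR t -> - lcst <= t.
Proof.
move=> h; have : ln 1 <= ln (bigK * expR t).
  by rewrite ler_ln// posrE// mulr_gt0 ?bigK_gt0 ?expR_gt0.
rewrite ln1 lnM ?posrE ?bigK_gt0 ?expR_gt0// expRK /lcst => ?; lra.
Qed.

Lemma Lp_ge0 p : 0 <= Lp p.
Proof. by rewrite /Lp /approx_L le_max normr_ge0. Qed.

Lemma devE_le p : `|devE p| <= Lp p.
Proof.
by rewrite /Lp /approx_L le_max; apply/orP; left; rewrite distrC /devE (mulrC xi).
Qed.

Lemma devE_leK p : `|devE p| <= kap * Lp p.
Proof.
by apply: le_trans (devE_le p) _; rewrite ler_peMl ?Lp_ge0 ?kap_ge1.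
Qed.

Lemma devF_le p : `|devF p| <= kap * Lp p.
Proof.
have h2 : `|(c2 p)%:~R - xi ^+ 2 * (c0 p)%:~R| <= Lp p.
  by rewrite /Lp /approx_L le_max; apply/orP; right; rewrite distrC (mulrC (xi ^+ 2)).
have -> : devF p = ((c2 p)%:~R - xi ^+ 2 * (c0 p)%:~R) - 2 * xi * devE p.
  by rewrite /devF /devE; ring.
apply: le_trans (ler_normB _ _) _; rewrite (_ : kap * _ = Lp p + 2 * `|xi| * Lp p) ?lerD//; last by rewrite /kap; ring.
by rewrite !normrM ger0_norm// ler_wpM2l ?mulr_ge0// devE_le.
Qed.

Lemma Lp_le p a : `|devE p| <= a -> `|devF p| <= a -> Lp p <= kap * a.
Proof.
move=> hE hF; have a0 : 0 <= a by apply: le_trans hE.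
rewrite /Lp /approx_L ge_max; apply/andP; split.
  rewrite distrC mulrC; apply: le_trans hE _.
  by rewrite ler_peMl// kap_ge1.
have -> : (c0 p)%:~R * xi ^+ 2 - (c2 p)%:~R = - (devF p + 2 * xi * devE p).
  by rewrite /devF /devE; ring.
rewrite normrN; apply: le_trans (ler_normD _ _) _; rewrite (_ : kap * _ = a + 2 * `|xi| * a) ?lerD//; last by rewrite /kap; ring.
by rewrite !normrM ger0_norm// ler_wpM2l// mulr_ge0.
Qed.

Lemma discE p : (disc p)%:~R = ht p * devF p - devE p ^+ 2 :> R.
Proof. by rewrite /disc /ht /devE /devF; ring. Qed.

Lemma det3E p q s : (det3 p q s)%:~R =
  (devE p * devF q - devF p * devE q) * ht s
  + (devF p * ht q - ht p * devF q) * devE s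
  + (ht p * devE q - devE p * ht q) * devF s :> R.
Proof. by rewrite /det3 /ht /devE /devF; ring. Qed.

Lemma intr_ge1 (z : int) : z != 0 -> 1 <= `|z%:~R : R|.
Proof. by move=> z0; rewrite -intr_norm ler1z -gtz0_ge1 normr_gt0. Qed.

Lemma intr_lt1 (z : int) : `|z%:~R : R| < 1 -> z = 0.
Proof.
by move=> h; apply/eqP/negPn/negP => /intr_ge1; rewrite leNgt h.
Qed.

Lemma ht_ge1 p : 0 < c0 p -> 1 <= ht p.
Proof. by move=> h; rewrite /ht ler1z -gtz0_ge1. Qed.

Lemma ht_gt0 p : 0 < c0 p -> 0 < ht p.
Proof. by move/ht_ge1; apply: lt_le_trans. Qed.

Lemma expR_lnht p : 0 < c0 p -> expR (lnht p) = ht p.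
Proof. by move=> h; rewrite lnK// posrE ht_gt0. Qed.

Lemma lnht_ge0 p : 0 < c0 p -> 0 <= lnht p.
Proof. by move=> h; rewrite ln_ge0// ht_ge1. Qed.

Lemma norm_mul_le (a b A B : R) : `|a| <= A -> `|b| <= B -> `|a * b| <= A * B.
Proof. by move=> hA hB; rewrite normrM ler_pM. Qed.

Lemma norm_add_le (a b A B : R) : `|a| <= A -> `|b| <= B -> `|a + b| <= A + B.
Proof. by move=> hA hB; apply: le_trans (ler_normD _ _) _; exact: lerD. Qed.

Lemma norm_sub_le (a b A B : R) : `|a| <= A -> `|b| <= B -> `|a - b| <= A + B.
Proof. by move=> hA hB; apply: le_trans (ler_normB _ _) _; exact: lerD. Qed.

Lemma sqr_le_norm (u w : R) : `|u| <= w -> u ^+ 2 <= w ^+ 2.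
Proof.
move=> h; rewrite -[u ^+ 2]real_normK ?num_real// lerXn2r ?nnegrE//.
exact: le_trans h.
Qed.

Lemma qualE m p : qual m p ->
  [/\ `|ht p| <= expR (lnht p), `|devE p| <= kap * expR (m - lnht p)
    & `|devF p| <= kap * expR (m - lnht p)].
Proof.
move=> [p0 hp]; split.
- by rewrite ger0_norm ?expR_lnht// ltW// ht_gt0.
- by apply: le_trans (devE_leK p) _; rewrite ler_wpM2l// ltW// kap_gt0.
- by apply: le_trans (devF_le p) _; rewrite ler_wpM2l// ltW// kap_gt0.
Qed.

Lemma qual_le m m' p : m <= m' -> qual m p -> qual m' p.
Proof.
move=> mm [p0 h]; split=> //; apply: le_trans h _; rewrite ler_expR; lra.
Qed.

Lemma kapM_expR (a b : R) : kap * expR a * (kap * expR b) = kap ^+ 2 * expR (a + b).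
Proof. by rewrite expRD; ring. Qed.

(** In sheared coordinates the cross product of [p] and [p'] has two entries [o1], [o2] of size
    about [W]; the vanishing determinant with [q] bounds the third one, [o0], in terms of them. In
    the nonzero integer [det3 p p' s], the [o0] term gives the first entry of the minimum and the
    other terms give the second. *)
Lemma gap m p p' q s : qual m p -> qual m p' -> qual m q -> qual m s ->
  lnht p <= lnht p' -> det3 p p' q = 0 -> det3 p p' s != 0 ->
  Num.min (2 * lnht q - lnht s) (lnht s) <= lnht p' - lnht p + 2 * m + lcst.
Proof.
move=> Qp Qp' Qq Qs vv dq ds.
have [p0 _] := Qp; have [p'0 _] := Qp'; have [q0 _] := Qq; have [s0 _] := Qs.
have [hp ep fp] := qualE Qp; have [hp' ep' fp'] := qualE Qp'.
have [hq eq fq] := qualE Qq; have [hs es fs] := qualE Qs.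
set mu := Num.min _ _.
set W := expR (lnht p' - lnht p + m).
have w (a b : R) : `|a| <= kap * expR (m - lnht p) -> `|b| <= kap * expR (m - lnht p') ->
    `|a * ht p' - ht p * b| <= 2 * kap * W.
  move=> ha hb; rewrite (_ : 2 * kap * W = kap * W + kap * W); last by ring.
  apply: norm_sub_le.
    apply: le_trans (norm_mul_le ha hp') _.
    rewrite -mulrA -expRD ler_pM2l ?kap_gt0// ler_expR; lra.
  apply: le_trans (norm_mul_le hp hb) _.
  rewrite mulrCA -expRD ler_pM2l ?kap_gt0// ler_expR; lra.
have w1 := w _ _ fp fp'; have w2 := w _ _ ep ep'.
set o1 := devF p * ht p' - ht p * devF p' in w1.
set o2 := devE p * ht p' - ht p * devE p' in w2.
set o0 := devE p * devF p' - devF p * devE p'.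
have Eq : o0 * ht q + o1 * devE q - o2 * devF q = 0.
  have := det3E p p' q; rewrite dq mulr0z => ->; rewrite /o0 /o1 /o2; ring.
have Es : (det3 p p' s)%:~R = o0 * ht s + o1 * devE s - o2 * devF s :> R.
  by rewrite det3E /o0 /o1 /o2; ring.
have W0 : 0 <= 2 * kap * W by rewrite !mulr_ge0 ?ltW ?kap_gt0 ?expR_gt0.
have h0 : `|o0| * ht q <= 2 * (2 * kap * W * (kap * expR (m - lnht q))).
  rewrite -[ht q]ger0_norm; last by rewrite ltW// ht_gt0.
  rewrite -normrM (_ : o0 * ht q = o2 * devF q - o1 * devE q); last by lra.
  rewrite (_ : 2 * _ = 2 * kap * W * (kap * expR (m - lnht q))
    + 2 * kap * W * (kap * expR (m - lnht q))); last by ring.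
  by apply: norm_sub_le; apply: norm_mul_le.
have h1 : `|o0| * ht s <= 4 * kap ^+ 2 * (W * expR (m - mu)).
  have -> : `|o0| * ht s = `|o0| * ht q * expR (lnht s - lnht q).
    by rewrite expRB !expR_lnht// -!mulrA; congr (_ * _); rewrite mulrCA mulfV ?mulr1// gt_eqF// ht_gt0.
  apply: le_trans (ler_wpM2r (expR_ge0 _) h0) _.
  have -> : 2 * (2 * kap * W * (kap * expR (m - lnht q))) * expR (lnht s - lnht q) = 4 * kap ^+ 2 * (W * (expR (m - lnht q) * expR (lnht s - lnht q))) by ring.
  rewrite ler_pM2l; last by rewrite mulr_gt0// exprn_gt0// kap_gt0.
  rewrite ler_pM2l ?expR_gt0// -expRD ler_expR.
  have : mu <= 2 * lnht q - lnht s by rewrite /mu ge_min lexx.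
  lra.
have h2 : `|o1 * devE s - o2 * devF s| <= 4 * kap ^+ 2 * (W * expR (m - mu)).
  have B : 2 * kap * W * (kap * expR (m - lnht s)) <= 2 * kap ^+ 2 * (W * expR (m - mu)).
    have -> : 2 * kap * W * (kap * expR (m - lnht s)) = 2 * kap ^+ 2 * (W * expR (m - lnht s)) by ring.
    rewrite ler_pM2l; last by rewrite mulr_gt0// exprn_gt0// kap_gt0.
    rewrite ler_pM2l ?expR_gt0// ler_expR.
    have : mu <= lnht s by rewrite /mu ge_min lexx orbT.
    lra.
  rewrite (_ : 4 * _ * _ = 2 * kap ^+ 2 * (W * expR (m - mu)) + 2 * kap ^+ 2 * (W * expR (m - mu))); last by ring.
  by apply: norm_sub_le; apply: le_trans (norm_mul_le _ _) B.
suff : - lcst <= lnht p' - lnht p + m + (m - mu) by lra.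
apply: lcst_le; apply: le_trans (intr_ge1 ds) _; rewrite Es -addrA.
apply: le_trans (ler_normD _ _) _; apply: le_trans (lerD _ h2) _.
  rewrite normrM (ger0_norm (ltW (ht_gt0 s0))); exact: h1.
have hk : 0 <= kap ^+ 2 * (W * expR (m - mu)).
  by rewrite !mulr_ge0 ?exprn_ge0 ?expR_ge0// ltW// kap_gt0.
rewrite [expR (_ + (m - mu))]expRD -/W; apply: (@le_trans _ _ (100 * kap ^+ 2 * (W * expR (m - mu)))); first by lra.
by rewrite ler_wpM2r ?bigK_ge// mulr_ge0 ?expR_ge0.
Qed.

(** Each of the six terms of the determinant is a height times two deviations; since [y] is the
    highest point all are at most [T], while a nonzero determinant is at least 1. *)
Lemma plane m x z y : qual m x -> qual m z -> qual m y ->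
  lnht x <= lnht z -> lnht z <= lnht y -> det3 x z y != 0 ->
  lnht x + lnht z <= lnht y + 2 * m + lcst.
Proof.
move=> Qx Qz Qy xz zy d0.
have [hx ex fx] := qualE Qx; have [hz ez fz] := qualE Qz; have [hy ey fy] := qualE Qy.
set T := kap ^+ 2 * expR (lnht y - lnht x - lnht z + 2 * m).
have k0 : 0 < kap ^+ 2 by rewrite exprn_gt0// kap_gt0.
have B p q s (a b c : R) : `|a| <= expR (lnht p) ->
    `|b| <= kap * expR (m - lnht q) -> `|c| <= kap * expR (m - lnht s) ->
    lnht p - lnht q - lnht s <= lnht y - lnht x - lnht z -> `|b * c * a| <= T.
  move=> ha hb hc h; apply: le_trans (norm_mul_le (norm_mul_le hb hc) ha) _.
  rewrite kapM_expR -mulrA -expRD ler_pM2l// ler_expR; lra.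
suff : - lcst <= lnht y - lnht x - lnht z + 2 * m by lra.
apply: lcst_le; apply: le_trans (intr_ge1 d0) _; rewrite det3E.
apply: (@le_trans _ _ (6 * T)); last first.
  apply: (@le_trans _ _ (100 * kap ^+ 2 * expR (lnht y - lnht x - lnht z + 2 * m))).
    rewrite -mulrA -/T; have : 0 <= T by rewrite mulr_ge0 ?expR_ge0// ltW.
    lra.
  by rewrite ler_wpM2r ?bigK_ge// expR_ge0.
have -> : 6 * T = (T + T) + (T + T) + (T + T) by ring.
apply: norm_add_le; [apply: norm_add_le|].
- rewrite mulrBl; apply: norm_sub_le.
    by apply: (B y x z) => //; lra.
  by apply: (B y x z) => //; lra.
- rewrite mulrBl; apply: norm_sub_le.
    by rewrite mulrAC; apply: (B z x y) => //; lra.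
  by rewrite -mulrA mulrC; apply: (B x z y) => //; lra.
- rewrite mulrBl; apply: norm_sub_le.
    by rewrite -mulrA mulrC; apply: (B x z y) => //; lra.
  by rewrite mulrAC; apply: (B z x y) => //; lra.
Qed.

(** The discriminant is [ht p * devF p - devE p ^+ 2] and a nonzero integer, so [Lp p] cannot be
    much smaller than 1 / [ht p]. *)
Lemma disc_lower p : 0 < c0 p -> disc p != 0 -> Lp p <= 1 ->
  1 <= 2 * kap * (ht p * Lp p).
Proof.
move=> p0 d0 L1; apply: le_trans (intr_ge1 d0) _; rewrite discE.
have h1 := ht_ge1 p0; have L0 := Lp_ge0 p; have k1 := kap_ge1.
have -> : 2 * kap * (ht p * Lp p) = kap * (ht p * Lp p) + kap * (ht p * Lp p) by ring.
apply: norm_sub_le.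
  rewrite mulrCA; apply: norm_mul_le (devF_le p).
  by rewrite ger0_norm// (le_trans ler01).
rewrite expr2; apply: (@le_trans _ _ (Lp p * Lp p)); first exact: norm_mul_le (devE_le p) (devE_le p).
apply: (@le_trans _ _ (1 * (1 * Lp p))); first by rewrite mul1r ler_wpM2r.
by rewrite ler_pM ?mul1r// ?mulr_ge0//; apply: ler_peMl.
Qed.

Lemma lnht_lower p t : 0 < c0 p -> disc p != 0 -> Lp p <= expR (- t) -> 0 <= t ->
  t <= lnht p + lcst.
Proof.
move=> p0 d0 Lt t0.
have L1 : Lp p <= 1 by rewrite (le_trans Lt)// -[leRHS]expR0 ler_expR; lra.
have h := disc_lower p0 d0 L1.
suff : - lcst <= lnht p + - t by lra.
apply: lcst_le; apply: le_trans h _; rewrite expRD expR_lnht//.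
have hh := ht_gt0 p0.
apply: (@le_trans _ _ (2 * kap * (ht p * expR (- t)))).
  by rewrite ler_pM2l ?mulr_gt0 ?kap_gt0// ler_pM2l.
rewrite ler_wpM2r ?mulr_ge0 ?expR_ge0 ?ltW//.
have := @bigK_ge 1 isT; rewrite expr1; have := kap_gt0; lra.
Qed.

Lemma Lp_scalpt g p : Lp (scalpt g p) = `|g%:~R| * Lp p.
Proof.
rewrite /Lp /approx_L /= maxr_pMr// -!normrM.
by congr Num.max; congr (`| _ |); ring.
Qed.

(** A direct estimate of the first coordinate bounds the height from above. The lower bound comes
    from the discriminant: it is the product of three nonzero ones, while [Lp] is small. Removing
    the content increases neither the height nor [Lp], so both bounds survive. *)
Lemma triple m x y z : 0 <= m -> qual m x -> qual m y -> qual m z ->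
  lnht z <= lnht y -> det3 x y z = 0 ->
  disc x != 0 -> disc y != 0 -> disc z != 0 ->
  3 * m + lcst < lnht x + lnht z - lnht y ->
  exists t, [/\ primitive t, disc t != 0,
    exists2 g : int, g != 0 & trip x y z = scalpt g t,
    `|lnht t - (lnht x + lnht z - lnht y)| <= 3 * m + 2 * lcst
    & qual (6 * m + 4 * lcst) t].
Proof.
move=> m0 Qx Qy Qz zy dt dx dy dz ha.
have [x0 _] := Qx; have [y0 _] := Qy; have [z0 _] := Qz.
have [hx ex fx] := qualE Qx; have [hy ey fy] := qualE Qy; have [hz ez fz] := qualE Qz.
set a := lnht x + lnht z - lnht y in ha *.
have vx0 := lnht_ge0 x0; have vy0 := lnht_ge0 y0; have vz0 := lnht_ge0 z0.
have c0' := lcst_ge0; have k1 := kap_ge1; have k0 := kap_gt0.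
have k2 : 0 < kap ^+ 2 by rewrite exprn_gt0.
set A00 := devF y * ht z - devE y * devE z.
set A10 := ht y * devE z - devE y * ht z.
set A01 := devF y * devE z - devE y * devF z.
set A11 := ht y * devF z - devE y * devE z.
set t := trip x y z.
have E0 : (c0 t)%:~R = ht x * A00 + devE x * A10 :> R.
  by rewrite /t /trip /trip_mx /A00 /A10 /ht /devE /devF /=; ring.
have E1 : devE t = devE x * A00 + devF x * A10.
  by rewrite /t /trip /trip_mx /A00 /A10 /ht /devE /devF /=; ring.
(* Coplanarity enters here: it removes a term [xi] times the determinant, which is not small
   otherwise. *)
have E2 : devF t = devE x * A01 + devF x * A11.
  have : devF t = devE x * A01 + devF x * A11 - xi * (det3 x y z)%:~R.
    by rewrite /t /trip /trip_mx /A01 /A11 /det3 /ht /devE /devF /=; ring.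
  by rewrite dt mulr0z mulr0 subr0.
set B := kap ^+ 2 * expR (lnht y - lnht z + 2 * m).
have kk (u w : R) : u <= w -> kap * expR u <= kap ^+ 2 * expR w.
  move=> uw; rewrite expr2 -mulrA ler_pM2l//; apply: (@le_trans _ _ (1 * expR w)).
    by rewrite mul1r ler_expR.
  by rewrite ler_wpM2r// expR_ge0.
have P1 (b c : R) : `|b| <= kap * expR (m - lnht y) -> `|c| <= expR (lnht z) -> `|b * c| <= B.
  move=> hb hc; apply: le_trans (norm_mul_le hb hc) _; rewrite -mulrA -expRD; apply: kk; lra.
have P2 (b c : R) : `|b| <= kap * expR (m - lnht y) -> `|c| <= kap * expR (m - lnht z) -> `|b * c| <= B.
  move=> hb hc; apply: le_trans (norm_mul_le hb hc) _.
  rewrite kapM_expR ler_pM2l// ler_expR; lra.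
have P3 (b c : R) : `|b| <= expR (lnht y) -> `|c| <= kap * expR (m - lnht z) -> `|b * c| <= B.
  move=> hb hc; apply: le_trans (norm_mul_le hb hc) _; rewrite mulrCA -expRD; apply: kk; lra.
have b00 : `|A00| <= B + B by apply: norm_sub_le; [exact: P1|exact: P2].
have b10 : `|A10| <= B + B by apply: norm_sub_le; [exact: P3|exact: P1].
have b01 : `|A01| <= B + B by apply: norm_sub_le; exact: P2.
have b11 : `|A11| <= B + B by apply: norm_sub_le; [exact: P3|exact: P2].
set C := 4 * kap ^+ 3 * expR (3 * m - a).
have CE : kap * expR (m - lnht x) * (B + B) + kap * expR (m - lnht x) * (B + B) = C.
  rewrite /C /B (_ : 3 * m - a = (m - lnht x) + (lnht y - lnht z + 2 * m)); last by rewrite /a; ring.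
  by rewrite [in RHS]expRD; ring.
have bE : `|devE t| <= C.
  by rewrite E1 -CE; apply: norm_add_le; apply: norm_mul_le.
have bF : `|devF t| <= C.
  by rewrite E2 -CE; apply: norm_add_le; apply: norm_mul_le.
have Lt : Lp t <= bigK * expR (3 * m - a).
  apply: le_trans (Lp_le bE bF) _; rewrite /C.
  have -> : kap * (4 * kap ^+ 3 * expR (3 * m - a)) = 4 * kap ^+ 4 * expR (3 * m - a) by ring.
  rewrite ler_wpM2r ?expR_ge0// (le_trans _ (bigK_ge (leqnn 4)))//.
  rewrite ler_wpM2r ?exprn_ge0 ?ltW//; lra.
have K0 := bigK_gt0.
have Lt' : Lp t <= expR (- (a - 3 * m - lcst)).
  apply: le_trans Lt _; have -> : - (a - 3 * m - lcst) = lcst + (3 * m - a) by ring.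
  by rewrite expRD /lcst lnK// posrE.
set D := kap ^+ 2 * expR (a + 2 * m).
have bX : `|(c0 t)%:~R : R| <= 4 * D.
  rewrite E0 (_ : 4 * D = (D + D) + (D + D)); last by ring.
  have Q (b c d : R) (u v w : R) : `|b| <= expR u -> `|c| <= kap * expR v -> `|d| <= kap * expR w ->
      u + v + w <= a + 2 * m -> `|b * (c * d)| <= D.
    move=> hb hc hd h; apply: le_trans (norm_mul_le hb (norm_mul_le hc hd)) _.
    by rewrite kapM_expR mulrCA -expRD ler_pM2l// ler_expR addrA.
  rewrite /A00 /A10 (mulrBr (ht x) (devF y * ht z)) (mulrBr (devE x) (ht y * devE z)).
  apply: norm_add_le; apply: norm_sub_le.
  - rewrite mulrA; apply: le_trans (norm_mul_le (norm_mul_le hx fy) hz) _.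
    have -> : expR (lnht x) * (kap * expR (m - lnht y)) * expR (lnht z) = kap * (expR (lnht x) * expR (m - lnht y) * expR (lnht z)) by ring.
    rewrite -!expRD; apply: kk; rewrite /a; lra.
  - by apply: (Q _ _ _ _ _ _ hx ey ez); move: ha; rewrite /a; lra.
  - by rewrite mulrCA; apply: (Q _ _ _ _ _ _ hy ex ez); move: ha; rewrite /a; lra.
  - by rewrite mulrA mulrC; apply: (Q _ _ _ _ _ _ hz ex ey); move: ha; rewrite /a; lra.
have dt0 : disc t != 0 by rewrite disc_trip// !mulf_neq0.
have Llt1 : Lp t < 1.
  by apply: le_lt_trans Lt' _; rewrite -[ltRHS]expR0 ltr_expR; lra.
have t0 : c0 t != 0.
  apply: contraNneq dt0 => t00.
  have : Lp t < 1 by [].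
  rewrite /Lp /approx_L t00 mulr0z !mul0r !sub0r !normrN gt_max => /andP[/intr_lt1 e1 /intr_lt1 e2].
  by rewrite /disc t00 e1 e2.
have [g [p [g0 p0 pp tE]]] := primitive_part t0.
have g1 := intr_ge1 g0.
have Lpt : Lp p <= Lp t.
  by rewrite tE Lp_scalpt ler_peMl ?Lp_ge0.
have dp : disc p != 0.
  by apply: contraNneq dt0 => d; rewrite tE disc_scalpt d mulr0.
have low : a - 3 * m - lcst <= lnht p + lcst.
  apply: lnht_lower => //; last by lra.
  exact: le_trans Lpt Lt'.
have up : lnht p <= a + 2 * m + lcst.
  have : ht p <= bigK * expR (a + 2 * m).
    apply: (@le_trans _ _ `|(c0 t)%:~R : R|).
      rewrite tE /= intrM normrM [X in _ * X]ger0_norm; last by rewrite ltW// ht_gt0.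
      by apply: ler_peMl => //; rewrite ltW// ht_gt0.
    apply: le_trans bX _; rewrite /D mulrA ler_wpM2r ?expR_ge0//.
    rewrite (le_trans _ (@bigK_ge 2 isT))// ler_wpM2r ?ltW//; lra.
  move=> h; have : ln (ht p) <= ln (bigK * expR (a + 2 * m)).
    by rewrite ler_ln// posrE ?mulr_gt0 ?expR_gt0 ?ht_gt0.
  by rewrite lnM ?posrE ?expR_gt0// expRK -/lcst -/(lnht p) => ?; lra.
exists p; split=> //.
- by exists g.
- rewrite ler_norml; apply/andP; split; lra.
- split=> //; apply: le_trans Lpt _; apply: le_trans Lt' _; rewrite ler_expR; lra.
Qed.

Lemma same_height p q : c0 p = c0 q -> Lp p < 1 / 2 -> Lp q < 1 / 2 -> p = q.
Proof.
move=> e; rewrite /Lp /approx_L e !gt_max => /andP[a1 a2] /andP[b1 b2].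
have E1 : c1 p = c1 q.
  apply/eqP; rewrite -subr_eq0; apply/eqP/intr_lt1; rewrite intrB.
  have -> : (c1 p)%:~R - (c1 q)%:~R = ((c0 q)%:~R * xi - (c1 q)%:~R) - ((c0 q)%:~R * xi - (c1 p)%:~R) by ring.
  apply: le_lt_trans (ler_normB _ _) _; lra.
have E2 : c2 p = c2 q.
  apply/eqP; rewrite -subr_eq0; apply/eqP/intr_lt1; rewrite intrB.
  have -> : (c2 p)%:~R - (c2 q)%:~R = ((c0 q)%:~R * xi ^+ 2 - (c2 q)%:~R) - ((c0 q)%:~R * xi ^+ 2 - (c2 p)%:~R) by ring.
  apply: le_lt_trans (ler_normB _ _) _; lra.
by case: p q e E1 E2 {a1 a2 b1 b2} => ? ? ? [? ? ?] /= -> -> ->.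
Qed.

(* If disc x = 0 then, in sheared coordinates, the corner entries of
   S(t) adj(S(x)) S(t) are squares divided by x0, hence too small to be nonzero
   integers. *)
Lemma isotropic_collinear x t : 0 < c0 x -> 0 < c0 t -> disc x = 0 ->
  (ht t * Lp x + ht x * Lp t) ^+ 2 < ht x ->
  (kap * (Lp x * Lp t) + kap * (ht x * Lp t)) ^+ 2 < ht x -> collinear x t.
Proof.
move=> x0 t0 dx h1 h2.
have X0 := ht_gt0 x0; have T0 := ht_gt0 t0; have Xn : ht x != 0 by rewrite gt_eqF.
have Lx0 := Lp_ge0 x; have Lt0 := Lp_ge0 t; have k0 := kap_gt0.
have fx : ht x * devF x = devE x ^+ 2.
  by apply/eqP; rewrite -subr_eq0 -discE dx.
set w := trip t x t.
set u := ht t * devE x - ht x * devE t.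
set s := devE x * devE t - ht x * devF t.
have E0 : ht x * (c0 w)%:~R = u ^+ 2.
  have : ht x * (c0 w)%:~R = u ^+ 2 + ht t ^+ 2 * (ht x * devF x - devE x ^+ 2).
    by rewrite /u /w /trip /trip_mx /ht /devE /devF /=; ring.
  by rewrite fx subrr mulr0 addr0.
have u_lt : u ^+ 2 < ht x.
  apply: le_lt_trans h1; apply: sqr_le_norm.
  by apply: norm_sub_le; apply: norm_mul_le; rewrite ?devE_le// ger0_norm// ltW.
have sq_small (z : int) (r : R) : ht x * z%:~R = r ^+ 2 -> r ^+ 2 < ht x -> z = 0.
  move=> e r2; apply: intr_lt1; rewrite -(ltr_pM2l X0) mulr1.
  by rewrite -{1}(ger0_norm (ltW X0)) -normrM e ger0_norm// sqr_ge0.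
have w0 := sq_small _ _ E0 u_lt.
have u0 : u = 0 by apply/eqP; rewrite -sqrf_eq0 -E0 w0 mulr0z mulr0.
have E2 : ht x * (c2 w)%:~R = s ^+ 2.
  have : ht x * (c2 w)%:~R = s ^+ 2 + xi ^+ 2 * u ^+ 2 + 2 * xi * u * s
     + (devE t + xi * ht t) ^+ 2 * (ht x * devF x - devE x ^+ 2).
    by rewrite /u /s /w /trip /trip_mx /ht /devE /devF /=; ring.
  by rewrite fx subrr mulr0 u0 expr0n /= !(mulr0, mul0r, addr0).
have s_lt : s ^+ 2 < ht x.
  apply: le_lt_trans h2; apply: sqr_le_norm.
  apply: norm_sub_le.
    apply: le_trans (norm_mul_le (devE_le x) (devE_le t)) _.
    by apply: ler_peMl; rewrite ?mulr_ge0 ?kap_ge1.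
  by rewrite mulrCA; apply: norm_mul_le (devF_le t); rewrite ger0_norm// ltW.
have w2 := sq_small _ _ E2 s_lt.
have s0 : s = 0 by apply/eqP; rewrite -sqrf_eq0 -E2 w2 mulr0z mulr0.
have toint (a b : int) : a%:~R = b%:~R :> R -> a = b by move/intr_inj.
apply: collinearP; first by rewrite gt_eqF.
- apply: toint; rewrite !intrM.
  by have : u = 0 by []; rewrite /u /ht /devE => ?; lra.
- apply: toint; rewrite !intrM.
  have e1 : ht x * devF t = devF x * ht t.
    apply: (mulfI Xn); have -> : ht x * (devF x * ht t) = (ht x * devF x) * ht t by ring.
    rewrite fx.
    have eu : ht x * devE t = ht t * devE x by apply/eqP; rewrite -subr_eq0 -opprB oppr_eq0 -/u u0.
    have es : ht x * devF t = devE x * devE t by apply/eqP; rewrite -subr_eq0 -opprB oppr_eq0 -/s s0.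
    rewrite es mulrCA eu; ring.
  have eu : ht x * devE t = ht t * devE x by apply/eqP; rewrite -subr_eq0 -opprB oppr_eq0 -/u u0.
  have -> : (c0 x)%:~R * (c2 t)%:~R = ht x * devF t + 2 * xi * (ht x * devE t) + xi ^+ 2 * ht x * ht t :> R.
    by rewrite /ht /devE /devF; ring.
  rewrite e1 eu /ht /devE /devF; ring.
Qed.

End Estimates.

(** * Two sequences with the same recursion *)

(* [lia] is very slow when the context holds many hypotheses on reals. *)
Ltac nlia :=
  repeat match goal with
  | H : ?T |- _ =>
    lazymatch type of T with
    | Prop => lazymatch T with
      | is_true (leq _ _) => fail
      | is_true (andb (leq _ _) (leq _ _)) => fail
      | @eq nat _ _ => fail
      | @eq bool (leq _ _) _ => fail
      | ~ (is_true (leq _ _)) => fail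
      | _ => clear H
      end
    end
  end; lia.

Definition ev (P : nat -> Prop) := exists N, forall i, (N <= i)%N -> P i.

Lemma ev_and P Q : ev P -> ev Q -> ev (fun i => P i /\ Q i).
Proof.
move=> [N hN] [M hM]; exists (maxn N M) => i; rewrite geq_max => /andP[hi hj].
by split; [exact: hN|exact: hM].
Qed.

Lemma ev_imp (P Q : nat -> Prop) : (forall i, P i -> Q i) -> ev P -> ev Q.
Proof. by move=> h [N hN]; exists N => i /hN /h. Qed.

Lemma ev_shift (P : nat -> Prop) k : ev P -> ev (fun i => P (i + k)%N).
Proof. by move=> [N hN]; exists N => i hi; apply: hN; rewrite (leq_trans hi) ?leq_addr. Qed.

Lemma ev_ge k : ev (fun i => (k <= i)%N).
Proof. by exists k. Qed.

Section Contraction.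
Variable R : realType.

Lemma archi_nat (x : R) : exists n : nat, x < n%:R.
Proof.
exists (Num.bound `|x|); apply: le_lt_trans (archi_boundP (normr_ge0 x)).
exact: ler_norm.
Qed.

Lemma lin_rec (a : nat -> R) (q e : R) N : q < 1 -> 0 <= q -> 0 < e ->
  (forall i, (N <= i)%N -> 0 <= a i) ->
  (forall i, (N <= i)%N -> a i.+1 <= q * a i + e) ->
  ev (fun i => a i <= 2 * e / (1 - q)).
Proof.
move=> q1 q0 e0 a0 h; set E := 2 * e / (1 - q).
have q' : 0 < 1 - q by lra.
have EE : E * (1 - q) = 2 * e by rewrite /E mulfVK// gt_eqF.
have stay i : (N <= i)%N -> a i <= E -> a i.+1 <= E.
  move=> Ni hi; apply: le_trans (h i Ni) _.
  have : q * a i <= q * E by rewrite ler_wpM2l.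
  lra.
have [k hk] := archi_nat (a N / e).
suff [j hj] : exists j, a (N + j)%N <= E.
  exists (N + j)%N => i hi; rewrite -(subnKC hi); elim: (i - _)%N => [|m IH].
    by rewrite addn0.
  by rewrite addnS; apply: stay => //; rewrite -addnA leq_addr.
apply: contrapT => /forallNP no.
have dec m : a (N + m)%N <= a N - m%:R * e.
  elim: m => [|m IH]; first by rewrite addn0 mul0r subr0.
  rewrite addnS; apply: le_trans (h _ (leq_addr _ _)) _.
  have /negP := no m; rewrite -ltNge => big.
  have : (1 - q) * E < (1 - q) * a (N + m)%N by rewrite ltr_pM2l.
  rewrite (mulrC _ E) EE -natr1; lra.
have := dec k; have := a0 (N + k)%N (leq_addr _ _).
have : a N < k%:R * e by rewrite -ltr_pdivrMr.
lra.
Qed.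

Lemma lin_rec0 (a : nat -> R) (q : R) : q < 1 -> 0 <= q -> (forall i, 0 <= a i) ->
  (forall e, 0 < e -> ev (fun i => a i.+1 <= q * a i + e)) ->
  forall e, 0 < e -> ev (fun i => a i <= e).
Proof.
move=> q1 q0 a0 h e e0; have q' : 0 < 1 - q by lra.
have e'0 : 0 < e * (1 - q) / 2 by rewrite divr_gt0// mulr_gt0.
have [N hN] := h _ e'0.
have := @lin_rec a q _ N q1 q0 e'0 (fun i _ => a0 i) hN.
apply: ev_imp => i; congr (_ <= _); field; lra.
Qed.

Lemma band_telescope (n v : nat -> R) (lo hi : R) a b : (a <= b)%N ->
  (forall k, (a <= k < b)%N -> lo * (v k.+1 - v k) <= n k.+1 - n k <= hi * (v k.+1 - v k)) ->
  lo * (v b - v a) <= n b - n a <= hi * (v b - v a).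
Proof.
elim: b => [|b IH]; first by rewrite leqn0 => /eqP -> _; rewrite !subrr !mulr0 lexx.
rewrite leq_eqVlt => /orP[/eqP <- _|ab h]; first by rewrite !subrr !mulr0 lexx.
have /andP[h1 h2] := IH ab (fun k hk => h k ltac:(nlia)).
have /andP[h3 h4] := h b ltac:(nlia).
apply/andP; split.
  have -> : lo * (v b.+1 - v a) = lo * (v b.+1 - v b) + lo * (v b - v a) by ring.
  lra.
have -> : hi * (v b.+1 - v a) = hi * (v b.+1 - v b) + hi * (v b - v a) by ring.
lra.
Qed.

Lemma finite_band (f : nat -> R) M : (forall k, 0 < f k) ->
  exists lo hi, 0 < lo /\ forall k, (k < M)%N -> lo <= f k <= hi.
Proof.
move=> f0; elim: M => [|M [lo [hi [l0 h]]]]; first by exists 1, 1.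
exists (Num.min lo (f M)), (Num.max hi (f M)); split; first by rewrite lt_min l0 f0.
move=> k; rewrite ltnS leq_eqVlt => /orP[/eqP ->|/h /andP[h1 h2]].
  by rewrite ge_min le_max !lexx !orbT.
by rewrite ge_min le_max h1 h2.
Qed.

(** Bookkeeping for [window_step], where [k], [t], [b], [a] are [kappa], [tau], [beta], [alpha]. *)
Lemma window_ineq (k t b a : R) : 0 <= t -> 0 < b -> 0 < a -> 2 * a <= b ->
  8 * b <= k -> k <= 1 / 2 ->
  (1 - k) * (t + b * (2 + t)) + 4 * a * (1 + t) * (1 + b)
    <= (1 - 2 * b) * ((1 - k / 4) * t + 8 * b).
Proof.
move=> t0 b0 a0 ab bk k1.
have h1 : 2 * a * ((1 + t) * (1 + b)) <= b * ((1 + t) * (1 + b)).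
  by rewrite ler_wpM2r// mulr_ge0//; lra.
have h2 : b * b <= b * (1 / 16) by rewrite ler_pM2l//; lra.
have h3 : t * (b * b) <= t * (b * (1 / 16)) by rewrite ler_wpM2l.
have h4 : t * (8 * b) <= t * k by rewrite ler_wpM2l.
have h5 : 0 <= k * b by rewrite mulr_ge0//; lra.
have h6 : 0 <= t * (k * b) by rewrite mulr_ge0.
have h7 : 0 <= t * b by rewrite mulr_ge0// ltW.
lra.
Qed.

Variables (n v : nat -> R) (psi : nat -> nat) (N C : nat) (eta : R).
Hypothesis C2 : (2 <= C)%N.
Hypothesis n_pos : forall i, 0 < n i.
Hypothesis n_inc : forall i, n i < n i.+1.
Hypothesis v_pos : forall i, 0 < v i.
Hypothesis eta_pos : 0 < eta.
Hypothesis psi_lt : forall i, (N <= i)%N -> (psi i < i)%N.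
Hypothesis psi_ge : forall i, (N <= i)%N -> (i <= psi i + C)%N.
Hypothesis n_rec : forall i, (N <= i)%N -> n i.+1 = 2 * n i - n (psi i).
Hypothesis v_le2 : forall i, (N <= i)%N -> v i.+1 <= 2 * v i.
Hypothesis v_grow : forall i, (N <= i)%N -> eta * v i <= v i.+1 - v i.
Hypothesis v_rec : forall e, 0 < e ->
  ev (fun i => `|v i.+1 - 2 * v i + v (psi i)| <= e * v i).

Let D i := v i.+1 - v i.
Let rho i := (n i.+1 - n i) / D i.
Let c : R := eta / 2.

Let D_gt0 i : (N <= i)%N -> 0 < D i.
Proof. by move=> /v_grow; apply: lt_le_trans; rewrite mulr_gt0. Qed.

Let eta_le1 : eta <= 1.
Proof.
have h1 := v_grow (leqnn N); have h2 := v_le2 (leqnn N); have h3 := v_pos N.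
rewrite -(ler_pM2r h3) mul1r; lra.
Qed.

Let rho_gt0 i : (N <= i)%N -> 0 < rho i.
Proof. by move=> Ni; rewrite divr_gt0 ?D_gt0// subr_gt0. Qed.

Let rhoD i : (N <= i)%N -> rho i * D i = n i.+1 - n i.
Proof. by move=> Ni; rewrite /rho mulfVK// gt_eqF// D_gt0. Qed.

(* The increments of v are, up to relative error alpha, sums of the previous
   ones, so rho i is a weighted mean of earlier values in which rho i.-1 has
   weight at least c. *)
Let rho_step alpha : 0 < alpha -> ev (fun i => forall lo hi, 0 <= lo ->
  (forall k, (i <= k + C)%N -> (k < i)%N -> lo <= rho k <= hi) ->
  rho i <= hi - c * (hi - rho i.-1) + alpha * hi /\
  lo + c * (rho i.-1 - lo) - alpha * lo <= rho i).
Proof.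
move=> a0; have ae : 0 < alpha * eta by rewrite mulr_gt0.
have := ev_and (v_rec ae) (ev_ge (N + C).+1); apply: ev_imp => i [herr hi0] lo hi lo0 hb.
have Ni : (N <= i)%N by nlia.
have Ni1 : (N <= i.-1)%N by nlia.
have iE : i.-1.+1 = i by nlia.
have p1 := psi_lt Ni; have p2 := psi_ge Ni.
have Di := D_gt0 Ni; have Di1 := D_gt0 Ni1.
have hi_lo : lo <= hi by have /andP[] := hb i.-1 ltac:(nlia) ltac:(nlia); apply: le_trans.
have /andP[r1 r2] := hb i.-1 ltac:(nlia) ltac:(nlia).
set S := v i.-1 - v (psi i).
have /andP[t1 t2] : lo * S <= n i.-1 - n (psi i) <= hi * S.
  apply: band_telescope; first by nlia.
  move=> k /andP[k1 k2]; have Nk : (N <= k)%N by nlia.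
  have /andP[b1 b2] := hb k ltac:(nlia) ltac:(nlia).
  by rewrite -(rhoD Nk) -/(D k) !ler_pM2r ?D_gt0// b1.
have E1 : rho i * D i = rho i.-1 * D i.-1 + (n i.-1 - n (psi i)).
  by rewrite !rhoD// iE n_rec//; ring.
have SD : S + D i.-1 = v i - v (psi i) by rewrite /S /D iE; ring.
have vi := v_pos i.
have g1 := v_grow Ni; have g2 := v_grow Ni1; have l1 := v_le2 Ni; have l2 := v_le2 Ni1.
rewrite iE in g2 l2.
have dE : D i = v i.+1 - v i by [].
have dE1 : D i.-1 = v i - v i.-1 by rewrite /D iE.
have big : alpha * (eta * v i) <= alpha * D i by rewrite ler_pM2l.
have cD : c * D i <= D i.-1.
  have : eta * v i <= eta * (2 * v i.-1) by rewrite ler_pM2l.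
  have : eta * D i <= eta * v i by rewrite ler_pM2l// dE; lra.
  rewrite /c; lra.
move: herr; rewrite ler_norml => /andP[e1 e2].
split; rewrite -(ler_pM2r Di).
  have u1 : (hi - rho i.-1) * (c * D i) <= (hi - rho i.-1) * D i.-1.
    by rewrite ler_wpM2l// subr_ge0.
  have u2 : hi * (S + D i.-1) <= hi * (D i + alpha * D i).
    rewrite ler_wpM2l ?(le_trans lo0)// SD dE; rewrite dE in big; lra.
  rewrite E1; lra.
have u1 : (rho i.-1 - lo) * (c * D i) <= (rho i.-1 - lo) * D i.-1.
  by rewrite ler_wpM2l// subr_ge0.
have u2 : lo * (D i - alpha * D i) <= lo * (S + D i.-1).
  rewrite ler_wpM2l// SD dE; rewrite dE in big; lra.
rewrite E1; lra.
Qed.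

(** The share of the width of a band that is gained over a window: a value in one half of the band
    keeps weight at least [c] at each of [C] steps, and its distance to the far end is at least half
    the width. *)
Let kappa : R := c ^+ C / 2.

Let c_gt0 : 0 < c. Proof. by rewrite /c divr_gt0. Qed.
Let c_half : c <= 1 / 2. Proof. by rewrite /c ler_pM2r. Qed.
Let kappa_gt0 : 0 < kappa. Proof. by rewrite /kappa divr_gt0// exprn_gt0. Qed.
Let kappa_le : kappa <= 1 / 2.
Proof.
rewrite /kappa ler_pM2r// exprn_ile1 ?ltW//; apply: le_lt_trans c_half _; lra.
Qed.

Let inw i (tau : R) := exists lo, 0 < lo /\
  forall k, (i <= k + C)%N -> (k < i)%N -> lo <= rho k <= lo * (1 + tau).

(** If [rho i.-1] lies in the lower half of the band, its weight in the following averages keeps the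
    next [C] values away from the top; symmetrically for the upper half. Beforehand the errors of
    these [C] steps widen the band at both ends by a relative amount at most [beta]. *)
Let window_step alpha : 0 < alpha -> 16 * (C%:R * alpha) <= kappa ->
  ev (fun i => forall tau, 0 <= tau -> inw i tau ->
   inw (i + C)%N ((1 - kappa / 4) * tau + 16 * (C%:R * alpha))).
Proof.
move=> a0 ka; have := ev_and (rho_step a0) (ev_ge (N + C).+1).
move=> [M hM]; exists M => i Mi tau tau0 [lo [lo0 hw]].
set beta := C%:R * alpha * 2.
have C0 : 1 <= C%:R :> R by rewrite ler1n; nlia.
have ab : 2 * alpha <= beta by rewrite /beta mulrC ler_pM2r// -[leLHS]mul1r ler_pM2r.
have b8 : 8 * beta <= kappa by rewrite /beta; lra.
have kl := kappa_le; have kg := kappa_gt0.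
have iNC : (N + C < i)%N by have [] := hM i Mi.
set hi := lo * (1 + tau) in hw.
have lohi : lo <= hi by rewrite /hi mulrDr mulr1 lerDl mulr_ge0// ltW.
have drift t : (t <= C)%N -> forall k, (i <= k + C)%N -> (k < i + t)%N ->
    lo * (1 - 2 * alpha * t%:R) <= rho k <= hi * (1 + 2 * alpha * t%:R).
  elim: t => [_ k k1 k2|t IH tC k k1 k2].
    by rewrite mulr0 subr0 addr0 !mulr1; apply: hw => //; nlia.
  have tc : t%:R <= C%:R :> R by rewrite ler_nat; nlia.
  have at1 : 2 * alpha * t%:R <= 1.
    apply: (@le_trans _ _ (2 * alpha * C%:R)); first by rewrite ler_pM2l// mulr_gt0.
    rewrite /beta in b8; lra.
  have at0 : 0 <= 2 * alpha * t%:R by rewrite mulr_ge0// mulr_ge0// ltW.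
  have [kl'|] := ltnP k (i + t).
    have /andP[h1 h2] := IH ltac:(nlia) k k1 kl'.
    have hi0 : 0 < hi by exact: lt_le_trans lohi.
    apply/andP; split.
      apply: le_trans h1; rewrite ler_pM2l// -natr1; lra.
    apply: le_trans h2 _; rewrite ler_pM2l// -natr1; lra.
  move=> ki; have kE : k = (i + t)%N by nlia.
  set lo' := lo * (1 - 2 * alpha * t%:R); set hi' := hi * (1 + 2 * alpha * t%:R).
  have lo'0 : 0 <= lo' by apply: mulr_ge0; [exact: ltW|lra].
  have [+ _] := hM k ltac:(nlia); move=> /(_ lo' hi' lo'0).
  have hb : forall j, (k <= j + C)%N -> (j < k)%N -> lo' <= rho j <= hi'.
    by move=> j j1 j2; apply: IH; nlia.
  move=> /(_ hb) [s1 s2].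
  have /andP[r1 r2] := hb k.-1 ltac:(nlia) ltac:(nlia).
  have m1 : 0 <= c * (hi' - rho k.-1) by rewrite mulr_ge0 ?subr_ge0// ltW.
  have m2 : 0 <= c * (rho k.-1 - lo') by rewrite mulr_ge0 ?subr_ge0// ltW.
  have hi0 : 0 < hi by exact: lt_le_trans lohi.
  apply/andP; split.
    apply: le_trans s2; apply: (@le_trans _ _ (lo' - alpha * lo')); last by lra.
    have -> : lo' - alpha * lo' = lo * ((1 - 2 * alpha * t%:R) * (1 - alpha)) by rewrite /lo'; ring.
    rewrite ler_pM2l// -natr1.
    have : 0 <= alpha * (2 * alpha * t%:R) by rewrite mulr_ge0// ltW.
    lra.
  apply: le_trans s1 _; apply: (@le_trans _ _ (hi' + alpha * hi')); first by lra.
  have -> : hi' + alpha * hi' = hi * ((1 + 2 * alpha * t%:R) * (1 + alpha)) by rewrite /hi'; ring.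
  rewrite ler_pM2l// -natr1.
  have : alpha * (2 * alpha * t%:R) <= alpha * 1 by rewrite ler_pM2l.
  lra.
set lo' := lo * (1 - beta); set hi' := hi * (1 + beta).
have hi0 : 0 < hi by exact: lt_le_trans lohi.
have b0 : 0 < beta by rewrite /beta !mulr_gt0//; lra.
have lo'0 : 0 < lo' by rewrite mulr_gt0//; lra.
have hi'0 : 0 < hi' by rewrite mulr_gt0//; lra.
have lohi' : lo' <= hi'.
  apply: (@le_trans _ _ lo); first by rewrite /lo' ler_piMr ?ltW//; lra.
  by apply: le_trans lohi _; rewrite /hi' ler_peMr ?ltW//; lra.
have all k : (i <= k + C)%N -> (k < i + C)%N -> lo' <= rho k <= hi'.
  move=> k1 k2; have -> : lo' = lo * (1 - 2 * alpha * C%:R) by rewrite /lo' /beta; ring.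
  have -> : hi' = hi * (1 + 2 * alpha * C%:R) by rewrite /hi' /beta; ring.
  exact: drift.
have st k : (i <= k)%N -> (k < i + C)%N -> rho k <= hi' - c * (hi' - rho k.-1) + alpha * hi' /\
    lo' + c * (rho k.-1 - lo') - alpha * lo' <= rho k.
  move=> k1 k2; have [+ _] := hM k ltac:(nlia); apply; first exact: ltW.
  by move=> j j1 j2; apply: all; nlia.
have cpow t : (t <= C)%N -> c ^+ C <= c ^+ t.
  move=> tC; rewrite ler_wiXn2l ?ltW//; apply: le_lt_trans c_half _; lra.
have ah : 0 <= alpha * hi' by rewrite mulr_ge0// ltW.
have al : 0 <= alpha * lo' by rewrite mulr_ge0// ltW.
have hiE : hi' - lo' = lo * (tau + beta * (2 + tau)).
  by rewrite /hi' /lo' /hi; ring.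
have fin (l h : R) : 0 < l -> lo * (1 - 2 * beta) <= l ->
    h - l <= (1 - kappa) * (hi' - lo') + 4 * (alpha * hi') ->
    (forall k, (i <= k)%N -> (k < i + C)%N -> l <= rho k <= h) ->
    inw (i + C)%N ((1 - kappa / 4) * tau + 16 * (C%:R * alpha)).
  move=> l0 ll hl hk; exists l; split=> // k k1 k2.
  have /andP[-> h2] /= := hk k ltac:(nlia) ltac:(nlia).
  apply: le_trans h2 _; rewrite mulrDr mulr1 -lerBlDl; apply: le_trans hl _.
  apply: (@le_trans _ _ (lo * (1 - 2 * beta) * ((1 - kappa / 4) * tau + 16 * (C%:R * alpha)))); last first.
    rewrite ler_wpM2r// addr_ge0 ?mulr_ge0//; [lra|exact: ltW].
  have -> : 16 * (C%:R * alpha) = 8 * beta by rewrite /beta; ring.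
  rewrite hiE /hi' /hi.
  have -> : (1 - kappa) * (lo * (tau + beta * (2 + tau))) + 4 * (alpha * (lo * (1 + tau) * (1 + beta)))
    = lo * ((1 - kappa) * (tau + beta * (2 + tau)) + 4 * alpha * (1 + tau) * (1 + beta)) by ring.
  rewrite -[leRHS]mulrA ler_pM2l//.
  by apply: window_ineq => //; lra.
have [mid|mid] := leP (rho i.-1) ((lo' + hi') / 2).
  apply: (fin lo' (hi' - kappa * (hi' - lo') + 2 * (alpha * hi'))) => //.
  - by rewrite /lo' ler_pM2l//; lra.
  - lra.
  move=> k k1 k2; have /andP[-> _] /= := all k ltac:(nlia) k2.
  have G t : (t <= C)%N -> c ^+ t * ((hi' - lo') / 2) - 2 * (alpha * hi') <= hi' - rho (i.-1 + t)%N.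
    elim: t => [_|t IH tC]; first by rewrite expr0 mul1r addn0; lra.
    have := IH ltac:(nlia); rewrite addnS => IHt.
    have [s1 _] := st (i.-1 + t).+1 ltac:(nlia) ltac:(nlia); rewrite /= in s1.
    have : c * (c ^+ t * ((hi' - lo') / 2) - 2 * (alpha * hi')) <= c * (hi' - rho (i.-1 + t)%N) by rewrite ler_pM2l.
    have : c * (2 * (alpha * hi')) <= 1 / 2 * (2 * (alpha * hi')) by rewrite ler_wpM2r// mulr_ge0.
    rewrite exprS; lra.
  have := G (k - i).+1 ltac:(nlia); rewrite (_ : (i.-1 + (k - i).+1)%N = k); last by nlia.
  have := cpow (k - i).+1 ltac:(nlia) => cp.
  have : c ^+ C * ((hi' - lo') / 2) <= c ^+ (k - i).+1 * ((hi' - lo') / 2) by rewrite ler_wpM2r// divr_ge0// subr_ge0.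
  rewrite /kappa; lra.
have alo : alpha * lo' <= alpha * hi' by rewrite ler_pM2l.
have kd : 0 <= kappa * (hi' - lo') by rewrite mulr_ge0 ?subr_ge0// ltW.
have lo_low : lo * (1 - 2 * beta) <= lo' - 2 * (alpha * lo').
  rewrite /lo' (_ : lo * (1 - beta) - _ = lo * ((1 - beta) * (1 - 2 * alpha))); last by ring.
  rewrite ler_pM2l//; have : 0 <= beta * alpha by rewrite mulr_ge0// ltW.
  lra.
apply: (fin (lo' + kappa * (hi' - lo') - 2 * (alpha * lo')) hi') => //.
- apply: (@lt_le_trans _ _ (lo * (1 - 2 * beta))); last by lra.
  by rewrite mulr_gt0//; lra.
- lra.
- lra.
move=> k k1 k2; have /andP[_ ->] := all k ltac:(nlia) k2; rewrite andbT.
have G t : (t <= C)%N -> c ^+ t * ((hi' - lo') / 2) - 2 * (alpha * lo') <= rho (i.-1 + t)%N - lo'.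
  elim: t => [_|t IH tC]; first by rewrite expr0 mul1r addn0; lra.
  have := IH ltac:(nlia); rewrite addnS => IHt.
  have [_ s1] := st (i.-1 + t).+1 ltac:(nlia) ltac:(nlia); rewrite /= in s1.
  have : c * (c ^+ t * ((hi' - lo') / 2) - 2 * (alpha * lo')) <= c * (rho (i.-1 + t)%N - lo') by rewrite ler_pM2l.
  have : c * (2 * (alpha * lo')) <= 1 / 2 * (2 * (alpha * lo')) by rewrite ler_wpM2r// mulr_ge0.
  rewrite exprS; lra.
have := G (k - i).+1 ltac:(nlia); rewrite (_ : (i.-1 + (k - i).+1)%N = k); last by nlia.
have := cpow (k - i).+1 ltac:(nlia) => cp.
have : c ^+ C * ((hi' - lo') / 2) <= c ^+ (k - i).+1 * ((hi' - lo') / 2) by rewrite ler_wpM2r// divr_ge0// subr_ge0.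
rewrite /kappa; lra.
Qed.

Let inw_small e : 0 < e -> ev (fun i => inw i e).
Proof.
move=> e0; have kg := kappa_gt0; have kl := kappa_le.
have C0 : 0 < C%:R :> R by rewrite ltr0n; nlia.
set m := Num.min 1 e.
have m0 : 0 < m by rewrite lt_min ltr01.
have m1 : m <= 1 by rewrite ge_min lexx.
have me : m <= e by rewrite ge_min lexx orbT.
(* Chosen so that the limit bound given by [lin_rec] for the recursion of the widths is exactly
   [m]. *)
set alpha := m * kappa / (128 * C%:R).
have al0 : 0 < alpha by apply: divr_gt0; apply: mulr_gt0.
have CaE : C%:R * alpha = m * kappa / 128.
  by rewrite /alpha; field; rewrite gt_eqF.
have mk : m * kappa <= 1 * kappa by rewrite ler_pM2r.
have mk0 : 0 < m * kappa by rewrite mulr_gt0.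
have [M hM] := window_step al0 ltac:(rewrite CaE; lra).
set i0 := (M + (N + C))%N.
have [lo [hi [lo0 hb]]] := @finite_band (fun k => rho (N + k)) (i0 + C) (fun k => rho_gt0 (leq_addr _ _)).
have lohi : lo <= hi by have /andP[] := hb 0%N ltac:(nlia); apply: le_trans.
set tau0 := (hi - lo) / lo.
have tau00 : 0 <= tau0 by rewrite divr_ge0 ?subr_ge0// ltW.
have start r : (r < C)%N -> inw (i0 + r)%N tau0.
  move=> rC; exists lo; split=> // k k1 k2.
  have -> : lo * (1 + tau0) = hi by rewrite /tau0; field; rewrite gt_eqF.
  by have := hb (k - N)%N ltac:(nlia); rewrite subnKC//; nlia.
set q := 1 - kappa / 4; set ee := 16 * (C%:R * alpha).
set tau := fun j => iter j (fun t => q * t + ee) tau0.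
have q0 : 0 <= q by rewrite /q; lra.
have ee0 : 0 < ee by rewrite /ee CaE; lra.
have tau_ge0 j : 0 <= tau j.
  by elim: j => // j IH; rewrite /tau iterS -/(tau j); apply: addr_ge0; [exact: mulr_ge0|exact: ltW].
(* Windows advance by blocks of length [C], so each residue [r] of the starting index is followed
   separately. *)
have all j r : (r < C)%N -> inw (i0 + r + j * C)%N (tau j).
  move=> rC; elim: j => [|j IH]; first by rewrite mul0n addn0; exact: start.
  rewrite mulSn addnCA addnC; apply: (hM _ _ _ (tau_ge0 j) IH); nlia.
have [M2 hM2] := @lin_rec tau q ee 0 ltac:(rewrite /q; lra) q0 ee0 (fun i _ => tau_ge0 i)
   (fun i _ => lexx _).
exists (i0 + M2 * C)%N => i hi'.
have Cn : (0 < C)%N by nlia.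
have := all ((i - i0) %/ C)%N ((i - i0) %% C)%N ltac:(by rewrite ltn_mod).
rewrite -addnA (addnC (_ %% _)%N) -divn_eq subnKC; last by nlia.
have hm : (M2 <= (i - i0) %/ C)%N by rewrite leq_divRL//; nlia.
have := hM2 _ hm; set t := tau _ => ht [l [l0 hl]]; exists l; split=> // k k1 k2.
have /andP[-> h2] /= := hl k k1 k2; apply: le_trans h2 _.
rewrite ler_pM2l// lerD2l; apply: le_trans ht _.
have -> : 2 * ee / (1 - q) = m; last exact: me.
rewrite /ee /q CaE (_ : 1 - (1 - kappa / 4) = kappa / 4); last by ring.
by field; rewrite gt_eqF.
Qed.

(** [h] compares the global quotient n / v with the local slope [rho]. The slope varies slowly and
    each increment of [v] is a fixed fraction of [v], so [h - 1] obeys a contracting recursion and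
    tends to 0; the difference of the two ratios is a bounded multiple of [(1 - h i) / h i]. *)
Lemma ratio_asymp e : 0 < e -> ev (fun i => `|n i.+1 / n i - v i.+1 / v i| <= e).
Proof.
move=> e0; have cg := c_gt0; have ch := c_half.
set h := fun i => n i / v i / rho i.
have hc : forall e, 0 < e -> ev (fun i => `|h i - 1| <= e).
  apply: (@lin_rec0 (fun i => `|h i - 1|) (1 - c / 2)) => //; [lra|lra|].
  move=> {e0}e' e'0; set m := Num.min (c / 2) e'.
  have m0 : 0 < m by rewrite lt_min e'0 andbT; lra.
  have mc : m <= c / 2 by rewrite ge_min lexx.
  have me : m <= e' by rewrite ge_min lexx orbT.
  have := ev_and (ev_shift 2 (inw_small m0)) (ev_ge N); apply: ev_imp => i [[lo [lo0 hl]] Ni].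
  have Ni1 : (N <= i.+1)%N by nlia.
  have /andP[a1 a2] := hl i ltac:(nlia) ltac:(nlia).
  have /andP[b1 b2] := hl i.+1 ltac:(nlia) ltac:(nlia).
  have r0 := rho_gt0 Ni; have r1 := rho_gt0 Ni1.
  have v0 := v_pos i; have v1 := v_pos i.+1; have D0 := D_gt0 Ni.
  set r := rho i / rho i.+1; set w := D i / v i.+1.
  have E : h i.+1 - 1 = r * ((1 - w) * (h i - 1)) + (r - 1).
    have nE : n i.+1 = n i + rho i * D i by rewrite rhoD//; ring.
    have DE : D i = v i.+1 - v i by [].
    rewrite /h /r /w nE DE; field.
    by rewrite !gt_eqF.
  have wc : c <= w.
    rewrite /w ler_pdivlMr//; have := v_grow Ni; have := v_le2 Ni.
    move=> l2 g2; rewrite -/(D i) in g2; rewrite /c; apply: le_trans g2.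
    have : eta * v i.+1 <= eta * (2 * v i) by rewrite ler_pM2l.
    lra.
  have w1 : w <= 1 by rewrite /w ler_pdivrMr// mul1r /D; lra.
  have rr : `|r - 1| <= m.
    have lm : lo * m <= m * rho i.+1 by rewrite mulrC ler_pM2l.
    have -> : r - 1 = (rho i - rho i.+1) / rho i.+1 by rewrite /r; field; rewrite gt_eqF.
    rewrite normrM normfV (gtr0_norm r1) ler_pdivrMr// ler_norml; lra.
  have r_le : `|r| <= 1 + c / 2.
    rewrite (_ : r = (r - 1) + 1); last by ring.
    apply: le_trans (ler_normD _ _) _; rewrite normr1; lra.
  rewrite E; apply: le_trans (ler_normD _ _) _; apply: lerD; last exact: le_trans rr me.
  rewrite normrM [X in _ * X]normrM mulrA ler_wpM2r// (ger0_norm (_ : 0 <= 1 - w)); last by lra.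
  apply: (@le_trans _ _ ((1 + c / 2) * (1 - c))).
    by apply: ler_pM; [exact: normr_ge0|rewrite subr_ge0|exact: r_le|exact: lerB].
  have : 0 <= c * c by rewrite mulr_ge0// ltW.
  lra.
set d := Num.min (1 / 2) (e / 2).
have d0 : 0 < d by rewrite lt_min; lra.
have d1 : d <= 1 / 2 by rewrite ge_min lexx.
have d2 : d <= e / 2 by rewrite ge_min lexx orbT.
have := ev_and (hc d d0) (ev_ge N); apply: ev_imp => i [hi Ni].
have r0 := rho_gt0 Ni; have v0 := v_pos i; have n0 := n_pos i; have D0 := D_gt0 Ni.
have h0 : 0 < h i by rewrite /h; apply: divr_gt0 => //; exact: divr_gt0.
have nE : n i.+1 = n i + rho i * D i by rewrite rhoD//; ring.
have DE : v i.+1 = v i + D i by rewrite /D; ring.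
have -> : n i.+1 / n i - v i.+1 / v i = (D i / v i) * ((1 - h i) / h i).
  by rewrite nE DE /h; field; rewrite !gt_eqF.
have h12 : 1 / 2 <= h i by move: hi; rewrite ler_norml; lra.
rewrite normrM -[e]mul1r; apply: ler_pM => //.
  rewrite gtr0_norm ?divr_gt0// ler_pdivrMr// mul1r.
  have := v_le2 Ni; rewrite DE; lra.
rewrite normrM normfV (gtr0_norm h0) ler_pdivrMr// distrC.
apply: le_trans hi _; apply: (@le_trans _ _ (e * (1 / 2))); first by lra.
by rewrite ler_pM2l.
Qed.

End Contraction.

(** * Palindromic prefixes *)

Section Enumeration.
Local Open Scope nat_scope.
Variable P : pred nat.
Hypothesis P_inf : forall n, exists m, (n < m) && P m.

(** Same bodies as [next_pal] and [pal_len] for an arbitrary predicate, so that [pal_len] is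
    convertible to an instance. *)
Definition nxt (Q : pred nat) (n : nat) : nat :=
  if pselect (exists m, (n < m) && Q m) is left h then ex_minn h else 0.
Definition nthsat (Q : pred nat) (i : nat) : nat := iter i.+1 (nxt Q) 0.

Lemma nxtP n : [/\ n < nxt P n, P (nxt P n) & forall m, n < m -> P m -> nxt P n <= m].
Proof.
rewrite /nxt; case: pselect => [h|/(_ (P_inf n))//].
case: ex_minnP => m /andP[nm Pm] hm; split=> // k nk Pk.
by apply: hm; rewrite nk.
Qed.

Lemma nthsat_sat i : P (nthsat P i). Proof. by have [] := nxtP (iter i (nxt P) 0). Qed.
Lemma nthsat_lt i : nthsat P i < nthsat P i.+1.
Proof. by have [] := nxtP (iter i.+1 (nxt P) 0). Qed.
Lemma nthsat_min i m : nthsat P i < m -> P m -> nthsat P i.+1 <= m.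
Proof. by have [_ _] := nxtP (iter i.+1 (nxt P) 0); apply. Qed.
Lemma nthsat_min0 m : 0 < m -> P m -> nthsat P 0 <= m.
Proof. by have [_ _] := nxtP 0; apply. Qed.
Lemma nthsat_gt i : i < nthsat P i.
Proof.
elim: i => [|i IH]; first by have [] := nxtP 0.
exact: leq_ltn_trans IH (nthsat_lt i).
Qed.
Lemma nthsat_mono i j : i < j -> nthsat P i < nthsat P j.
Proof.
elim: j => // j IH; rewrite ltnS leq_eqVlt => /orP[/eqP ->|/IH h]; first exact: nthsat_lt.
exact: ltn_trans h (nthsat_lt j).
Qed.
Lemma nthsat_bracket i0 m : nthsat P i0 <= m ->
  exists i, [/\ i0 <= i, nthsat P i <= m & m < nthsat P i.+1].
Proof.
move=> h0.
have ex : exists i, nthsat P i <= m by exists i0.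
have ub i : nthsat P i <= m -> i <= m by apply: leq_trans; rewrite ltnW// nthsat_gt.
case: (ex_maxnP ex ub) => i hi hmax; exists i; split=> //; first exact: hmax.
by rewrite ltnNge; apply/negP => /hmax; rewrite ltnn.
Qed.
Lemma nthsat_ex m : 0 < m -> P m -> exists i, nthsat P i = m.
Proof.
move=> m0 Pm; have [i [_ h1 h2]] := nthsat_bracket (nthsat_min0 m0 Pm).
exists i; apply/eqP; rewrite eqn_leq h1 /= leqNgt; apply/negP => /nthsat_min /(_ Pm).
by rewrite leqNgt h2.
Qed.
Lemma nthsat_eq (s : nat -> nat) : 0 < s 0 -> (forall i, s i < s i.+1) ->
  (forall i, P (s i)) -> (forall m, 0 < m -> P m -> exists i, s i = m) ->
  forall i, nthsat P i = s i.
Proof.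
move=> s0 s_lt sP s_ex.
have s_mono i j : i < j -> s i < s j.
  elim: j => // j IH; rewrite ltnS leq_eqVlt => /orP[/eqP ->//|/IH h].
  exact: ltn_trans h (s_lt j).
have s_le i j : i <= j -> s i <= s j.
  by rewrite leq_eqVlt => /orP[/eqP ->//|/s_mono/ltnW].
elim=> [|i IH].
  apply/eqP; rewrite eqn_leq nthsat_min0//=.
  have [j <-] := s_ex _ (leq_ltn_trans (leq0n _) (nthsat_gt 0)) (nthsat_sat 0).
  exact: s_le.
apply/eqP; rewrite eqn_leq; apply/andP; split.
  by apply: nthsat_min; rewrite ?IH.
have [j hj] := s_ex _ (leq_ltn_trans (leq0n _) (nthsat_gt i.+1)) (nthsat_sat i.+1).
rewrite -hj; apply: (s_le i.+1 j); rewrite ltnNge; apply/negP => /s_le; rewrite hj -IH leqNgt.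
by rewrite nthsat_lt.
Qed.
End Enumeration.

Lemma pal_len_nthsat (A : finType) (w : nat -> A) i : pal_len w i = nthsat (pal_prefix w) i.
Proof. by []. Qed.

Section Palindromes.
Local Open Scope nat_scope.
Variables (A : finType) (w : nat -> A).

Lemma pal_prefixP n :
  reflect (forall i, i < n -> w i = w (n - i.+1)) (pal_prefix w n).
Proof.
have sz : size (mkseq w n) = n by rewrite size_mkseq.
apply: (iffP eqP) => [e i hi|h].
  have := congr1 (fun s => nth (w 0) s i) e.
  by rewrite nth_rev sz// !nth_mkseq//; lia.
apply: (@eq_from_nth _ (w 0)); first by rewrite size_rev.
by move=> i; rewrite sz => hi; rewrite nth_rev sz// nth_mkseq// nth_mkseq; [exact: h|lia].
Qed.

Lemma pal_period a b : pal_prefix w a -> pal_prefix w b -> a <= b ->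
  forall i, i < a -> w (i + (b - a)) = w i.
Proof.
move=> /pal_prefixP pa /pal_prefixP pb ab i ia.
rewrite (pa i ia) (pb (a - i.+1)); last by lia.
by congr w; lia.
Qed.

(** The prefix of length [b] has period [b - a], and removing one period from the palindrome of
    length [a] leaves a palindrome. *)
Lemma pal_reflect a b : pal_prefix w a -> pal_prefix w b -> a <= b -> b <= 2 * a ->
  pal_prefix w (2 * a - b).
Proof.
move=> pa pb ab b2; apply/pal_prefixP => i hi.
have h1 := pal_period pa pb ab (i := 2 * a - b - i.+1) ltac:(lia).
move/pal_prefixP: pa => pa; rewrite (pa i) -?h1; last by lia.
by congr w; lia.
Qed.

End Palindromes.

(** * Limits superior in terms of eventual bounds *)

Section Limsup.
Variable R : realType.
Implicit Types u : nat -> R.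
Local Open Scope ereal_scope.

Lemma limn_esup_ev_le u r : ev (fun i => (u i <= r)%R) ->
  limn_esup (fun i => (u i)%:E) <= r%:E.
Proof.
move=> [N hN]; rewrite limn_esup_lim.
have -> : limn (esups (fun i => (u i)%:E)) = ereal_inf (range (esups (fun i => (u i)%:E))).
  by apply/cvg_lim => //; exact: cvg_esups_inf.
apply: (@le_trans _ _ (esups (fun i => (u i)%:E) N)).
  by apply: ereal_inf_lbound; exists N.
by apply: ge_ereal_sup => _ [k /= hk <-]; rewrite lee_fin; exact: hN.
Qed.

Lemma limn_esup_lt_ev u r : limn_esup (fun i => (u i)%:E) < r%:E ->
  ev (fun i => (u i <= r)%R).
Proof.
rewrite limn_esup_lim.
have -> : limn (esups (fun i => (u i)%:E)) = ereal_inf (range (esups (fun i => (u i)%:E))).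
  by apply/cvg_lim => //; exact: cvg_esups_inf.
move=> /ereal_inf_lt [_ [N _ <-]] h; exists N => i Ni; rewrite -lee_fin.
apply: le_trans (ltW h); apply: ereal_sup_ubound; by exists i.
Qed.

Lemma limn_esup_eq u (b : R) :
  (forall r, (b < r)%R -> ev (fun i => (u i <= r)%R)) ->
  (forall r, (r < b)%R -> ~ ev (fun i => (u i <= r)%R)) ->
  limn_esup (fun i => (u i)%:E) = b%:E.
Proof.
move=> h1 h2; apply/eqP; rewrite eq_le; apply/andP; split.
  apply/lee_addgt0Pr => e e0; rewrite -EFinD; apply: limn_esup_ev_le; apply: h1.
  by rewrite ltrDl.
rewrite leNgt; apply/negP => hlt.
have [r r1 r2] : exists2 r : R, limn_esup (fun i => (u i)%:E) < r%:E & (r < b)%R.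
  move: hlt; case: (limn_esup _) => [s|//|_].
    rewrite lte_fin => sb; exists ((s + b) / 2)%R; rewrite ?lte_fin; lra.
  by exists (b - 1)%R; rewrite ?ltNyr//; lra.
exact: (h2 r r2 (limn_esup_lt_ev r1)).
Qed.

End Limsup.

(** * Exponents and lists of good approximations *)

Section Beta.
Variables (R : realType) (xi : R).
Local Notation lnht := (@lnht R).
Local Notation ht := (@ht R).
Local Notation Lp := (Lp xi).
Local Notation lcst := (lcst xi).
Local Notation kap := (kap xi).
Local Notation qual := (qual xi).

Definition good (eps : R) (p : pt) := 0 < c0 p /\ Lp p <= expR ((eps - 1) * lnht p).

Lemma good_qual eps m p : good eps p -> eps * lnht p <= m -> qual m p.
Proof. by move=> [p0 h] hm; split=> //; apply: le_trans h _; rewrite ler_expR; lra. Qed.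

Lemma qual_good eps m p : qual m p -> m <= eps * lnht p -> good eps p.
Proof. by move=> [p0 h] hm; split=> //; apply: le_trans h _; rewrite ler_expR; lra. Qed.

Lemma lnht_lt p q : 0 < c0 p -> 0 < c0 q -> (lnht p < lnht q) = (c0 p < c0 q).
Proof. by move=> p0 q0; rewrite /lnht ltr_ln ?posrE ?ht_gt0// /ht ltr_int. Qed.

Lemma lnht_le p q : 0 < c0 p -> 0 < c0 q -> (lnht p <= lnht q) = (c0 p <= c0 q).
Proof. by move=> p0 q0; rewrite /lnht ler_ln ?posrE ?ht_gt0// /ht ler_int. Qed.

(** Logarithmic form of [beta_set], with B = exp u, reduced to primitive points with positive first
    coordinate. *)
Definition cov (eps b : R) := exists u0, forall u, u0 <= u -> exists z,
  [/\ primitive z, good eps z, lnht z <= u & Lp z <= expR (- (u / b))].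

(** Removing the content increases neither the height nor [Lp], and since [eps < 1] a smaller height
    only relaxes the bound with exponent [eps - 1]. *)
Lemma beta_set_cov eps b : eps < 1 -> beta_set xi eps b -> cov eps b.
Proof.
move=> e1 [b0 [M [_ hM]]]; exists (ln (`|M| + 1)) => u hu.
have M0 : 0 < `|M| + 1 by rewrite ltr_wpDl.
have hB : M < expR u.
  apply: (@lt_le_trans _ _ (`|M| + 1)); first by rewrite (le_lt_trans (ler_norm M))// ltrDl.
  by rewrite -[leLHS]lnK ?posrE// ler_expR.
have [x0 [x1 [x2 [/andP[h1 h2] hL]]]] := hM _ hB.
have x00 : c0 (Pt x0 x1 x2) != 0.
  by apply: contraTneq h1 => /= ->; rewrite normr0 -ltNge.
have [g [z [g0 z0 zp e]]] := primitive_part x00.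
have g1 := @intr_ge1 R g g0.
have Lz : Lp z <= approx_L xi x0 x1 x2.
  have -> : approx_L xi x0 x1 x2 = Lp (Pt x0 x1 x2) by [].
  by rewrite e Lp_scalpt ler_peMl ?Lp_ge0.
have hz : ht z <= `|x0%:~R : R|.
  have -> : x0 = g * c0 z by have /(congr1 c0) := e.
  rewrite intrM normrM [X in _ * X]ger0_norm; last by rewrite ltW// ht_gt0.
  by apply: ler_peMl => //; rewrite ltW// ht_gt0.
have vz : lnht z <= ln `|x0%:~R : R|.
  by rewrite /lnht ler_ln ?posrE ?ht_gt0// (lt_le_trans _ h1).
have x0n : `|x0%:~R : R| != 0 by rewrite gt_eqF// (lt_le_trans _ h1).
move: hL; rewrite le_min => /andP[L1 L2].
exists z; split=> //.
- split=> //; apply: le_trans Lz _; apply: le_trans L2 _.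
  rewrite /powR (negbTE x0n) ler_expR.
  by rewrite ler_wnM2l//; lra.
- apply: le_trans vz _; rewrite -(expRK u) ler_ln ?posrE ?expR_gt0//.
  by rewrite (lt_le_trans _ h1).
- apply: le_trans Lz _; apply: le_trans L1 _.
  by rewrite /powR gt_eqF ?expR_gt0// expRK mulNr mulrC.
Qed.

Lemma cov_le eps b b' : 0 < b -> b <= b' -> cov eps b -> cov eps b'.
Proof.
move=> b0 bb [u0 h]; exists (Num.max u0 0) => u; rewrite ge_max => /andP[h1 h2].
have [z [a1 a2 a3 a4]] := h u h1; exists z; split=> //.
apply: le_trans a4 _; rewrite ler_expR lerN2.
by apply: ler_wpM2l => //; rewrite lef_pV2 ?posrE// (lt_le_trans b0).
Qed.

Lemma inc_ge (x : nat -> pt) : (forall i, 0 < c0 (x i)) ->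
  (forall i, c0 (x i) < c0 (x i.+1)) -> forall i, i%:R <= ht (x i).
Proof.
move=> x0 xi' i; rewrite -[i%:R]/(i%:~R : R) /ht ler_int; elim: i => [|i IH].
  exact: ltW.
have := xi' i; lia.
Qed.

Lemma inc_mono (x : nat -> pt) : (forall i, c0 (x i) < c0 (x i.+1)) ->
  forall i j, (i < j)%N -> c0 (x i) < c0 (x j).
Proof.
move=> h i; elim=> // j IH; rewrite ltnS leq_eqVlt => /orP[/eqP ->//|/IH hij].
exact: lt_trans hij (h j).
Qed.

Lemma list_beta_set (x : nat -> pt) (rho b eps : R) :
  (forall i, 0 < c0 (x i)) -> (forall i, c0 (x i) < c0 (x i.+1)) ->
  (forall e, 0 < e -> ev (fun i => good e (x i))) ->
  ev (fun i => lnht (x i.+1) <= rho * lnht (x i)) -> 0 < rho -> rho < b -> 0 < eps ->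
  beta_set xi eps b.
Proof.
move=> x0 xinc xg xr rho0 rb eps0; have b0 : 0 < b by lra.
split=> //.
(* With this choice the exponent [1 - e] of approximation is at least [rho / b], which is what a
   point must offer to serve all B up to the next height. *)
set e := Num.min eps (1 - rho / b).
have rb1 : rho / b < 1 by rewrite ltr_pdivrMr// mul1r.
have e0 : 0 < e by rewrite lt_min eps0; lra.
have e1 : e <= eps by rewrite ge_min lexx.
have e2 : e <= 1 - rho / b by rewrite ge_min lexx orbT.
have [N hN] := ev_and (xg e e0) xr.
exists (ht (x N)); split; first by rewrite num_real.
move=> B hB.
have B0 : 0 < B by apply: lt_trans hB; exact: ht_gt0.
have ex : exists i, ht (x i) <= B by exists N; exact: ltW.
have [m hm] := archi_nat B.
have ub i : ht (x i) <= B -> (i <= m)%N.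
  move=> hi; rewrite -(ler_nat R); apply: le_trans (inc_ge x0 xinc i) _.
  by apply: le_trans hi _; exact: ltW.
case: (ex_maxnP ex ub) => i hi hmax.
have Ni : (N <= i)%N by apply: hmax; exact: ltW.
have hi1 : B < ht (x i.+1).
  by rewrite ltNge; apply/negP => /hmax; rewrite ltnn.
have [[_ gi] ri] := hN i Ni.
have vi := @lnht_ge0 R _ (x0 i).
exists (c0 (x i)), (c1 (x i)), (c2 (x i)).
have -> : `|(c0 (x i))%:~R : R| = ht (x i) by rewrite ger0_norm// ltW// ht_gt0.
split; first by rewrite hi ht_ge1.
rewrite le_min; apply/andP; split.
  apply: le_trans gi _; rewrite /powR gt_eqF// ler_expR.
  have lB : ln B <= rho * lnht (x i).
    by apply: le_trans ri; rewrite ler_ln ?posrE ?ht_gt0// ltW.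
  have : b^-1 * ln B <= b^-1 * (rho * lnht (x i)) by rewrite ler_pM2l// invr_gt0.
  have : rho / b * lnht (x i) <= (1 - e) * lnht (x i) by rewrite ler_wpM2r//; lra.
  lra.
apply: le_trans gi _; rewrite /powR gt_eqF ?ht_gt0// ler_expR.
by rewrite ler_wpM2r//; lra.
Qed.

Definition indep := forall a b c : int,
  a%:~R + b%:~R * xi + c%:~R * xi ^+ 2 = 0 :> R -> [/\ a = 0, b = 0 & c = 0].

(** At each height, [Lp] is at least the distance from [ht z * xi] to the integers, nonzero by
    independence; finitely many heights share a positive bound. *)
Lemma irr_lower_nat (N : nat) : indep -> exists2 m : R, 0 < m &
  forall z, 0 < c0 z -> ht z <= N%:R -> m <= Lp z.
Proof.
move=> ind; elim: N => [|N [m m0 IH]].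
  exists 1 => // z z0; have := @ht_ge1 R _ z0; lra.
set y := N.+1%:R * xi.
set f := Num.floor y.
have fy : f%:~R <= y by exact: floor_le_tmp.
have fy1 : y < (f + 1)%:~R by exact: floorD1_gt.
have yn : f%:~R != y.
  apply/eqP => e; have [] := ind (- f) N.+1%:Z 0.
    rewrite mulr0z mul0r addr0 intrN e /y; ring.
  by move=> _ /eqP; rewrite eqz_nat.
exists (Num.min m (Num.min (y - f%:~R) ((f + 1)%:~R - y))).
  by rewrite !lt_min m0 !subr_gt0 fy1 lt_neqAle yn fy.
move=> z z0 hz.
have [hz'|hz'] := leP (ht z) N%:R; first by rewrite ge_min IH.
have zE : c0 z = N.+1%:Z.
  move: hz hz'; rewrite /ht -[N.+1%:R]/(N.+1%:~R : R) -[N%:R]/(N%:~R : R) ler_int ltr_int; lia.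
have hE : (c0 z)%:~R * xi = y by rewrite zE.
rewrite !ge_min; apply/orP; right.
have hL : `|y - (c1 z)%:~R| <= Lp z by rewrite -hE /Lp /approx_L le_max lexx.
have [h|h] := lerP (c1 z) f.
  apply/orP; left; apply: le_trans hL; apply: le_trans (ler_norm _).
  by rewrite lerB// ler_int.
apply/orP; right; apply: le_trans hL; rewrite distrC; apply: le_trans (ler_norm _).
by rewrite lerB// ler_int; lia.
Qed.

Lemma irr_lower (V : R) : indep -> exists u0 : R,
  forall z u, 0 < c0 z -> u0 <= u -> Lp z <= expR (- u) -> V < lnht z.
Proof.
move=> ind; have [N hN] := archi_nat (expR V).
have [m m0 hm] := irr_lower_nat N ind.
exists (1 - ln m) => z u z0 hu hL; rewrite ltNge; apply/negP => hV.
have h1 : ht z <= N%:R.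
  by rewrite -expR_lnht//; apply: le_trans (ltW hN); rewrite ler_expR.
have := le_trans (hm z z0 h1) hL; rewrite -[leLHS]lnK ?posrE// ler_expR; lra.
Qed.

(** The covering property is applied just below the next point, at [u = lnht (x i.+1) - ln 2]. The
    point found is some [x l] with [l <= i], and since its discriminant is nonzero, so small an [Lp]
    forces its logarithmic height to be at least [u / b - lcst]. *)
Lemma list_ratio (x : nat -> pt) (eps b V0 : R) N : indep -> 0 < b -> cov eps b ->
  (forall i, 0 < c0 (x i)) -> (forall i, c0 (x i) < c0 (x i.+1)) ->
  (forall z, primitive z -> good eps z -> V0 <= lnht z -> exists i, z = x i) ->
  (forall i, (N <= i)%N -> disc (x i) != 0) ->
  exists c, ev (fun i => lnht (x i.+1) <= b * lnht (x i) + c).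
Proof.
move=> ind b0 [u0 hcov] x0 xinc xc xd; exists (b * lcst + ln 2).
have [u1 hu1] := irr_lower (Num.max V0 (lnht (x N))) ind.
have [M hM] := archi_nat (expR (Num.max u0 (Num.max (b * u1) 0) + ln 2)).
exists M => i Mi.
have vi : Num.max u0 (Num.max (b * u1) 0) + ln 2 <= lnht (x i.+1).
  rewrite -[leLHS]expRK ler_ln ?posrE ?expR_gt0 ?ht_gt0//.
  apply: le_trans (ltW hM) _; apply: le_trans (inc_ge x0 xinc i.+1).
  by rewrite ler_nat; nlia.
set u := lnht (x i.+1) - ln 2.
have hu : Num.max u0 (Num.max (b * u1) 0) <= u by rewrite /u; lra.
move: hu; rewrite !ge_max => /and3P[h1 h2 h3].
have [z [zp zg zu zL]] := hcov u h1; have [z0 _] := zg.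
have ub : u1 <= u / b by rewrite ler_pdivlMr// mulrC.
have := hu1 z _ z0 ub zL; rewrite gt_max => /andP[vz vN].
have [l zl] := xc z zp zg (ltW vz).
have Nl : (N <= l)%N.
  rewrite leqNgt; apply/negP => /(inc_mono xinc); rewrite -zl -lnht_lt//.
  by move/lt_trans => /(_ _ vN); rewrite ltxx.
have li : (l <= i)%N.
  rewrite leqNgt; apply/negP; rewrite -ltnS => il.
  have ln2 : 0 < ln 2 :> R by rewrite ln_gt0// ltr1n.
  have : lnht z < lnht (x i.+1) by apply: le_lt_trans zu _; rewrite /u; lra.
  rewrite lnht_lt// zl ltNge => /negP; apply.
  by move: il; rewrite leq_eqVlt ltnS => /orP[/eqP[<-]//|/(inc_mono xinc)/ltW]//.
have dz : disc z != 0 by rewrite zl xd.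
have := lnht_lower z0 dz zL ltac:(by rewrite divr_ge0// ltW).
have vzi : lnht z <= lnht (x i).
  rewrite lnht_le// zl; move: li; rewrite leq_eqVlt => /orP[/eqP ->//|/(inc_mono xinc)/ltW]//.
rewrite ler_pdivrMr// => h.
have : (lnht z + lcst) * b <= (lnht (x i) + lcst) * b by rewrite ler_pM2r// lerD2r.
rewrite /u in h; lra.
Qed.

(** A good point [x] of zero discriminant is compared with the point [t] covering half its height.
    As 1/b > 1/2, the products of heights and deviations stay below the square root of [ht x], so
    [isotropic_collinear] makes the two primitive points equal, against their heights. *)
Lemma disc_neq0 (eps b : R) : eps <= 1 / 4 -> 0 < b -> b < 2 -> cov eps b ->
  exists V0, forall z, primitive z -> good eps z -> V0 <= lnht z -> disc z != 0.
Proof.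
move=> e4 b0 b2 [u0 hcov].
have k1 := kap_ge1 xi; have k0 := kap_gt0 xi.
have lk : 0 <= ln kap by rewrite ln_ge0.
have l2 : 0 < ln 2 :> R by rewrite ln_gt0// ltr1n.
have l8 : 0 < ln 8 :> R by rewrite ln_gt0// ltr1n.
set gam := b^-1 - 1 / 2.
have gam0 : 0 < gam.
  rewrite /gam subr_gt0 div1r ltf_pV2 ?posrE//.
exists (Num.max (u0 + ln 2) (Num.max (4 * ln 8) ((ln 8 + ln kap + b^-1 * ln 2) / gam))).
move=> x xp [x0 xg]; rewrite !ge_max => /and3P[h1 h2 h3].
apply/eqP => dx.
set v := lnht x in xg h1 h2 h3.
have [t [tp [t0 tg] tu tL]] := hcov (v - ln 2) ltac:(lra).
have hg : ln 8 + ln kap + b^-1 * ln 2 <= gam * v by rewrite [leRHS]mulrC -ler_pdivrMr//.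
have XE : ht x = expR v by rewrite expR_lnht.
have X1 := @ht_ge1 R _ x0.
have e8 : expR (- ln 8) = 1 / 8 :> R by rewrite expRN lnK ?posrE// div1r.
have B1 : ht t * Lp x <= 1 / 8 * expR (v / 2).
  have hT : ht t <= expR v by rewrite -expR_lnht// ler_expR; lra.
  apply: (@le_trans _ _ (expR v * expR ((eps - 1) * v))).
    by apply: ler_pM => //; [rewrite ltW// ht_gt0|exact: Lp_ge0].
  rewrite -e8 -!expRD ler_expR.
  have : eps * v <= 1 / 4 * v by rewrite ler_wpM2r// lnht_ge0.
  lra.
have B2 : kap * (ht x * Lp t) <= 1 / 8 * expR (v / 2).
  apply: (@le_trans _ _ (expR (ln kap) * (expR v * expR (- ((v - ln 2) / b))))).
    by rewrite lnK ?posrE// XE ler_pM2l// ler_pM2l ?expR_gt0.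
  rewrite -e8 -!expRD ler_expR; rewrite /gam in hg; lra.
have E2 : expR (v / 2) ^+ 2 = ht x by rewrite XE expr2 -expRD; congr expR; lra.
have Ev := expR_gt0 (v / 2).
have Lx0 := Lp_ge0 xi x; have Lt0 := Lp_ge0 xi t.
have Lx1 : Lp x <= 1.
  apply: le_trans xg _; rewrite -[leRHS]expR0 ler_expR.
  have := @lnht_ge0 R _ x0; rewrite -/v => v0.
  have : (eps - 1) * v <= 0 by rewrite mulr_le0_ge0//; lra.
  by [].
have B0 : 0 <= ht x * Lp t by rewrite mulr_ge0//; lra.
have B2' : ht x * Lp t <= 1 / 8 * expR (v / 2).
  by apply: le_trans B2; apply: ler_peMl.
have sm (s : R) : 0 <= s -> s <= 1 / 4 * expR (v / 2) -> s ^+ 2 < ht x.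
  move=> s0 hs; by rewrite -E2 -subr_gt0 subr_sqr mulr_gt0//; lra.
have col : collinear x t.
  apply: (@isotropic_collinear R xi) => //; apply: sm.
  - apply: addr_ge0 => //; apply: mulr_ge0 => //; exact/ltW/ht_gt0.
  - lra.
  - by apply: addr_ge0; apply: mulr_ge0 => //; [exact: ltW|exact: mulr_ge0|exact: ltW].
  have : kap * (Lp x * Lp t) <= kap * (ht x * Lp t).
    by rewrite ler_pM2l// ler_wpM2r// (le_trans Lx1).
  lra.
have := primitive_collinear xp tp x0 t0 col => e.
move: tu; rewrite -e -/v; lra.
Qed.

End Beta.

(** * Runs of coplanar points *)

Section Runs.
Variables (R : realType) (xi : R).
Local Notation lnht := (@lnht R).
Local Notation ht := (@ht R).
Local Notation Lp := (Lp xi).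
Local Notation lcst := (lcst xi).
Local Notation qual := (qual xi).
Local Notation good := (good xi).

(** A point [z] inserted between [p] and [p'] allows [gap] to be used for each of the two pairs
    against the same outside point [s]; adding the results produces the factor 2. *)
Lemma double_gap m a a' s q p z p' : ~ collinear a a' -> det3 a a' s != 0 ->
  det3 a a' q = 0 -> det3 a a' p = 0 -> det3 a a' z = 0 -> det3 a a' p' = 0 ->
  ~ collinear p z -> ~ collinear z p' ->
  qual m p -> qual m z -> qual m p' -> qual m q -> qual m s ->
  lnht p <= lnht z -> lnht z <= lnht p' -> lnht s <= lnht q ->
  2 * lnht s <= lnht p' - lnht p + 4 * m + 2 * lcst.
Proof.
move=> na ds dq dp dz dp' n1 n2 Qp Qz Qp' Qq Qs v1 v2 v3.
have key u w : ~ collinear u w -> det3 a a' u = 0 -> det3 a a' w = 0 -> det3 u w s != 0.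
  move=> nuw du dw; apply: contraNneq ds => duw; apply/eqP.
  by apply: (coplanar3 nuw) => //; apply: (coplanar3 na) => //; rewrite ?det3aba ?det3baa.
have E : Num.min (2 * lnht q - lnht s) (lnht s) = lnht s.
  by apply/min_idPr; lra.
have g1 := gap Qp Qz Qq Qs v1 (coplanar3 na dp dz dq) (key _ _ n1 dp dz).
have g2 := gap Qz Qp' Qq Qs v2 (coplanar3 na dz dp' dq) (key _ _ n2 dz dp').
rewrite E in g1 g2; lra.
Qed.

(** A run is a block of successive coplanar points. The last field says that no plane through two
    successive points contains all later ones, so that every run ends. *)
Record runlist (x : nat -> pt) (eps b : R) (N0 : nat) : Prop := RunList {
  rl_pos : forall i, 0 < c0 (x i);
  rl_inc : forall i, c0 (x i) < c0 (x i.+1);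
  rl_prim : forall i, primitive (x i);
  rl_good : forall i, (N0 <= i)%N -> good eps (x i);
  rl_disc : forall i, (N0 <= i)%N -> disc (x i) != 0;
  rl_rat : forall i, (N0 <= i)%N -> lnht (x i.+1) <= b * lnht (x i);
  rl_np : forall k, exists i, (k < i)%N && (det3 (x k) (x k.+1) (x i) != 0) }.

Section Run.
Variables (x : nat -> pt) (eps b : R) (N0 : nat).
Hypothesis rl : runlist x eps b N0.
Hypothesis b1 : 1 < b.
Hypothesis b2 : b < 2.
Hypothesis eps_ge0 : 0 <= eps.
Hypothesis eps_le : 16 * eps <= 2 - b.

Local Notation V i := (lnht (x i)).
Let x0 i : 0 < c0 (x i). Proof. by case: rl. Qed.
Let xinc i : c0 (x i) < c0 (x i.+1). Proof. by case: rl. Qed.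
Let xprim i : primitive (x i). Proof. by case: rl. Qed.
Let xgood i : (N0 <= i)%N -> good eps (x i). Proof. by case: rl => ? ? ? + *; apply. Qed.
Let xrat i : (N0 <= i)%N -> V i.+1 <= b * V i. Proof. by case: rl => ? ? ? ? ? + *; apply. Qed.
Let nonplanar k : exists i, (k < i)%N && (det3 (x k) (x k.+1) (x i) != 0).
Proof. by case: rl. Qed.

Lemma V_lt i j : (i < j)%N -> V i < V j.
Proof. by move=> ij; rewrite lnht_lt// inc_mono. Qed.

Lemma V_le i j : (i <= j)%N -> V i <= V j.
Proof. by rewrite leq_eqVlt => /orP[/eqP ->//|/V_lt/ltW]. Qed.

Lemma V_ge0 i : 0 <= V i. Proof. exact: lnht_ge0. Qed.

Lemma V_large M : ev (fun i => M <= V i).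
Proof.
have [n hn] := archi_nat (expR M); exists n => i ni.
rewrite -[leLHS]expRK ler_ln ?posrE ?expR_gt0 ?ht_gt0//.
apply: le_trans (ltW hn) _; apply: le_trans (inc_ge R x0 xinc i).
by rewrite ler_nat.
Qed.

Lemma x_inj i j : c0 (x i) = c0 (x j) -> i = j.
Proof.
move=> e; have [ij|ij|//] := ltngtP i j; have := inc_mono xinc ij; rewrite e ltxx => h.
  by exfalso; move: h.
by exfalso; move: h.
Qed.

Lemma x_ncol i j : i != j -> ~ collinear (x i) (x j).
Proof.
move=> ij /(primitive_collinear (xprim i) (xprim j) (x0 i) (x0 j)) e.
by move/eqP: ij; apply; apply: x_inj; rewrite e.
Qed.

Lemma run_end k : exists K, [/\ (k < K)%N,
  forall i, (k <= i <= K)%N -> det3 (x k) (x k.+1) (x i) = 0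
  & det3 (x k) (x k.+1) (x K.+1) != 0].
Proof.
have := ex_minnP (nonplanar k); case=> m /andP[km dm] hm.
have m2 : (k.+2 <= m)%N.
  rewrite ltn_neqAle km andbT; apply: contraNneq dm => <-; by rewrite det3baa.
exists m.-1; split; first by nlia.
  move=> i /andP[ki im]; apply/eqP/negPn/negP => di.
  have [ki'|] := ltnP k i.
    have := hm i ltac:(by rewrite ki' di); nlia.
  move=> ik; have e : i = k by nlia.
  by move/eqP: di; rewrite e; apply; exact: det3aba.
by rewrite prednK//; nlia.
Qed.

Local Notation eta := ((2 - b) / 2).

(** [gap] is applied with [x K] in the plane and [x K.+1] outside: [2 * V K - V K.+1] is at least
    [(2 - b) * V K], and half of this pays for the errors. *)
Lemma growth : exists2 N, (N0 <= N)%N & forall k K, (N <= k)%N -> (k < K)%N ->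
  det3 (x k) (x k.+1) (x K) = 0 -> det3 (x k) (x k.+1) (x K.+1) != 0 ->
  eta * V K <= V k.+1 - V k.
Proof.
have hb1 := b1; have hb2 := b2; have hle := eps_le; have b20 : 0 < 2 - b by lra.
have [N hN] := V_large (4 * lcst / (2 - b)).
exists (maxn N0 N); first exact: leq_maxl.
move=> k K; rewrite geq_max => /andP[k1 k2] kK dK dK1.
have large := hN K ltac:(nlia).
have hl : 4 * lcst <= (2 - b) * V K by rewrite [leRHS]mulrC -ler_pdivrMr//.
have rK := xrat (i := K) ltac:(nlia).
have VK0 := V_ge0 K; have VKK := V_le (leqnSn K).
have mono i : (i <= K.+1)%N -> eps * V i <= eps * V K.+1 by move=> iK; rewrite ler_wpM2l// V_le.
have Q i : (N0 <= i)%N -> (i <= K.+1)%N -> qual (eps * V K.+1) (x i).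
  by move=> Ni iK; apply: (good_qual (xgood Ni)); exact: mono.
have := gap (Q k ltac:(nlia) ltac:(nlia)) (Q k.+1 ltac:(nlia) ltac:(nlia))
  (Q K ltac:(nlia) ltac:(nlia)) (Q K.+1 ltac:(nlia) ltac:(nlia)) (V_le (leqnSn k)) dK dK1.
move=> g.
have mn : (2 - b) * V K <= Num.min (2 * V K - V K.+1) (V K.+1).
  rewrite le_min; apply/andP; split; first by lra.
  apply: le_trans VKK; rewrite -[leRHS]mul1r ler_wpM2r//; lra.
have e1 : eps * V K.+1 <= eps * (b * V K) by rewrite ler_wpM2l.
have e2 : eps * (b * V K) <= eps * (2 * V K) by rewrite ler_wpM2l// ler_wpM2r//; lra.
have e3 : 16 * eps * V K <= (2 - b) * V K by rewrite ler_wpM2r.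
lra.
Qed.

Lemma growth1 : exists2 N, (N0 <= N)%N & forall k, (N <= k)%N -> eta * V k.+1 <= V k.+1 - V k.
Proof.
have hb1 := b1; have hb2 := b2; have [N N0N h] := growth; exists N => // k Nk.
have [K [kK dK dK1]] := run_end k.
have := h k K Nk kK (dK K ltac:(by rewrite leqnn ltnW)) dK1; apply: le_trans.
by rewrite ler_wpM2l ?V_le//; lra.
Qed.

(** [run_end] looks forwards; here the plane of [x k], [x k.+1] is followed backwards to the last
    point [x j] outside it, which exists beyond [N] because the points from [N] on are not all
    coplanar. *)
Lemma run_start N : exists K0, forall k, (K0 <= k)%N -> exists j,
  [/\ (N <= j)%N, (j < k)%N, forall i, (j < i)%N -> (i <= k.+1)%N -> det3 (x j.+1) (x j.+2) (x i) = 0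
    & det3 (x j.+1) (x j.+2) (x j) != 0].
Proof.
have [i1 /andP[Ni1 d1]] := nonplanar N.
exists (maxn i1 N.+1) => k; rewrite geq_max => /andP[ik Nk].
have nk : ~ collinear (x k) (x k.+1) by apply: x_ncol; nlia.
have ex : exists j, (N <= j < k)%N && (det3 (x k) (x k.+1) (x j) != 0).
  apply: contrapT => /forallNP no.
  have pl j : (N <= j)%N -> (j <= k.+1)%N -> det3 (x k) (x k.+1) (x j) = 0.
    move=> Nj jk; have [jk'|] := ltnP j k.
      by apply/eqP/negPn/negP => dj; apply: (no j); rewrite Nj jk'.
    rewrite leq_eqVlt => /orP[/eqP <-|kj]; first exact: det3aba.
    have -> : j = k.+1 by nlia.
    exact: det3baa.
  move/eqP: d1; apply; apply: (coplanar3 nk); apply: pl; nlia.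
have ub j : (N <= j < k)%N && (det3 (x k) (x k.+1) (x j) != 0) -> (j <= k)%N.
  by move=> /andP[/andP[_ /ltnW]].
case: (ex_maxnP ex ub) => j /andP[/andP[Nj jk] dj] hmax.
have pl i : (j < i)%N -> (i <= k.+1)%N -> det3 (x k) (x k.+1) (x i) = 0.
  move=> ji ik'; have [ik''|] := ltnP i k.
    apply/eqP/negPn/negP => di; have := hmax i ltac:(by rewrite ik'' di andbT andbT; nlia).
    nlia.
  rewrite leq_eqVlt => /orP[/eqP <-|ki]; first exact: det3aba.
  have -> : i = k.+1 by nlia.
  exact: det3baa.
exists j; split=> //.
  by move=> i ji ik'; apply: (coplanar3 nk); apply: pl; nlia.
apply: contraNneq dj => dj; apply/eqP.
have nj : ~ collinear (x j.+1) (x j.+2) by apply: x_ncol; nlia.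
by apply: (coplanar3 nj) => //; apply: (coplanar3 nk); apply: pl; nlia.
Qed.

Lemma run_bounds : exists2 N, (N0 <= N)%N & forall j k, (N <= j)%N -> (j < k)%N ->
  (forall i, (j < i)%N -> (i <= k.+1)%N -> det3 (x j.+1) (x j.+2) (x i) = 0) ->
  [/\ eta * V k.+1 <= V j.+2 - V j.+1, V j.+2 - V j.+1 <= (b - 1) * V j.+1,
      V j.+2 - V j.+1 <= b * (b - 1) * V j & eta * V k.+1 <= 2 * V j].
Proof.
have hb1 := b1; have hb2 := b2; have [N N0N h] := growth; exists N => // j k Nj jk pl.
have [K [kK dK dK1]] := run_end j.+1.
have kK1 : (k.+1 <= K)%N.
  rewrite leqNgt; apply/negP => Kk; move/eqP: dK1; apply; apply: pl; nlia.
have g := h j.+1 K ltac:(nlia) kK (dK K ltac:(by rewrite leqnn ltnW)) dK1.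
have e0 : 0 <= eta by lra.
have g' : eta * V k.+1 <= V j.+2 - V j.+1.
  by apply: le_trans g; rewrite ler_wpM2l// V_le.
have r1 := xrat (i := j.+1) ltac:(nlia); have r0 := xrat (i := j) ltac:(nlia).
have r2 : V j.+2 - V j.+1 <= (b - 1) * V j.+1 by lra.
have r3 : (b - 1) * V j.+1 <= (b - 1) * (b * V j) by rewrite ler_wpM2l//; lra.
have r4 : V j.+2 - V j.+1 <= b * (b - 1) * V j by lra.
split=> //; apply: le_trans g' _; apply: le_trans r4 _; rewrite ler_wpM2r ?V_ge0//.
(* This product equals 2 - b (b - 1), the margin that later excludes foreign points. *)
have : 0 < (2 - b) * (b + 1) by rewrite mulr_gt0//; lra.
lra.
Qed.

Lemma bracket K0 z : 0 < c0 z -> V K0 <= lnht z ->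
  exists k, [/\ (K0 <= k)%N, c0 (x k) <= c0 z & c0 z < c0 (x k.+1)].
Proof.
clear b1 b2 eps_ge0 eps_le; move=> z0; rewrite lnht_le// => hz.
have ex : exists i, c0 (x i) <= c0 z by exists K0.
have ub i : c0 (x i) <= c0 z -> (i <= `|c0 z|)%N.
  move=> hi; have := inc_ge R x0 xinc i; rewrite -[i%:R]/(i%:~R : R) !htE ler_int; lia.
case: (ex_maxnP ex ub) => k hk hmax; exists k; split=> //; first exact: hmax.
by rewrite ltNge; apply/negP => /hmax; rewrite ltnn.
Qed.

End Run.

Lemma le_of_large (c a u : R) : 0 < a -> c / a <= u -> c <= a * u.
Proof. by move=> a0 h; rewrite mulrC -ler_pdivrMr. Qed.

(** A point [z] between [x k] and [x k.+1] lies in the plane of their run. Starting at [y = x k.+1],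
    taking the triple of [y], [x j.+2], [x j.+1] lowers the logarithmic height by about the first
    gap [d] of the run and multiplies the loss by about 6, so a bounded number of steps reaches the
    level of [z]. If two successive points of this descent enclosed [z] without [z] being the lower
    one, [double_gap] against [x j] would give 2 V_j at most [d] plus errors, whereas [d] is at most
    b (b - 1) V_j. Hence [z] is a point of the descent and inherits its quality. *)
Lemma good_improve (b : R) : 1 < b -> b < 2 -> exists2 eps0 : R,
  0 < eps0 <= 1 / 4 & forall eps', 0 < eps' -> exists2 eps : R, 0 < eps <= eps0 &
  forall x N0, runlist x eps b N0 ->
  exists V0, forall z, primitive z -> good eps0 z -> V0 <= lnht z -> good eps' z.
Proof.
move=> b1 b2.
have [eta etaE] : exists e : R, e = (2 - b) / 2 by exists ((2 - b) / 2).
have eta0 : 0 < eta by rewrite etaE; lra.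
have eta2 : eta <= 1 / 2 by rewrite etaE; lra.
have [kp kpE] : exists e : R, e = 2 - b * (b - 1) by exists (2 - b * (b - 1)).
have kp0 : 0 < kp.
  have : 0 < (2 - b) * (b + 1) by rewrite mulr_gt0//; lra.
  rewrite kpE; lra.
have kp2 : kp <= 2.
  have : 0 <= b * (b - 1) by rewrite mulr_ge0//; lra.
  rewrite kpE; lra.
have kpe : kp <= 6 * eta.
  have : 0 <= (2 - b) * (2 - b) by rewrite mulr_ge0//; lra.
  rewrite kpE etaE; lra.
(* [kp] is the margin in the final contradiction; one factor [eta] compares V_j with V_(k+1), the
   other is the margin 2 - b that keeps the triples high enough. *)
have [eps0 eps0E] : exists e : R, e = eta * eta * kp / 128 by exists (eta * eta * kp / 128).
have eps00 : 0 < eps0 by rewrite eps0E divr_gt0// !mulr_gt0.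
have ee0 : 0 < eta * eta by rewrite mulr_gt0.
have ek0 : 0 < eta * kp by rewrite mulr_gt0.
have f1 : eta * eta * kp <= eta * eta * 2 by rewrite ler_pM2l.
have f2 : eta * eta <= eta * (1 / 2) by rewrite ler_pM2l.
have f3 : eta * (eta * kp) <= 1 / 2 * (eta * kp) by rewrite ler_pM2r.
have f4 : eta * kp <= eta * 2 by rewrite ler_pM2l.
have s1 : 64 * eps0 <= eta * eta by rewrite eps0E; lra.
have s2 : 128 * eps0 <= eta by lra.
have s3 : 256 * eps0 <= eta * kp by rewrite eps0E; lra.
exists eps0; first by apply/andP; split; lra.
move=> eps' eps'0.
(* Each step of the descent loses at least [d / 2] and [d >= eta * Vk], so [2 / eta] steps exhaust
   [Vk]. *)
have [T hT] := archi_nat (2 / eta + 1).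
have [P6 P6E] : exists e : R, e = 6 ^+ T.+1 by exists (6 ^+ T.+1).
have P60 : 0 < P6 by rewrite P6E exprn_gt0.
set eps := Num.min eps0 (Num.min (eps0 / (2 * P6)) (eps' / (8 * P6))).
have epsp : 0 < eps by rewrite !lt_min eps00 /=; apply/andP; split; apply: divr_gt0 => //; exact: mulr_gt0.
have eps_0 : eps <= eps0 by rewrite ge_min lexx.
have epsP : P6 * eps <= eps0 / 2.
  have : eps <= eps0 / (2 * P6) by rewrite !ge_min lexx orbT.
  rewrite -(ler_pM2l P60) => /le_trans; apply.
  by rewrite le_eqVlt; apply/orP; left; apply/eqP; field; rewrite gt_eqF.
have epsP' : P6 * eps <= eps' / 8.
  have : eps <= eps' / (8 * P6) by rewrite !ge_min lexx !orbT.
  rewrite -(ler_pM2l P60) => /le_trans; apply.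
  by rewrite le_eqVlt; apply/orP; left; apply/eqP; field; rewrite gt_eqF.
exists eps; first by rewrite epsp.
move=> x N0 rl.
have c0' := lcst_ge0 xi.
have epsb : 16 * eps <= 2 - b by lra.
have eps_ge0 := ltW epsp.
have Vlt := V_lt rl; have Vle := V_le rl; have Vge0 := V_ge0 rl.
have xpos := rl_pos rl; have xprim := rl_prim rl.
have xncol := x_ncol rl.
have [N1 N01 hrb] := run_bounds rl b1 b2 eps_ge0 epsb.
set big := Num.max (lcst * (100 / (eta * kp)) ) (Num.max (P6 * lcst / (eps0 / 2)) (Num.max (P6 * lcst / (eps' / 8)) 100)).
have [N2 hN2] := V_large rl (big / (eta / 2)).
have [K0 hK0] := run_start rl (maxn N1 N2).
exists (lnht (x (maxn K0 (maxn N1 N2)))) => z zp zg hz; have [z0 _] := zg.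
have [k [Kk kz zk]] := bracket rl z0 hz.
move: Kk; rewrite !geq_max => /and3P[Kk N1k N2k].
have [j [Nj jk plj dj]] := hK0 k Kk.
move: Nj; rewrite geq_max => /andP[N1j N2j].
have [q1 q2 q3 q4] := hrb j k N1j jk plj.
rewrite -etaE in q1 q4.
have [Vk VkE] : exists v, v = lnht (x k.+1) by exists (lnht (x k.+1)).
have [d dE] : exists v, v = lnht (x j.+2) - lnht (x j.+1) by eexists.
rewrite -VkE -dE in q1 q2 q3 q4.
have Vj0 := Vge0 j.
have jV : lnht (x j) <= Vk by rewrite VkE; apply: Vle; nlia.
have Vj_big : big <= eta / 2 * lnht (x j).
  by apply: le_of_large; [rewrite divr_gt0|exact: hN2].
have Vk_ge : eta / 2 * lnht (x j) <= Vk.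
  have : eta / 2 * lnht (x j) <= 1 / 4 * lnht (x j).
    by rewrite ler_wpM2r//; move: eta2; clear; lra.
  by move: jV Vj0; clear; lra.
have bigV := le_trans Vj_big Vk_ge.
move: bigV; rewrite {Vj_big Vk_ge hN2 N2k N2j}/big !ge_max => /and4P[g1 g2 g3 Vk_pos].
have c1 : 100 * lcst <= eta * kp * Vk.
  by move: g1; rewrite mulrA ler_pdivrMr// mulrC (mulrC Vk).
have c2 : P6 * lcst <= eps0 / 2 * Vk by apply: le_of_large => //; rewrite divr_gt0.
have c3 : P6 * lcst <= eps' / 8 * Vk by apply: le_of_large => //; rewrite divr_gt0.
clear g1 g2 g3.
(* [triple] turns a loss [m] into [6 * m + 4 * lcst]; losses of the form [6 ^+ t * A - lcst] absorb
   this recursion. *)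
have [A AE'] : exists v, v = eps * Vk + lcst by eexists.
have Vk0 : 0 <= Vk by move: Vk_pos; clear; lra.
have PA : P6 * A <= eps0 * Vk.
  have : P6 * eps * Vk <= eps0 / 2 * Vk by rewrite ler_wpM2r.
  by move: c2; rewrite AE'; clear; lra.
have PA' : P6 * A <= eps' / 4 * Vk.
  have : P6 * eps * Vk <= eps' / 8 * Vk by rewrite ler_wpM2r.
  by move: c3; rewrite AE'; clear; lra.
have A0 : 0 <= A by rewrite AE' addr_ge0// mulr_ge0.
have Vk2 : Vk <= 2 * lnht (x k).
  have r := rl_rat rl (i := k) ltac:(nlia); rewrite VkE; apply: le_trans r _.
  by rewrite ler_wpM2r//; exact: ltW.
have vkz : lnht (x k) <= lnht z by rewrite lnht_le.
have zVk : lnht z < Vk by rewrite VkE lnht_lt.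
clear f1 f2 f3 f4 eps0E epsP epsP' c2 c3.
suff [t tT Qz] : exists2 t, (t <= T)%N & qual (6 ^+ t.+1 * A - lcst) z.
  apply: (qual_good Qz).
  have : 6 ^+ t.+1 * A <= P6 * A.
    by rewrite ler_wpM2r// P6E ler_weXn2l// ler1n.
  have : eps' * Vk <= eps' * (2 * lnht z).
    by rewrite ler_pM2l//; move: Vk2 vkz; clear; lra.
  have : 0 <= eps' * lnht z by rewrite mulr_ge0// ?lnht_ge0// ltW.
  by move: PA' c0'; clear; lra.
have pow t : (t <= T.+1)%N -> 6 ^+ t * A <= eps0 * Vk.
  move=> tT; apply: le_trans PA; rewrite ler_wpM2r// P6E ler_weXn2l// ler1n.
  by [].
have Qx i : (N0 <= i)%N -> (i <= k.+1)%N -> qual (eps * Vk) (x i).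
  move=> Ni ik; apply: (good_qual (rl_good rl Ni)); rewrite ler_wpM2l// VkE.
  exact: Vle.
have AE : eps * Vk = A - lcst by rewrite AE' addrK.
have [ez|nez] := eqVneq (c0 z) (c0 (x k)).
  exists 0%N => //.
  have Lsm p : qual (eps0 * Vk) p -> lnht (x k) <= lnht p -> Lp p < 1 / 2.
    move=> [_ h] hp; apply: le_lt_trans h _.
    have l2 : expR (- 1) < 1 / 2 :> R.
      rewrite expRN; have := @expR_gt1Dx R 1 ltac:(by rewrite oner_neq0).
      rewrite -[1 + 1]/(2 : R) => h2; rewrite div1r ltf_pV2 ?posrE ?expR_gt0//.
    apply: le_lt_trans l2; rewrite ler_expR.
    have : 128 * eps0 * Vk <= 1 / 2 * Vk by rewrite ler_wpM2r//; exact: le_trans eta2.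
    by move: Vk2 Vk_pos hp; clear; lra.
  have zE : z = x k.
    apply: (@same_height R xi) => //; apply: Lsm => //.
      apply: (good_qual zg); rewrite ler_pM2l//; exact: ltW.
    by apply: qual_le (Qx k ltac:(nlia) ltac:(nlia)); rewrite ler_wpM2r.
  rewrite zE expr1; apply: qual_le (Qx k ltac:(nlia) ltac:(nlia)).
  by rewrite AE; move: A0; clear; lra.
have vkz' : lnht (x k) < lnht z by rewrite lnht_lt// lt_neqAle eq_sym nez.
have Qz0 : qual (eps0 * Vk) z.
  by apply: (good_qual zg); rewrite ler_pM2l//; exact: ltW.
have Qx0 i : (N0 <= i)%N -> (i <= k.+1)%N -> qual (eps0 * Vk) (x i).
  by move=> Ni ik; apply: qual_le (Qx i Ni ik); rewrite ler_wpM2r.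
have nk : ~ collinear (x k) (x k.+1) by apply: xncol; nlia.
have na : ~ collinear (x j.+1) (x j.+2) by apply: xncol; nlia.
have dz : det3 (x k) z (x k.+1) = 0.
  apply/eqP/negPn/negP => dz.
  have := plane (Qx0 k ltac:(nlia) ltac:(nlia)) Qz0 (Qx0 k.+1 ltac:(nlia) ltac:(nlia)) vkz ltac:(by rewrite -VkE ltW) dz.
  rewrite -VkE => h.
  have r := rl_rat rl (i := k) ltac:(nlia); rewrite -VkE in r.
  have : 128 * eps0 * Vk <= eta * Vk by rewrite ler_wpM2r.
  have : eta * Vk <= eta * (2 * lnht (x k)) by rewrite ler_pM2l.
  have : eta * kp * Vk <= eta * 2 * Vk by rewrite ler_wpM2r// ler_pM2l.
  have : 0 < eta * Vk by rewrite mulr_gt0//; move: Vk_pos; clear; lra.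
  have : b * lnht (x k) = 2 * lnht (x k) - 2 * (eta * lnht (x k)) by rewrite etaE; clear; lra.
  by move: h r vkz c1 c0'; clear; lra.
have dza : det3 (x j.+1) (x j.+2) z = 0.
  have pk := plj k ltac:(nlia) ltac:(nlia); have pk1 := plj k.+1 ltac:(nlia) ltac:(nlia).
  apply: (coplanar3 nk).
  - by apply: (coplanar3 na) => //; exact: det3aba.
  - by apply: (coplanar3 na) => //; exact: det3baa.
  - by rewrite det3_swap23 dz oppr0.
have vj1 : lnht (x j.+1) <= lnht (x k) by apply: Vle; nlia.
have chain t : (t <= T)%N -> (exists2 t', (t' <= T)%N & qual (6 ^+ t'.+1 * A - lcst) z) \/
   exists y, [/\ primitive y, disc y != 0, det3 (x j.+1) (x j.+2) y = 0, qual (6 ^+ t * A - lcst) y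
     & lnht z < lnht y <= Vk - t%:R * (d / 2)].
  elim: t => [_|t IH tT].
    right; exists (x k.+1); split=> //.
    - by apply: (rl_disc rl); nlia.
    - by apply: plj; nlia.
    - by rewrite expr0 mul1r -AE; apply: Qx; nlia.
    - by rewrite mul0r subr0 -VkE lexx zVk.
  have [?|[y [yp yd yin yq /andP[y1 y2]]]] := IH (ltnW tT); [by left|].
  have [m mE] : exists v, v = 6 ^+ t * A - lcst by eexists.
  rewrite -mE in yq.
  have p1 : A <= 6 ^+ t * A by apply: ler_peMl => //; apply: exprn_ege1; rewrite ler1n.
  have eA : 0 <= eps * Vk by rewrite mulr_ge0.
  have m0 : 0 <= m by rewrite mE; move: p1 eA; rewrite AE; clear; lra.
  have mle : m <= eps0 * Vk by have := pow t ltac:(nlia); rewrite mE; move: c0'; clear; lra.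
  have y0 : 0 < c0 y by case: yq.
  have Qa : qual m (x j.+1) by apply: qual_le (Qx j.+1 ltac:(nlia) ltac:(nlia)); rewrite mE AE; move: p1; clear; lra.
  have Qa' : qual m (x j.+2) by apply: qual_le (Qx j.+2 ltac:(nlia) ltac:(nlia)); rewrite mE AE; move: p1; clear; lra.
  have dt : det3 y (x j.+2) (x j.+1) = 0 by rewrite det3_rot det3_swap yin oppr0.
  have e2V : eta * (eta * Vk) <= eta * (2 * lnht (x j)) by rewrite ler_pM2l.
  have jj1 : lnht (x j) <= lnht (x j.+1) by apply: Vle.
  have ejj : eta * lnht (x j) <= eta * lnht (x j.+1) by rewrite ler_pM2l.
  have dd : (b - 1) * lnht (x j.+1) = lnht (x j.+1) - 2 * (eta * lnht (x j.+1)).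
    by rewrite etaE; clear; lra.
  have sV1 : 64 * eps0 * Vk <= eta * eta * Vk by rewrite ler_wpM2r.
  have sV2 : 128 * eps0 * Vk <= eta * Vk by rewrite ler_wpM2r.
  have sV3 : 256 * eps0 * Vk <= eta * kp * Vk by rewrite ler_wpM2r.
  have kV : eta * kp * Vk <= eta * (6 * eta) * Vk by rewrite ler_wpM2r// ler_pM2l.
  have kV2 : eta * kp * Vk <= eta * 2 * Vk by rewrite ler_wpM2r// ler_pM2l.
  have kV3 : kp * (eta * Vk) <= kp * (2 * lnht (x j)) by rewrite ler_pM2l.
  have eV : 0 < eta * eta * Vk by rewrite mulr_gt0//; move: Vk_pos; clear; lra.
  have low : 3 * m + lcst < lnht y + lnht (x j.+1) - lnht (x j.+2).
    have hd : lnht y + lnht (x j.+1) - lnht (x j.+2) = lnht y - d by rewrite dE; clear; lra.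
    rewrite hd; move: mle q2 y1 vkz vj1 dd e2V ejj sV1 kV c1 eV; clear; lra.
  have [t' [tp td [g g0 tE] tv tq]] := triple m0 yq Qa' Qa ltac:(by apply: Vle) dt yd
    (rl_disc rl (i := j.+2) ltac:(nlia)) (rl_disc rl (i := j.+1) ltac:(nlia)) low.
  have tq1 : qual (6 ^+ t.+1 * A - lcst) t'.
    by apply: qual_le tq; rewrite exprS mE; move: c0'; clear; lra.
  have tin : det3 (x j.+1) (x j.+2) t' = 0.
    have := det3_trip yin; rewrite tE det3_scalpt => /eqP.
    by rewrite mulf_eq0 (negbTE g0) => /eqP.
  have t0' : 0 < c0 t' by case: tq.
  have hd : lnht y + lnht (x j.+1) - lnht (x j.+2) = lnht y - d by rewrite dE; clear; lra.
  move: tv; rewrite hd ler_norml => /andP[tv1 tv2].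
  have [vz|vz] := leP (lnht t') (lnht z); last first.
    right; exists t'; split=> //; rewrite vz /= -[t.+1%:R]natr1.
    have : 0 <= eta * Vk by rewrite mulr_ge0// ltW.
    by move: tv2 y2 mle sV2 kV2 c1 q1; clear; lra.
  left; exists t; first exact: ltnW.
  have [col|ncol] := pselect (collinear t' z).
    by rewrite -(primitive_collinear tp zp t0' z0 col).
  exfalso.
  have nzy : ~ collinear z y.
    by move=> /(primitive_collinear zp yp z0 y0) e; move: y1; rewrite e ltxx.
  have pw := pow t.+1 ltac:(nlia).
  have := double_gap na dj (plj k.+1 ltac:(nlia) ltac:(nlia)) tin dza yin ncol nzy
    (qual_le _ tq1) Qz0 (qual_le mle yq) (Qx0 k.+1 ltac:(nlia) ltac:(nlia)) (Qx0 j ltac:(nlia) ltac:(nlia))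
    vz (ltW y1) ltac:(by rewrite -VkE).
  have kpV : kp * lnht (x j) = 2 * lnht (x j) - b * (b - 1) * lnht (x j) by rewrite kpE; clear; lra.
  have kpj : 0 < kp * lnht (x j).
    rewrite mulr_gt0//; have : 0 < eta * Vk by rewrite mulr_gt0//; move: Vk_pos; clear; lra.
    by move: q4; clear; lra.
  have c0'' := c0'; move=> /(_ ltac:(move: pw c0'; clear; lra)).
  by move: tv1 q3 mle sV3 c1 kV3 kpV kpj; clear; lra.
have [//|[y [_ _ _ _ /andP[y1 y2]]]] := chain T (leqnn T).
exfalso.
have : (2 / eta) * (eta * Vk) <= T%:R * d.
  apply: ler_pM => //; [by rewrite divr_ge0// ltW|by rewrite mulr_ge0// ltW|].
  by move: hT; clear; lra.
have -> : 2 / eta * (eta * Vk) = 2 * Vk by field; rewrite gt_eqF.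
have := Vge0 k; move: y1 y2 vkz'; clear; lra.
Qed.

End Runs.

(** * The structure of the good approximations *)

Section Structure.
Variables (R : realType) (xi : R).
Local Notation lnht := (@lnht R).
Local Notation ht := (@ht R).
Local Notation Lp := (Lp xi).
Local Notation lcst := (lcst xi).
Local Notation qual := (qual xi).
Local Notation good := (good xi).
Local Notation cov := (cov xi).

Lemma expRN1_lt_half : expR (- 1) < 1 / 2 :> R.
Proof.
rewrite expRN; have := @expR_gt1Dx R 1 ltac:(by rewrite oner_neq0).
rewrite -[1 + 1]/(2 : R) => h2; rewrite div1r ltf_pV2 ?posrE ?expR_gt0//.
Qed.

Lemma good_Lp_small eps z : eps <= 1 / 4 -> good eps z -> 4 <= lnht z -> Lp z < 1 / 2.
Proof.
move=> e4 [z0 h] v4; apply: le_lt_trans h _; apply: le_lt_trans expRN1_lt_half.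
rewrite ler_expR; have : eps * lnht z <= 1 / 4 * lnht z by rewrite ler_wpM2r ?lnht_ge0.
by move: v4; clear; lra.
Qed.

(** The integer normal vector of the plane pairs with (1, xi, xi^2) to a nonzero number [w], and a
    point of the plane with [Lp z <= 1] satisfies [|w| * ht z <= S]. *)
Lemma det3_indep_neq0 p q : indep xi -> ~ collinear p q ->
  exists V0, forall z, 0 < c0 z -> Lp z <= 1 -> V0 <= lnht z -> det3 p q z != 0.
Proof.
move=> ind nc.
have [n0 n0E] : exists n, n = c1 p * c2 q - c2 p * c1 q by eexists.
have [n1 n1E] : exists n, n = c2 p * c0 q - c0 p * c2 q by eexists.
have [n2 n2E] : exists n, n = c0 p * c1 q - c1 p * c0 q by eexists.
set w : R := n0%:~R + n1%:~R * xi + n2%:~R * xi ^+ 2.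
have w0 : 0 < `|w|.
  rewrite normr_gt0; apply/eqP => /ind [e0 e1 e2]; apply: nc.
  by rewrite n0E n1E n2E in e0 e1 e2; split; lia.
set S : R := `|n1%:~R| + `|n2%:~R|.
exists (ln (S / `|w| + 1)) => z z0 L1 hV; apply/eqP => dz.
have S0 : 0 <= S / `|w| by rewrite divr_ge0 ?addr_ge0.
have hz : S / `|w| + 1 <= ht z.
  rewrite -expR_lnht// -[leLHS]lnK ?posrE; last by apply: ltr_wpDl.
  by rewrite ler_expR.
have E : w * ht z = n1%:~R * ((c0 z)%:~R * xi - (c1 z)%:~R) + n2%:~R * ((c0 z)%:~R * xi ^+ 2 - (c2 z)%:~R).
  have : (det3 p q z)%:~R = 0 :> R by rewrite dz.
  have -> : det3 p q z = n0 * c0 z + n1 * c1 z + n2 * c2 z.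
    by rewrite /det3 n0E n1E n2E; ring.
  rewrite !intrD !intrM => h; rewrite -[RHS]addr0 -[X in _ = _ + X]h /w !htE; ring.
have : `|w| * ht z <= S.
  rewrite -[ht z]ger0_norm; last by rewrite ltW// ht_gt0.
  rewrite -normrM E /S; apply: le_trans (ler_normD _ _) _; rewrite !normrM.
  by apply: lerD; apply: ler_piMr => //; apply: le_trans L1;
    rewrite LpE /approx_L le_max lexx ?orbT.
rewrite -ler_pdivlMl// mulrC => h; move: hz h; clear; lra.
Qed.

(** The points are enumerated by first coordinate: from logarithmic height 4 on, [Lp] is below 1/2,
    so a first coordinate determines the point. *)
Lemma exists_list eps b : indep xi -> 0 < b -> 0 < eps <= 1 / 4 -> cov eps b ->
  exists x : nat -> pt, [/\ forall i, 0 < c0 (x i), forall i, c0 (x i) < c0 (x i.+1),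
    forall i, primitive (x i), forall i, good eps (x i)
    & forall z, primitive z -> good eps z -> 4 <= lnht z -> exists i, z = x i].
Proof.
move=> ind b0 /andP[e0 e4] [u0 hcov].
set Q := fun (X : nat) (z : pt) => [/\ c0 z = X%:Z, primitive z, good eps z & 4 <= lnht z].
set P : pred nat := fun X => `[< exists z, Q X z >].
have P_inf n : exists m, (n < m)%N && P m.
  have [u1 hu1] := irr_lower (Num.max 4 (ln (n.+1%:R : R))) ind.
  have [z [zp zg _ zL]] := hcov (Num.max u0 (Num.max (b * u1) 0)) ltac:(by rewrite le_max lexx).
  have [z0 _] := zg.
  have hu : u1 <= Num.max u0 (Num.max (b * u1) 0) / b.
    by rewrite ler_pdivlMr// !le_max mulrC lexx !orbT.
  have := hu1 z _ z0 hu zL; rewrite gt_max => /andP[v4 vn].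
  exists `|c0 z|%N; apply/andP; split; last first.
    apply/asboolP; exists z; split=> //; [by lia|exact: ltW].
  have : n.+1%:R < ht z by rewrite -ltr_ln ?posrE ?ht_gt0.
  by rewrite -[n.+1%:R]/(n.+1%:~R : R) !htE ltr_int; lia.
have ex i : exists z, Q (nthsat P i) z by have := nthsat_sat P_inf i; move/asboolP.
have [x hx] := choice ex.
have cE i : c0 (x i) = nthsat P i by have [] := hx i.
exists x; split.
- by move=> i; rewrite cE; have := nthsat_gt P_inf i; lia.
- by move=> i; rewrite !cE ltz_nat nthsat_lt.
- by move=> i; have [] := hx i.
- by move=> i; have [] := hx i.
move=> z zp zg v4; have [z0 _] := zg.
have Pz : P `|c0 z|%N by apply/asboolP; exists z; split=> //; lia.
have [i hi] := nthsat_ex P_inf (m := `|c0 z|%N) ltac:(lia) Pz.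
exists i; have [h1 _ h3 h4] := hx i.
apply: (@same_height R xi); first by rewrite cE hi; lia.
  exact: good_Lp_small e4 zg v4.
exact: good_Lp_small e4 h3 h4.
Qed.

Lemma list_runlist (x : nat -> pt) eps b b' : indep xi -> eps <= 1 / 4 -> 0 < b -> b < b' -> b' < 2 ->
  cov eps b ->
  (forall i, 0 < c0 (x i)) -> (forall i, c0 (x i) < c0 (x i.+1)) ->
  (forall i, primitive (x i)) -> (forall i, good eps (x i)) ->
  (forall z, primitive z -> good eps z -> 4 <= lnht z -> exists i, z = x i) ->
  exists N0, runlist xi x eps b' N0.
Proof.
move=> ind e4 b0 bb b2 hcov x0 xinc xp xg xc.
have large M : ev (fun i => M <= lnht (x i)).
  have [n hn] := archi_nat (expR M); exists n => i ni.
  rewrite -[leLHS]expRK ler_ln ?posrE ?expR_gt0 ?ht_gt0//.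
  apply: le_trans (ltW hn) _; apply: le_trans (inc_ge R x0 xinc i).
  by rewrite ler_nat.
have [V0 hV0] := disc_neq0 e4 b0 (lt_trans bb b2) hcov.
have [N1 hN1] := large V0.
have hd i : (N1 <= i)%N -> disc (x i) != 0 by move=> /hN1; apply: hV0.
have [c [N2 hN2]] := list_ratio ind b0 hcov x0 xinc xc hd.
have [N3 hN3] := large (c / (b' - b)).
exists (maxn N1 (maxn N2 N3)); split=> //.
- by move=> i; rewrite !geq_max => /and3P[? ? ?]; exact: hd.
- move=> i; rewrite !geq_max => /and3P[_ i2 i3]; apply: le_trans (hN2 i i2) _.
  have : c <= (b' - b) * lnht (x i) by rewrite mulrC -ler_pdivrMr ?subr_gt0//; exact: hN3.
  by clear; lra.
move=> k.
have nc : ~ collinear (x k) (x k.+1).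
  move=> /(primitive_collinear (xp k) (xp k.+1) (x0 k) (x0 k.+1)) e.
  by have := xinc k; rewrite -e ltxx.
have [V1 hV1] := det3_indep_neq0 ind nc.
have [n hn] := ev_and (large V1) (ev_and (large 4) (ev_ge k.+1)).
have [v1 [v4 kn]] := hn n (leqnn n); exists n; rewrite kn hV1//.
apply: ltW; apply: lt_trans (good_Lp_small e4 (xg n) v4) _; lra.
Qed.

(** What the word retains of the number. [st_rel] transports the recursion from matrices to words,
    [st_no] excludes further palindromic prefixes, and the last three fields serve the comparison of
    heights with lengths. [C] is both the starting index and the bound on the memory. *)
Record struct (x : nat -> pt) (psi : nat -> nat) (C : nat) (eta : R) : Prop := Struct {
  st_pos : forall i, 0 < c0 (x i);
  st_inc : forall i, c0 (x i) < c0 (x i.+1);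
  st_V : forall i, 0 < lnht (x i);
  st_disc : forall i, disc (x i) != 0;
  st_lt : forall k, (C <= k)%N -> (psi k < k)%N;
  st_ge : forall k, (C <= k)%N -> (k <= psi k + C)%N;
  st_rel : forall k, (C <= k)%N -> proj_eq (trip_mx (x k) (x k.+1) (x k)) (mx_of (x (psi k)));
  st_no : forall k l, (C <= k)%N -> (psi k < l)%N -> (l < k)%N ->
    det3 (x k.+1) (x l) (x (psi k)) != 0;
  st_le2 : forall k, (C <= k)%N -> lnht (x k.+1) <= 2 * lnht (x k);
  st_grow : forall k, (C <= k)%N -> eta * lnht (x k) <= lnht (x k.+1) - lnht (x k);
  st_rec : forall e, 0 < e ->
    ev (fun k => `|lnht (x k.+1) - 2 * lnht (x k) + lnht (x (psi k))| <= e * lnht (x k)) }.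

Section Build.
Variables (x : nat -> pt) (b eps0 eta : R) (N : nat).
Hypothesis x0 : forall i, 0 < c0 (x i).
Hypothesis xinc : forall i, c0 (x i) < c0 (x i.+1).
Hypothesis xp : forall i, primitive (x i).
Hypothesis xg : forall e, 0 < e -> ev (fun i => good e (x i)).
Hypothesis xc : forall z, primitive z -> good eps0 z -> 4 <= lnht z -> exists i, z = x i.
Hypothesis xd : forall i, (N <= i)%N -> disc (x i) != 0.
Hypothesis xr : forall i, (N <= i)%N -> lnht (x i.+1) <= b * lnht (x i).
Hypothesis xe : forall i, (N <= i)%N -> eta * lnht (x i.+1) <= lnht (x i.+1) - lnht (x i).
Hypothesis b1 : 1 < b.
Hypothesis b2 : b < 2.
Hypothesis eps00 : 0 < eps0.
Hypothesis eta0 : 0 < eta.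
Hypothesis eta1 : eta <= 1.
Local Notation V i := (lnht (x i)).

Let V_lt i j : (i < j)%N -> V i < V j.
Proof. by move=> ij; rewrite lnht_lt// inc_mono. Qed.
Let V_le i j : (i <= j)%N -> V i <= V j.
Proof. by rewrite leq_eqVlt => /orP[/eqP ->//|/V_lt/ltW]. Qed.
Let V_ltE i j : V i < V j -> (i < j)%N.
Proof. by move=> h; rewrite ltnNge; apply/negP => /V_le; rewrite leNgt h. Qed.
Let V_large M : ev (fun i => M <= V i).
Proof.
have [n hn] := archi_nat (expR M); exists n => i ni.
rewrite -[leLHS]expRK ler_ln ?posrE ?expR_gt0 ?ht_gt0//.
apply: le_trans (ltW hn) _; apply: le_trans (inc_ge R x0 xinc i).
by rewrite ler_nat.
Qed.
Let x_inj i j : collinear (x i) (x j) -> i = j.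
Proof.
move/(primitive_collinear (xp i) (xp j) (x0 i) (x0 j)) => e.
have [ij|ij|//] := ltngtP i j; have := inc_mono xinc ij; rewrite e ltxx => h.
  by exfalso; move: h.
by exfalso; move: h.
Qed.

Definition psirel k l := exists2 g : int, g != 0 & trip (x k) (x k.+1) (x k) = scalpt g (x l).
(** When an index related to [k] exists it is unique, by [psirel_psi]; it does for all large [k], by
    [psi_approx]. The default 0 concerns only the other [k]. *)
Definition psi k : nat := xget 0%N [set l | psirel k l]%classic.

Let psirel_psi k l : psirel k l -> psi k = l.
Proof.
move=> h; have : psirel k (psi k) by have := @xgetPex _ 0%N [set l | psirel k l]%classic (ex_intro _ l h).
move: h => [g g0 e] [g' g'0 e'].
rewrite e' in e; apply: x_inj.
have e0 : g' * c0 (x (psi k)) = g * c0 (x l) by have /(congr1 c0) := e.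
have e1 : g' * c1 (x (psi k)) = g * c1 (x l) by have /(congr1 c1) := e.
have e2 : g' * c2 (x (psi k)) = g * c2 (x l) by have /(congr1 c2) := e.
by apply: collinearP; rewrite ?gt_eqF//; apply: (mulfI g'0); rewrite mulrA e0 [RHS]mulrA ?e1 ?e2; ring.
Qed.

(** The lower bound on [V i + V l - V j] makes the errors of [triple], small against [V k], also
    small against the height of the new point. That point is then good at level [eps0], and
    completeness of the list, [xc], puts it back in the list. *)
Let triple_in (dl : R) : 0 < dl -> exists2 e1 : R, 0 < e1 & ev (fun k => forall i j l,
  (i <= k.+1)%N -> (j <= k.+1)%N -> (l <= j)%N ->
  good e1 (x i) -> good e1 (x j) -> good e1 (x l) -> (N <= i)%N -> (N <= j)%N -> (N <= l)%N ->
  det3 (x i) (x j) (x l) = 0 -> (2 - b) / 4 * V k <= V i + V l - V j ->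
  exists h, `|V h - (V i + V l - V j)| <= dl * V k /\
   exists2 g : int, g != 0 & trip (x i) (x j) (x l) = scalpt g (x h)).
Proof.
move=> dl0; have hb1 := b1; have hb2 := b2; have he0 := eps00.
have c0' := lcst_ge0 xi.
have [bt btE] : exists v : R, v = (2 - b) / 4 by eexists.
have bt0 : 0 < bt by rewrite btE; lra.
have [e1 [e10 s1 s2 s3]] : exists e1 : R, [/\ 0 < e1, 24 * e1 <= dl, 48 * e1 <= eps0 * bt & 24 * e1 <= bt].
  exists (Num.min (dl / 24) (Num.min (eps0 * bt / 48) (bt / 24))).
  rewrite !lt_min !divr_gt0 ?mulr_gt0//; split=> //.
  - by rewrite mulrC -ler_pdivlMr// ge_min lexx.
  - by rewrite mulrC -ler_pdivlMr// !ge_min lexx !orbT.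
  - by rewrite mulrC -ler_pdivlMr// !ge_min lexx !orbT.
exists e1 => //.
have [c cgt0 hc] : exists2 c : R, 0 < c & forall v, c <= v -> [/\ 8 * lcst <= dl * v, 16 * lcst <= eps0 * bt * v, 8 * lcst <= bt * v & 16 <= bt * v].
  exists (Num.max 1 (Num.max (8 * lcst / dl) (Num.max (16 * lcst / (eps0 * bt)) (Num.max (8 * lcst / bt) (16 / bt))))).
    by rewrite lt_max ltr01.
  move=> v; rewrite !ge_max => /and5P[_ h1 h2 h3 h4].
  by split; apply: le_of_large => //; exact: mulr_gt0.
have := ev_and (V_large c) (ev_ge N); apply: ev_imp => k [Vk Nk] i j l ik jk lj gi gj gl Ni Nj Nl dt low.
have [q1 q2 q3 q4] := hc _ Vk.
have rk := xr Nk.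
have Vk0 : 0 < V k by apply: lt_le_trans Vk.
have V2 : V k.+1 <= 2 * V k by apply: le_trans rk _; rewrite ler_pM2r// ltW.
have [m mE] : exists v, v = e1 * (2 * V k) by eexists.
have Q h : (h <= k.+1)%N -> good e1 (x h) -> qual m (x h).
  move=> hk hg; apply: (good_qual hg); rewrite mE ler_pM2l//.
  by apply: le_trans V2; exact: V_le.
have m0 : 0 <= m by rewrite mE !mulr_ge0// ltW.
have t1 : 24 * e1 * V k <= dl * V k by rewrite ler_pM2r.
have t2 : 48 * e1 * V k <= eps0 * bt * V k by rewrite ler_pM2r.
have t3 : 24 * e1 * V k <= bt * V k by rewrite ler_pM2r.
rewrite -btE in low.
have cond : 3 * m + lcst < V i + V l - V j.
  by apply: lt_le_trans low; rewrite mE; move: q3 q4 t3; lra.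
have [t [tp td [g g0 tE] tv tq]] := triple m0 (Q i ik gi) (Q j jk gj) (Q l (leq_trans lj jk) gl)
  (V_le lj) dt (xd Ni) (xd Nj) (xd Nl) cond.
have tlow : bt / 2 * V k <= lnht t.
  by move: tv; rewrite ler_norml => /andP[h _]; move: h low q3 t3; rewrite mE; lra.
have t0 : 0 < c0 t by case: tq.
have tgood : good eps0 t.
  apply: (qual_good tq).
  have : eps0 * (bt / 2 * V k) <= eps0 * lnht t by rewrite ler_pM2l.
  by rewrite mE; move: q2 t2; lra.
have [h hE] := xc tp tgood ltac:(by apply: le_trans tlow; move: q4; lra).
exists h; rewrite -hE; split; last by exists g.
by apply: le_trans tv _; rewrite mE; move: q1 t1; lra.
Qed.

Let psi_approx (dl : R) : 0 < dl -> ev (fun k => psirel k (psi k) /\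
  `|V (psi k) - (2 * V k - V k.+1)| <= dl * V k).
Proof.
move=> dl0; have hb1 := b1; have hb2 := b2.
have [e1 e10 hev] := triple_in dl0.
have := ev_and hev (ev_and (xg e10) (ev_and (ev_shift 1 (xg e10)) (ev_ge N))).
apply: ev_imp => k [h [g1 [g2 Nk]]]; rewrite addn1 in g2.
have rk := xr Nk.
have Vk0 : 0 <= V k by apply: lnht_ge0.
have low : (2 - b) / 4 * V k <= V k + V k - V k.+1.
  have : 0 <= (2 - b) * V k by rewrite mulr_ge0//; lra.
  by move: rk; lra.
have [l [hl rel]] := h k k.+1 k ltac:(nlia) ltac:(nlia) ltac:(nlia) g1 g2 g1 Nk ltac:(nlia) Nk
   (det3aba _ _) low.
have e := psirel_psi rel; rewrite e; split=> //.
by move: hl; congr (`| _ | <= _); ring.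
Qed.

Let psi_ratio : ev (fun k => (2 - b) / 2 * V k <= V (psi k) /\ (psi k < k)%N).
Proof.
have hb1 := b1; have hb2 := b2; have he1 := eta1.
have [dl dl0 [d1 d2]] : exists2 dl : R, 0 < dl & dl <= (2 - b) / 2 /\ dl <= eta / 2.
  exists (Num.min ((2 - b) / 2) (eta / 2)); last by rewrite !ge_min !lexx orbT.
  by rewrite lt_min !divr_gt0//; move: hb2; lra.
have := ev_and (psi_approx dl0) (ev_and (V_large 1) (ev_ge N)); apply: ev_imp => k [[_ h] [V1 Nk]].
have rk := xr Nk; have gk := xe Nk.
have Vk0 : 0 < V k by move: V1; lra.
move: h; rewrite ler_norml => /andP[h1 h2].
have u1 : dl * V k <= (2 - b) / 2 * V k by rewrite ler_pM2r.
have u2 : dl * V k <= eta / 2 * V k by rewrite ler_pM2r.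
have u3 : eta * V k <= eta * V k.+1 by rewrite ler_pM2l// V_le.
have u4 : 0 < eta * V k by rewrite mulr_gt0.
split; first by move: h1 rk u1; lra.
by apply: V_ltE; move: h2 gk u2 u3 u4; lra.
Qed.

Let psi_large M : ev (fun k => (M <= psi k)%N).
Proof.
have hb2 := b2.
have := ev_and psi_ratio (V_large ((V M + 1) / ((2 - b) / 2))); apply: ev_imp => k [[h _] hk].
apply: ltnW; apply: V_ltE; apply: lt_le_trans h.
have b20 : 0 < (2 - b) / 2 by move: hb2; lra.
have := le_of_large b20 hk; lra.
Qed.

(** From [psi k] to [k] each step adds at least [eta * V (psi k)], and [V (psi k)] is a fixed
    fraction of [V k], so there are boundedly many steps. *)
Let psi_memory : exists C, ev (fun k => (k <= psi k + C)%N).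
Proof.
have hb2 := b2.
have b20 : 0 < (2 - b) / 2 by move: hb2; lra.
have [C hC] := archi_nat ((((2 - b) / 2) * eta)^-1).
exists C; have := ev_and psi_ratio (ev_and (psi_large N) (ev_and (psi_large 1) (V_large 1))).
apply: ev_imp => k [[h lt] [Np [p1 V1]]].
have Vk0 : 0 < V k by move: V1; lra.
have acc n : V (psi k) + n%:R * (eta * V (psi k)) <= V (psi k + n)%N.
  elim: n => [|n IH]; first by rewrite mul0r addr0 addn0.
  rewrite addnS -[n.+1%:R]natr1; have g := xe (i := (psi k + n)%N) ltac:(nlia).
  have : eta * V (psi k) <= eta * V (psi k + n).+1 by rewrite ler_pM2l// V_le//; nlia.
  by move: IH g; lra.
rewrite -leq_subLR -(ler_nat R).
have := acc (k - psi k)%N; rewrite subnKC; last exact: ltnW.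
move=> hk; apply: le_trans (ltW hC).
have e0 : 0 < (2 - b) / 2 * eta by rewrite mulr_gt0.
rewrite -[_^-1]mul1r ler_pdivlMr// -(ler_pM2r Vk0) mul1r.
have nn : 0 <= (k - psi k)%:R * eta :> R by rewrite mulr_ge0// ltW.
have : (k - psi k)%:R * eta * ((2 - b) / 2 * V k) <= (k - psi k)%:R * eta * V (psi k) by rewrite ler_wpM2l.
have : 0 <= V (psi k) by apply: lnht_ge0.
by move: hk; lra.
Qed.

(** Otherwise the triple of [x k.+1], [x l], [x (psi k)] would be a point of the list of logarithmic
    height near [2 * V k - V l], strictly between [V k] and [V k.+1]. *)
Let no_between : ev (fun k => forall l, (psi k < l)%N -> (l < k)%N ->
  det3 (x k.+1) (x l) (x (psi k)) != 0).
Proof.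
have hb1 := b1; have hb2 := b2; have he1 := eta1; have he0 := eta0.
have [bt btE] : exists v : R, v = (2 - b) / 2 by eexists.
have bt0 : 0 < bt by rewrite btE; move: hb2; lra.
have bt1 : bt <= 1 / 2 by rewrite btE; move: hb1; lra.
have eb0 : 0 < eta * bt by rewrite mulr_gt0.
have dl0 : 0 < eta * bt / 4 by rewrite divr_gt0.
have [e1 e10 hev] := triple_in dl0.
have [N1 hN1] := xg e10.
have := ev_and (ev_and hev (psi_approx dl0)) (ev_and (ev_and (psi_large N1) (psi_large N)) (ev_and psi_ratio (ev_and (V_large 1) (ev_ge (maxn N N1).+1)))).
apply: ev_imp => k [[h [_ app]] [[p1 p2] [[pr pk] [V1 Nk]]]] l pl lk.
rewrite -btE in pr.
apply/eqP => d0.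
have Vk0 : 0 < V k by move: V1; lra.
have gl := xe (i := k.-1) ltac:(nlia); rewrite prednK in gl; last by nlia.
have lk1 : V l <= V k.-1 by apply: V_le; nlia.
have gp := xe (i := psi k) ltac:(nlia).
have pl1 : V (psi k).+1 <= V l by apply: V_le.
have gp' : eta * V (psi k) <= eta * V (psi k).+1 by rewrite ler_pM2l// V_le.
have e1' : eta * (bt * V k) <= eta * V (psi k) by rewrite ler_pM2l.
have e2 : eta * bt * V k <= eta * (1 / 2) * V k by rewrite ler_pM2r// ler_pM2l.
have e3 : 0 < eta * bt * V k by rewrite mulr_gt0.
have e4 : eta * bt * V k <= 1 * bt * V k by rewrite ler_pM2r// ler_pM2r.
have e5 : bt * V k <= 1 / 2 * V k by rewrite ler_pM2r.
move: app; rewrite ler_norml => /andP[a1 a2].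
have low : (2 - b) / 4 * V k <= V k.+1 + V (psi k) - V l.
  have -> : (2 - b) / 4 * V k = bt * V k / 2 by rewrite btE; field.
  by move: a1 gl lk1 e1' e2 e3 e4 e5 Vk0; lra.
have [i [hi _]] := h k.+1 l (psi k) ltac:(nlia) ltac:(nlia) ltac:(nlia)
  (hN1 k.+1 ltac:(nlia)) (hN1 l ltac:(nlia)) (hN1 (psi k) ltac:(nlia)) ltac:(nlia) ltac:(nlia) ltac:(nlia) d0 low.
move: hi; rewrite ler_norml => /andP[i1 i2].
have c1 : (k < i)%N by apply: V_ltE; move: i1 a1 gl lk1 e1' e2 e3; lra.
have c2 : (i < k.+1)%N by apply: V_ltE; move: i2 pl1 gp gp' e1' e3; lra.
by move: c1 c2; nlia.
Qed.

(** A shift by [M] replaces eventual statements by statements from the start; for [k >= C] the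
    memory bound gives [psi (k + M) >= M], so the subtraction does not truncate. *)
Lemma build_struct : exists M C, struct (fun i => x (i + M)%N) (fun i => (psi (i + M) - M)%N) C eta.
Proof.
have hb1 := b1; have hb2 := b2; have he1 := eta1; have he0 := eta0.
have [C hC] := psi_memory.
have [M hM] := ev_and (ev_and (ev_and hC no_between) (ev_and (psi_approx ltr01) psi_ratio))
   (ev_and (ev_ge N) (V_large 1)).
exists M, C.
have H i := hM (i + M)%N (leq_addl _ _).
have pE k : (C <= k)%N -> (psi (k + M) - M + M)%N = psi (k + M).
  by move=> Ck; apply: subnK; have [[[h _] _] _] := H k; move: h Ck; nlia.
split=> //.
- by move=> i; have [_ [_ h]] := H i; move: h; lra.
- by move=> i; apply: xd; have [_ [h _]] := H i.
- move=> k Ck; have [[_ [_ [_ h]]] _] := H k; have := pE k Ck; move: h; nlia.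
- move=> k Ck; have [[[h _] _] _] := H k; have := pE k Ck; move: h; nlia.
- move=> k Ck; rewrite pE//; have [[_ [[[g g0 e] _] _]] _] := H k.
  rewrite addSn -mx_of_trip ?det3aba// e.
  have -> : mx_of (scalpt g (x (psi (k + M)))) = scal2 g (mx_of (x (psi (k + M)))) by [].
  exact: proj_eq_scal.
- move=> k l Ck pl lk; rewrite pE//; have [[[_ h] _] _] := H k; apply: h.
    by have := pE k Ck; move: pl; nlia.
  by move: lk; nlia.
- move=> k Ck; have [_ [h v1]] := H k; apply: le_trans (xr h) _.
  by rewrite ler_pM2r ?ltW//; move: v1; lra.
- move=> k Ck; have [_ [h v1]] := H k; apply: le_trans (xe h).
  by rewrite ler_pM2l// V_le//; nlia.
move=> e e0; have [K hK] := psi_approx e0; exists (maxn K C) => k; rewrite geq_max => /andP[Kk Ck].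
rewrite pE// addSn; have [_] := hK (k + M)%N ltac:(move: Kk; nlia).
by congr (`| _ | <= _); ring.
Qed.

End Build.
Lemma number_struct (beta : R) : indep xi -> 1 < beta -> beta < 2 ->
  (forall eps b, 0 < eps < 1 -> beta < b -> cov eps b) ->
  exists x psi C eta, [/\ struct x psi C eta, 0 < eta,
    forall r, beta < r -> ev (fun i => lnht (x i.+1) <= r * lnht (x i))
    & forall e, 0 < e -> ev (fun i => good e (x i))].
Proof.
move=> ind be1 be2 hcov.
have [b bE] : exists v : R, v = (beta + 2) / 2 by eexists.
have [b' b'E] : exists v : R, v = (beta + b) / 2 by eexists.
have [h1 h2 h3 h4] : [/\ 1 < b', b' < b, b < 2 & beta < b'] by split; lra.
have b'0 : 0 < b' by lra.
have b1 : 1 < b by lra.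
have [eps0 /andP[eps00 eps04] himp] := good_improve xi b1 h3.
have eps0r : 0 < eps0 <= 1 / 4 by rewrite eps00.
have [x [x0 xinc xp xg xc]] := exists_list ind b'0 eps0r (hcov eps0 b' ltac:(lra) h4).
have [N0 rl0] := list_runlist ind eps04 b'0 h2 h3 (hcov eps0 b' ltac:(lra) h4) x0 xinc xp xg xc.
(* The list [y] of points good at the smaller level [eps] only supplies the hypothesis of [himp];
   the conclusion is about [x], which is therefore one list for all levels. *)
have xgood e : 0 < e -> ev (fun i => good e (x i)).
  move=> e0; have [eps /andP[p1 p2] hi] := himp e e0.
  have ce := hcov eps b' ltac:(lra) h4.
  have e4 : eps <= 1 / 4 by exact: le_trans p2 eps04.
  have epsr : 0 < eps <= 1 / 4 by rewrite p1.
  have [y [y0 yinc yp yg yc]] := exists_list ind b'0 epsr ce.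
  have [N1 rl1] := list_runlist ind e4 b'0 h2 h3 ce y0 yinc yp yg yc.
  have [V0 hV0] := hi y N1 rl1.
  by have := V_large rl0 V0; apply: ev_imp => i; apply: hV0.
have e1 : 0 < (2 - b) / 16 by lra.
have [N1 hN1] := xgood _ e1.
have rl1 : runlist xi x ((2 - b) / 16) b (maxn N0 N1).
  split=> //.
  - by move=> i; rewrite geq_max => /andP[_ /hN1].
  - by move=> i; rewrite geq_max => /andP[/(rl_disc rl0)].
  - by move=> i; rewrite geq_max => /andP[/(rl_rat rl0)].
  - exact: (rl_np rl0).
have [N2 N12 hgr] := growth1 rl1 b1 h3 (ltW e1) ltac:(lra).
have eta0 : 0 < (2 - b) / 2 by lra.
have [M [C st]] := @build_struct x b eps0 ((2 - b) / 2) N2 x0 xinc xp xgood xc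
  (fun i hi => rl_disc rl1 (leq_trans N12 hi)) (fun i hi => rl_rat rl1 (leq_trans N12 hi)) hgr b1 h3 eps00 eta0 ltac:(lra).
exists (fun i => x (i + M)%N), (fun i => (psi x (i + M) - M)%N), C, ((2 - b) / 2); split=> //.
- move=> r hr.
  have rr : beta < (beta + r) / 2 by lra.
  have [c hc] := @list_ratio R xi x eps0 ((beta + r) / 2) 4 N0 ind ltac:(lra) (hcov eps0 _ ltac:(lra) rr)
     x0 xinc xc (fun i hi => rl_disc rl0 hi).
  have := ev_shift M (ev_and hc (V_large rl0 (c / ((r - beta) / 2)))).
  apply: ev_imp => i [a1 a2]; rewrite addSn; apply: le_trans a1 _.
  have r0 : 0 < (r - beta) / 2 by lra.
  by have := le_of_large r0 a2; clear; lra.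
- by move=> e e0; exact: (ev_shift M (xgood e e0)).
Qed.

End Structure.

(** * The word of a number *)

Section PalSeq.
Local Open Scope nat_scope.
Variable A : eqType.

(** In the free group the prefix taken here is q p^-1, and its reversal is p^-1 q. *)
Lemma pal_split (p q s : seq A) : rev p = p -> rev q = q -> q = p ++ s ->
  q = take (size q - size p) q ++ p /\ q = p ++ rev (take (size q - size p) q).
Proof.
move=> hp hq e.
have e1 : q = rev s ++ p by rewrite -hq e rev_cat hp.
have e2 : take (size q - size p) q = rev s.
  by rewrite e1 size_cat addnK take_size_cat.
by rewrite e2 revK; split.
Qed.
End PalSeq.

Section PhiWords.
Variables (A : Type) (F : A -> m2).
Definition Phi (u : seq A) : m2 := foldr (fun a M => mul2 (F a) M) one2 u.

Lemma Phi_cat u v : Phi (u ++ v) = mul2 (Phi u) (Phi v).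
Proof. by elim: u => [|a u IH] /=; rewrite ?mul12// IH mul2A. Qed.

Lemma Phi1 a : Phi [:: a] = F a. Proof. by rewrite /= mul21. Qed.

Hypothesis Fsym : forall a, tr2 (F a) = F a.

Lemma Phi_rev u : Phi (rev u) = tr2 (Phi u).
Proof.
elim: u => [|a u IH]; first by [].
by rewrite rev_cons -cats1 Phi_cat Phi1 /= tr2_mul IH Fsym.
Qed.
End PhiWords.

Section BuildWord.
Variables (R : realType) (x : nat -> pt) (psi : nat -> nat) (C : nat) (eta : R).
Hypothesis st : struct x psi C eta.
Local Notation A := 'I_C.+1.
Local Notation S i := (mx_of (x i)).

(** Below [C] no relation [st_rel] is available, and a fresh letter is inserted instead; from [C]
    on, [take] computes the quotient of [h n] by its suffix [h (psi n)]. *)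
Definition wstep (n : nat) (h : nat -> seq A) : seq A :=
  if (n < C)%N then h n ++ inord n.+1 :: h n
  else take (size (h n) - size (h (psi n)))%N (h n) ++ h n.

(** Course-of-values recursion: [whist n] tabulates all words up to index [n], since [psi n] may be
    any earlier index. *)
Fixpoint whist (n : nat) : nat -> seq A :=
  if n is n'.+1 then fun k => if k == n then wstep n' (whist n') else whist n' k
  else fun _ => [:: ord0].

Definition wpi n := whist n n.

Lemma whistE n k : (k <= n)%N -> whist n k = wpi k.
Proof.
elim: n k => [|n IH] k; first by rewrite leqn0 => /eqP ->.
rewrite leq_eqVlt => /orP[/eqP ->//|kn] /=.
by rewrite ltn_eqF//= IH.
Qed.

Lemma psi_lt n : (C <= n)%N -> (psi n < n)%N. Proof. by move/(st_lt st). Qed.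

Lemma wpiS n : wpi n.+1 = wstep n wpi.
Proof.
rewrite /wpi /= eqxx /wstep; case: ltnP => nC //.
by rewrite !whistE// ltnW// psi_lt.
Qed.

Local Open Scope nat_scope.

(** Palindromicity and the prefix relation are proved together: the quotient in [wstep] is
    meaningful only if [wpi (psi n)] is a palindromic prefix of [wpi n]. *)
Lemma wpi_inv n : (forall i, i <= n -> rev (wpi i) = wpi i) /\
  (forall i, i < n -> exists s, wpi i.+1 = wpi i ++ s /\ 0 < size s).
Proof.
elim: n => [|n [IHp IHs]]; first by split=> // i; rewrite leqn0 => /eqP ->.
have pre i j : i <= j -> j <= n -> exists s, wpi j = wpi i ++ s.
  move=> ij; rewrite -(subnKC ij); elim: (j - i) => [|k IH] hk; first by exists [::]; rewrite addn0 cats0.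
  have [s e] := IH ltac:(move: hk; clear; nlia).
  have [s' [e' _]] := IHs (i + k) ltac:(move: hk; clear; nlia).
  by exists (s ++ s'); rewrite addnS e' e catA.
have mono i j : i < j -> j <= n -> size (wpi i) < size (wpi j).
  move=> ij jn; have [s' [e' s0]] := IHs i ltac:(move: ij jn; clear; nlia).
  have [s e] := pre i.+1 j ij jn; rewrite e e' !size_cat; move: s0; clear; nlia.
have main : rev (wpi n.+1) = wpi n.+1 /\ exists s, wpi n.+1 = wpi n ++ s /\ 0 < size s.
  rewrite wpiS /wstep; case: ltnP => nC.
    split; last by exists (inord n.+1 :: wpi n).
    by rewrite rev_cat rev_cons IHp// -cats1 -catA.
  have pn := psi_lt nC.
  have [s e] := pre (psi n) n (ltnW pn) (leqnn n).
  have [e1 e2] := pal_split (IHp _ (ltnW pn)) (IHp n (leqnn n)) e.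
  set r := take _ _ in e1 e2 *.
  (* Both sides are [r ++ wpi (psi n) ++ rev r], which yields symmetry and the prefix property at
     once. *)
  have E : r ++ wpi n = wpi n ++ rev r by rewrite [in LHS]e2 catA -e1.
  split; first by rewrite rev_cat IHp// -E.
  exists (rev r); split=> //; rewrite size_rev.
  have hs : size (wpi n) = size r + size (wpi (psi n)) by rewrite {1}e1 size_cat.
  by have := mono _ _ pn (leqnn n); rewrite hs -{1}[size (wpi (psi n))]add0n ltn_add2r.
split=> i; rewrite leq_eqVlt => /orP[/eqP e|].
- by rewrite e; case: main.
- by rewrite ltnS; exact: IHp.
- by case: e => ->; case: main.
- by rewrite ltnS; exact: IHs.
Qed.

Lemma wpi_rev n : rev (wpi n) = wpi n.
Proof. by have [h _] := wpi_inv n; apply: h. Qed.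

Lemma wpi_pre i j : i <= j -> exists s, wpi j = wpi i ++ s.
Proof.
move=> ij; rewrite -(subnKC ij); elim: (j - i) => [|k [s e]]; first by exists [::]; rewrite addn0 cats0.
have [_ h] := wpi_inv (i + k).+1; have [s' [e' _]] := h (i + k) (leqnn _).
by exists (s ++ s'); rewrite addnS e' e catA.
Qed.

Local Notation n_ i := (size (wpi i)).

Lemma wpi_size_lt i : n_ i < n_ i.+1.
Proof.
have [_ h] := wpi_inv i.+1; have [s [e s0]] := h i (leqnn _).
by rewrite e size_cat; move: s0; clear; nlia.
Qed.

Lemma wpi_size_mono i j : i < j -> n_ i < n_ j.
Proof.
elim: j => // j IH; rewrite ltnS leq_eqVlt => /orP[/eqP ->|/IH h]; first exact: wpi_size_lt.
exact: ltn_trans h (wpi_size_lt j).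
Qed.

Lemma wpi_size_ltE i j : n_ i < n_ j -> i < j.
Proof.
move=> h; rewrite ltnNge; apply/negP; rewrite leq_eqVlt => /orP[/eqP e|/wpi_size_mono].
  by move: h; rewrite e ltnn.
by rewrite ltnNge (ltnW h).
Qed.

Lemma wpi_size_gt i : i < n_ i.
Proof. by elim: i => // i IH; apply: leq_ltn_trans IH (wpi_size_lt i). Qed.

Lemma wpi_size_rec n : C <= n -> n_ n.+1 + n_ (psi n) = 2 * n_ n.
Proof.
move=> nC; rewrite wpiS /wstep ltnNge nC /= size_cat size_take.
have := wpi_size_mono (psi_lt nC); have := wpi_size_gt (psi n).
by case: ifP; clear; nlia.
Qed.

Definition wword (m : nat) : A := nth ord0 (wpi m) m.

Lemma wwordE i m : m < n_ i -> wword m = nth ord0 (wpi i) m.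
Proof.
move=> mi; rewrite /wword; have [im|mi'] := leqP i m.
  by have [s ->] := wpi_pre im; rewrite nth_cat mi.
by have [s ->] := wpi_pre (ltnW mi'); rewrite nth_cat wpi_size_gt.
Qed.

Lemma mkseq_wword i : mkseq wword (n_ i) = wpi i.
Proof.
apply: (@eq_from_nth _ ord0); rewrite size_mkseq// => m hm.
by rewrite nth_mkseq// (wwordE hm).
Qed.

Lemma mkseq_take i m : m <= n_ i -> mkseq wword m = take m (wpi i).
Proof.
move=> hm; apply: (@eq_from_nth _ ord0); rewrite size_mkseq ?size_takel// => j hj.
by rewrite nth_mkseq// nth_take// (@wwordE i)//; apply: leq_trans hm.
Qed.

(** The matrix of a fresh letter [i.+1] is dictated by [S i F S i = S i.+1] up to a scalar. *)
Definition wF (a : A) : m2 :=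
  if val a is i.+1 then mul2 (mul2 (adj2 (S i)) (S i.+1)) (adj2 (S i)) else S 0.

Lemma wF_sym a : tr2 (wF a) = wF a.
Proof.
rewrite /wF; case: (val a) => [|i]; first by [].
by rewrite /mul2 /tr2 /=; congr M2; ring.
Qed.

Local Notation Ph := (Phi wF).

Lemma det_S i : det2 (S i) != 0%R. Proof. by have := st_disc st i. Qed.

(** At a fresh letter this is the choice of [wF]. Afterwards, taking adjugates in [st_rel] gives
    [S n.+1] as [S n adj(S (psi n)) S n] up to a scalar, the matrix form of the rule for words. *)
Lemma Phi_wpi i : proj_eq (Ph (wpi i)) (S i).
Proof.
elim/ltn_ind: i => -[|n] IH.
  by rewrite /wpi /= mul21 /wF /=; exact: proj_eq_refl.
have In := IH n (leqnn _).
have canc M : proj_eq (mul2 (mul2 (S n) (mul2 (mul2 (adj2 (S n)) M) (adj2 (S n)))) (S n)) M.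
  have -> : mul2 (mul2 (S n) (mul2 (mul2 (adj2 (S n)) M) (adj2 (S n)))) (S n)
    = scal2 (disc (x n) * disc (x n)) M.
    rewrite !mul2A mul2_adj -!mul2A mul_adj2 scal2_mull mul12 scal2_mulr mul21 scal2A.
    by rewrite det2_mx_of.
  by apply: proj_eq_scal; rewrite mulf_neq0//; exact: det_S.
rewrite wpiS /wstep; case: ltnP => nC.
  rewrite -cat1s !Phi_cat Phi1.
  have -> : wF (inord n.+1) = mul2 (mul2 (adj2 (S n)) (S n.+1)) (adj2 (S n)).
    by rewrite /wF (_ : val (inord n.+1 : 'I_C.+1) = n.+1)//; exact: inordK.
  apply: proj_eq_trans (canc _); rewrite mul2A.
  by apply: proj_eq_mul => //; apply: proj_eq_mul => //; exact: proj_eq_refl.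
have pn := psi_lt nC.
have [s e] := wpi_pre (ltnW pn).
have [e1 _] := pal_split (wpi_rev (psi n)) (wpi_rev n) e.
set r := take _ _ in e1 *.
have hr : proj_eq (Ph r) (mul2 (S n) (adj2 (S (psi n)))).
  apply: proj_eq_mulrI (det_S _) _; apply: proj_eq_trans In.
  rewrite e1 Phi_cat; apply: proj_eq_mul; first exact: proj_eq_refl.
  by apply: proj_eq_sym; apply: IH; exact: ltnW.
rewrite Phi_cat; apply: proj_eq_trans (proj_eq_mul hr In) _.
apply: proj_eq_trans (canc (S n.+1)).
apply: proj_eq_mul (proj_eq_refl _); apply: proj_eq_mul; first exact: proj_eq_refl.
have := proj_eq_adj (proj_eq_sym (st_rel st nC)); rewrite /trip_mx !adj2_mul adj2K mul2A.
by [].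
Qed.

Lemma wpi_letters i : i <= C -> forall a, a \in wpi i -> nat_of_ord a <= i.
Proof.
elim: i => [_ a|i IH iC a]; first by rewrite /wpi /= inE => /eqP ->.
rewrite wpiS /wstep iC mem_cat inE => /or3P[h|/eqP ->|h].
- by apply: leqW; apply: IH => //; exact: ltnW.
- by rewrite inordK.
- by apply: leqW; apply: IH => //; exact: ltnW.
Qed.

Lemma wword_pal i : pal_prefix wword (n_ i).
Proof. by rewrite /pal_prefix mkseq_wword wpi_rev. Qed.

(** Suppose [m] lies strictly between the lengths of [wpi k] and [wpi k.+1]. If [k < C], the fresh
    letter [k.+1] would be mirrored into a copy of [wpi k], whose letters are at most [k]. If
    [k >= C], reflection in [wpi k] gives a shorter palindromic prefix, by induction some [wpi l]
    with [psi k < l < k]; the image of the prefix of length [m] is then the triple of [x k.+1],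
    [x l], [x (psi k)] up to a scalar, and its symmetry is the coplanarity excluded by [st_no]. *)
Lemma wword_pal_only m : 0 < m -> pal_prefix wword m -> exists i, n_ i = m.
Proof.
elim/ltn_ind: m => m IH m0 pm.
have ex : exists i, n_ i <= m by exists 0.
have ub i : n_ i <= m -> i <= m by apply: leq_trans; rewrite ltnW// wpi_size_gt.
case: (ex_maxnP ex ub) => k hk hmax.
have mk : m < n_ k.+1 by rewrite ltnNge; apply/negP => /hmax; rewrite ltnn.
move: hk; rewrite leq_eqVlt => /orP[/eqP e|km]; first by exists k.
exfalso; have [kC|Ck] := ltnP k C.
  have sz : n_ k.+1 = (n_ k).*2.+1 by rewrite wpiS /wstep kC size_cat /= addnS addnn.
  have w1 : wword (n_ k) = inord k.+1.
    rewrite (@wwordE k.+1) ?wpi_size_lt// wpiS /wstep kC nth_cat ltnn subnn.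
    by [].
  have h2 : m - (n_ k).+1 < n_ k by move: mk km; rewrite sz; clear; nlia.
  have := pal_prefixP _ _ pm (n_ k) km; rewrite w1 (wwordE h2) => e.
  by have := wpi_letters (ltnW kC) (mem_nth ord0 h2); rewrite -e inordK// ltnn.
have rec := wpi_size_rec Ck; have pk := psi_lt Ck.
have m'1 : n_ (psi k) < 2 * n_ k - m by move: rec mk; clear; nlia.
have nk0 : 0 < n_ k by apply: leq_ltn_trans (wpi_size_gt k).
have m'2 : 2 * n_ k - m < n_ k by move: km nk0; clear; nlia.
have pm' : pal_prefix wword (2 * n_ k - m).
  by apply: pal_reflect (wword_pal k) pm (ltnW km) _; move: rec mk; clear; nlia.
have [l hl] := IH (2 * n_ k - m) ltac:(move: km nk0; clear; nlia) ltac:(move: m'1; clear; nlia) pm'.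
have lk : l < k by apply: wpi_size_ltE; rewrite hl.
have pl : psi k < l by apply: wpi_size_ltE; rewrite hl.
have /eqP := st_no st Ck pl lk; apply; apply: sym_det3.
set p := take m (wpi k.+1).
have pE : mkseq wword m = p by apply: mkseq_take; exact: ltnW.
have prev : rev p = p by rewrite -pE; move/eqP: pm => <-.
have [s e] : exists s, wpi k.+1 = p ++ s by exists (drop m (wpi k.+1)); rewrite cat_take_drop.
have [_ e2] := pal_split prev (wpi_rev k.+1) e.
have szp : size p = m by rewrite size_takel// ltnW.
rewrite szp in e2; set q := rev _ in e2.
have [s' e'] := wpi_pre (ltnW pl).
have [e3 _] := pal_split (wpi_rev (psi k)) (wpi_rev l) e'.
set r := take _ _ in e3.
have qr : q = rev r.
  congr rev; rewrite /r; have -> : n_ l - n_ (psi k) = n_ k.+1 - m.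
    by rewrite hl; move: rec mk km; clear; nlia.
  have : n_ k.+1 - m <= n_ l by rewrite hl; move: rec mk km; clear; nlia.
  move: (n_ k.+1 - m) => t tl; have [s2 ->] := wpi_pre (leqW (ltnW lk)).
  by rewrite takel_cat.
have hr : proj_eq (Ph r) (mul2 (S l) (adj2 (S (psi k)))).
  apply: proj_eq_mulrI (det_S _) _; apply: proj_eq_trans (Phi_wpi l).
  rewrite e3 Phi_cat; apply: proj_eq_mul; first exact: proj_eq_refl.
  exact/proj_eq_sym/Phi_wpi.
have hq : proj_eq (Ph q) (mul2 (adj2 (S (psi k))) (S l)).
  have := proj_eq_tr hr; rewrite -(Phi_rev wF_sym) -qr tr2_mul.
  by [].
have dq : det2 (mul2 (adj2 (S (psi k))) (S l)) != 0%R.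
  by rewrite det2_mul det2_adj mulf_neq0//; exact: det_S.
have hp : proj_eq (Ph p) (trip_mx (x k.+1) (x l) (x (psi k))).
  have -> : trip_mx (x k.+1) (x l) (x (psi k)) = mul2 (S k.+1) (adj2 (mul2 (adj2 (S (psi k))) (S l))).
    by rewrite adj2_mul adj2K mul2A.
  apply: proj_eq_mulrI dq _; apply: proj_eq_trans (Phi_wpi k.+1).
  rewrite e2 Phi_cat; apply: proj_eq_mul; first exact: proj_eq_refl.
  exact: proj_eq_sym.
apply: (proj_eq_sym2 hp); apply/sym2P.
by rewrite -(Phi_rev wF_sym) prev.
Qed.

Lemma wword_inf : inf_pal_prefixes wword.
Proof. by move=> n; exists (n_ n); rewrite wpi_size_gt wword_pal. Qed.

Lemma wword_len i : pal_len wword i = n_ i.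
Proof.
rewrite pal_len_nthsat; apply: (@nthsat_eq _ wword_inf (fun i => n_ i)) => //.
- exact: wpi_size_lt.
- exact: wword_pal.
- exact: wword_pal_only.
Qed.

End BuildWord.

Lemma struct_word (R : realType) (x : nat -> pt) psi C (eta : R) : struct x psi C eta ->
  exists w : nat -> 'I_C.+1, inf_pal_prefixes w /\
   forall k, (C <= k)%N -> (pal_len w k.+1 + pal_len w (psi k) = 2 * pal_len w k)%N.
Proof.
move=> st; exists (@wword psi C); split; first exact: (wword_inf st).
by move=> k Ck; rewrite !(wword_len st); exact: (wpi_size_rec st).
Qed.

(** * Linear independence of 1, xi, xi^2 and the degree of Q(xi) *)

Section Degree.
Variables (R : realType) (xi : R).

Lemma indep_nonquadratic : indep xi -> irrational xi /\ nonquadratic xi.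
Proof.
move=> ind; split.
  move=> [q _ hq]; have [] := ind (- numq q) (denq q) 0.
    rewrite mulr0z mul0r addr0 intrN -hq /ratr mulrC divfK ?addNr//.
    by rewrite intr_eq0 denq_neq0.
  by move=> _ /eqP; rewrite (negbTE (denq_neq0 q)).
exists (fun i : 'I_3 => xi ^+ i); split.
  move=> i K [K1 _ Kdiv] Kxi.
  have Kinv y : y \in K -> y^-1 \in K by move=> Ky; rewrite -[y^-1]mul1r; exact: Kdiv.
  have Kmul y z : y \in K -> z \in K -> y * z \in K.
    by move=> Ky Kz; rewrite -[z]invrK; apply: Kdiv => //; exact: Kinv.
  by elim: (nat_of_ord i) => [|n IH]; rewrite ?expr0// exprS; exact: Kmul.
move=> c; rewrite !big_ord_recl big_ord0 /= addr0 expr0 mulr1 expr1 => h.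
set q0 := c ord0 in h; set q1 := c (lift ord0 ord0) in h; set q2 := c (lift ord0 (lift ord0 ord0)) in h.
have dn q : (denq q)%:~R != 0 :> R by rewrite intr_eq0 denq_neq0.
have [] := ind (numq q0 * denq q1 * denq q2) (numq q1 * denq q0 * denq q2) (numq q2 * denq q0 * denq q1).
  rewrite !intrM.
  have : (denq q0)%:~R * (denq q1)%:~R * (denq q2)%:~R *
    (ratr q0 + (ratr q1 * xi + ratr q2 * xi ^+ 2)) = 0 :> R by rewrite h mulr0.
  rewrite /ratr => <-; field.
  by rewrite !dn.
move=> /eqP e0 /eqP e1 /eqP e2.
have z (q : rat) : numq q = 0 -> q = 0 by move=> e; apply/eqP; rewrite -numq_eq0 e.
move: e0 e1 e2; rewrite !mulf_eq0 !(negbTE (denq_neq0 _)) !orbF => /eqP/z e0 /eqP/z e1 /eqP/z e2.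
case=> -[|[|[|//]]] hi.
- by rewrite -e0; congr c; apply: val_inj.
- by rewrite -e1; congr c; apply: val_inj.
- by rewrite -e2; congr c; apply: val_inj.
Qed.

(** A relation with [c != 0] makes the numbers s + t xi, with s and t rational, a field containing
    Q(xi); three of its elements are dependent because a 3 by 2 rational matrix has a nonzero left
    kernel. *)
Lemma nonquadratic_indep : irrational xi -> nonquadratic xi -> indep xi.
Proof.
move=> irr [v [vK vind]] a b c h.
have irr' (p q : rat) : ratr p + ratr q * xi = 0 :> R -> p = 0 /\ q = 0.
  have [->|q0] := eqVneq q 0.
    by rewrite rmorph0 mul0r addr0 => /eqP; rewrite fmorph_eq0 => /eqP.
  move=> e; exfalso; apply: irr; exists (- p / q) => //.
  have q0' : ratr q != 0 :> R by rewrite fmorph_eq0.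
  rewrite fmorph_div rmorphN; apply: (mulIf q0'); rewrite divfK//.
  by apply/eqP; rewrite -subr_eq0 -oppr_eq0 -e; apply/eqP; ring.
have [c0|c0] := eqVneq c 0.
  move: h; rewrite c0 mulr0z mul0r addr0 => h.
  have [] := irr' a%:~R b%:~R; first by rewrite !ratr_int.
  by move=> /eqP + /eqP; rewrite !intr_eq0 => /eqP -> /eqP ->.
exfalso.
have [p pE] : exists p : rat, p = - b%:~R / c%:~R by eexists.
have [q qE] : exists q : rat, q = - a%:~R / c%:~R by eexists.
have cR : c%:~R != 0 :> R by rewrite intr_eq0.
have x2 : xi ^+ 2 = ratr p * xi + ratr q.
  rewrite pE qE !fmorph_div !rmorphN /= !ratr_int; apply: (mulfI cR).
  transitivity (- a%:~R - b%:~R * xi : R); last by field.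
  by apply/eqP; rewrite -subr_eq0 -h; apply/eqP; ring.
set K : {pred R} := fun y => `[< exists s t : rat, y = ratr s + ratr t * xi >].
have inK y : reflect (exists s t : rat, y = ratr s + ratr t * xi) (y \in K).
  exact: asboolP.
have Kxi : xi \in K by apply/inK; exists 0, 1; rewrite rmorph0 rmorph1 add0r mul1r.
have Kinv y : y \in K -> y^-1 \in K.
  move=> /inK [s [t ->]].
  have [z|nz] := eqVneq (ratr s + ratr t * xi : R) 0.
    by rewrite z invr0; apply/inK; exists 0, 0; rewrite !rmorph0 mul0r addr0.
  (* The norm of s + t xi for xi^2 = p xi + q; the second factor in [E] is the conjugate. *)
  set n : rat := s ^+ 2 + s * t * p - t ^+ 2 * q.
  have E : (ratr s + ratr t * xi) * (ratr (s + t * p) + ratr (- t) * xi) = ratr n :> R.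
    rewrite /n !(rmorphD, rmorphN, rmorphM, rmorphXn) /=.
    transitivity (ratr s ^+ 2 + ratr s * ratr t * ratr p + ratr t ^+ 2 * ratr p * xi - ratr t ^+ 2 * xi ^+ 2 : R); first by ring.
    by rewrite x2; ring.
  have n0 : ratr n != 0 :> R.
    rewrite -E mulf_neq0//; apply/eqP => /irr' [e1 e2].
    move/eqP: nz; apply; move/eqP: e2; rewrite oppr_eq0 => /eqP t0.
    by move: e1; rewrite t0 mul0r addr0 => ->; rewrite !rmorph0 mul0r addr0.
  apply/inK; exists ((s + t * p) / n), (- t / n).
  rewrite !fmorph_div; apply: (mulfI nz); rewrite mulfV//.
  by apply: (mulIf n0); rewrite mul1r -{1}E; field.
have Kmul y z : y \in K -> z \in K -> y * z \in K.
  move=> /inK [s [t ->]] /inK [s' [t' ->]]; apply/inK.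
  exists (s * s' + t * t' * q), (s * t' + t * s' + t * t' * p).
  rewrite !(rmorphD, rmorphM) /=.
  transitivity (ratr s * ratr s' + (ratr s * ratr t' + ratr t * ratr s') * xi + ratr t * ratr t' * xi ^+ 2 : R); first by ring.
  by rewrite x2; ring.
have Kdiv : divring_closed K.
  split.
  - by apply/inK; exists 1, 0; rewrite rmorph1 rmorph0 mul0r addr0.
  - move=> y z /inK [s [t ->]] /inK [s' [t' ->]]; apply/inK; exists (s - s'), (t - t').
    by rewrite !rmorphB /=; ring.
  - by move=> y z Ky Kz; apply: Kmul => //; exact: Kinv.
have hv i : exists st : rat * rat, v i = ratr st.1 + ratr st.2 * xi.
  by have /inK [s [t e]] := vK i K Kdiv Kxi; exists (s, t).
have [f hf] := choice hv.
pose M : 'M[rat]_(3, 2) := \matrix_(i, j) (if j == 0 then (f i).1 else (f i).2).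
have : kermx M != 0.
  rewrite kermx_eq0 /row_free; apply: contraTneq (rank_leq_col M) => ->.
  by [].
move/rowV0Pn => [u /sub_kermxP uM u0].
have E j : \sum_i u 0 i * M i j = 0.
  by have := congr1 (fun T : 'M[rat]_(1, 2) => T 0 j) uM; rewrite !mxE.
have uz : forall i, u 0 i = 0.
  apply: (vind (fun i => u 0 i)).
  under eq_bigr => i _ do rewrite hf mulrDr mulrA -!rmorphM.
  rewrite big_split /= -mulr_suml -!rmorph_sum.
  have := E 0; under eq_bigr => i _ do rewrite mxE /=; move=> ->.
  have := E 1; under eq_bigr => i _ do rewrite mxE /=; move=> ->.
  by rewrite rmorph0 mul0r addr0.
by move/eqP: u0; apply; apply/rowP => i; rewrite uz mxE.
Qed.

End Degree.

(** * From the exponent of a number to the exponent of a word *)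

Section FromNumber.
Variables (R : realType) (xi : R).

Lemma beta0_le b : (forall eps, 0 < eps < 1 -> beta_set xi eps b) -> (beta0 xi <= b%:E)%E.
Proof.
move=> h; apply: ge_ereal_sup => _ [eps /= he <-]; apply: ereal_inf_lbound.
by exists b => //; exact: h.
Qed.

Lemma beta0_cov (beta : R) : beta0 xi = beta%:E ->
  forall eps b, 0 < eps < 1 -> beta < b -> cov xi eps b.
Proof.
move=> hb eps b e01 bb.
have : (beta_eps xi eps < b%:E)%E.
  apply: (@le_lt_trans _ _ (beta0 xi)); last by rewrite hb lte_fin.
  by apply: ereal_sup_ubound; exists eps.
move=> /ereal_inf_lt [_ [b' h <-]]; rewrite lte_fin => b'b.
apply: (@cov_le _ _ _ b'); [by case: h|exact: ltW|].
by apply: beta_set_cov h; case/andP: e01.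
Qed.

Lemma number_to_word (beta : R) : irrational xi -> nonquadratic xi ->
  1 < beta -> beta < 2 -> beta0 xi = beta%:E ->
  exists (A : finType) (w : nat -> A), beta%:E = delta_word R w.
Proof.
move=> irr nq b1 b2 hb; have ind := nonquadratic_indep irr nq.
have [x [psi [C [eta [st eta0 hup hgood]]]]] := number_struct ind b1 b2 (beta0_cov hb).
have [w [winf wrec]] := struct_word st.
exists 'I_C.+1, w; rewrite /delta_word; case: pselect => [winf'|//].
set n := fun i => (pal_len w i)%:R : R; set v := fun i => lnht R (x i).
have n_inc i : n i < n i.+1 by rewrite /n ltr_nat (nthsat_lt winf).
have n_pos i : 0 < n i by rewrite /n ltr0n; apply: leq_ltn_trans (nthsat_gt winf i).
have v_pos i : 0 < v i by exact: (st_V st).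
(* The memory bound is enlarged because [ratio_asymp] needs a window containing two successive
   slopes. *)
have C2 : (2 <= C.+2)%N by [].
have pl i : (C <= i)%N -> (psi i < i)%N by exact: (st_lt st).
have pg i : (C <= i)%N -> (i <= psi i + C.+2)%N.
  by move=> /(st_ge st) h; apply: leq_trans h _; rewrite !addnS leqW.
have nr i : (C <= i)%N -> n i.+1 = 2 * n i - n (psi i).
  move=> Ci; apply/eqP; rewrite eq_sym subr_eq eq_sym /n -natrD wrec// natrM.
  by [].
have diff := @ratio_asymp R n v psi C C.+2 eta C2 n_pos n_inc v_pos eta0 pl pg nr (st_le2 st) (st_grow st) (st_rec st).
symmetry; apply: limn_esup_eq => r hr.
  have e0 : 0 < (r - beta) / 2 by lra.
  have rr : beta < (beta + r) / 2 by lra.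
  have := ev_and (diff _ e0) (hup _ rr); apply: ev_imp => i [h1 h2].
  have : v i.+1 / v i <= (beta + r) / 2 by rewrite ler_pdivrMr.
  move: h1; rewrite ler_norml => /andP[_ h1] h3; rewrite -/(n i.+1) -/(n i).
  move: h1 h3; lra.
move=> hev.
(* The maximum with 1 keeps [r'] positive, as [list_beta_set] requires. *)
set r' := Num.max 1 ((r + beta) / 2).
have r'b : r' < beta by rewrite gt_max b1 /=; lra.
have r'1 : 1 <= r' by rewrite le_max lexx.
have r'2 : (r + beta) / 2 <= r' by rewrite le_max lexx orbT.
have e0 : 0 < (beta - r) / 2 by lra.
have hv : ev (fun i => v i.+1 <= r' * v i).
  have := ev_and hev (diff _ e0); apply: ev_imp => i [h1 h2].
  rewrite -ler_pdivrMr//; apply: le_trans r'2.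
  move: h2; rewrite ler_norml => /andP[h2 _]; rewrite -/(n i.+1) -/(n i) in h1.
  move: h1 h2; lra.
have : (beta0 xi <= ((r' + beta) / 2)%:E)%E.
  apply: beta0_le => eps /andP[p0 p1].
  apply: (@list_beta_set R xi x r') => //; [exact: (st_pos st)|exact: (st_inc st)|lra|lra].
rewrite hb lee_fin; lra.
Qed.

End FromNumber.

(** * The number of a word *)

Section CFWords.
Variable A : finType.

(* Letters are encoded by distinct partial quotients, all at least 2. *)
Definition cfF (a : A) : m2 := M2 (enum_rank a).+2%:Z 1 1 0.
Local Notation Ph := (Phi cfF).

Lemma cfF_sym a : tr2 (cfF a) = cfF a. Proof. by []. Qed.

Lemma cf_inv u : [/\ 0 <= m10 (Ph u) < m00 (Ph u), 0 <= m01 (Ph u) & 0 <= m11 (Ph u)].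
Proof.
elim: u => [|a u [/andP[h1 h2] h3 h4]] //=.
have : 0 <= (enum_rank a : nat)%:Z by [].
set e := (enum_rank a : nat)%:Z; have -> : (enum_rank a).+2%:Z = e + 2 by rewrite /e; lia.
move=> e0; have t1 : 0 <= e * m00 (Ph u) by rewrite mulr_ge0//; lia.
have t2 : 0 <= e * m01 (Ph u) by rewrite mulr_ge0.
by split; rewrite ?mulrDl; lia.
Qed.

Lemma cf_m01 u : m01 (Ph u) < m00 (Ph u).
Proof.
have [/andP[_ +] _ _] := cf_inv (rev u).
by rewrite (Phi_rev cfF_sym).
Qed.

Lemma cf_m00_gt0 u : 0 < m00 (Ph u).
Proof. by have [/andP[h1 h2] _ _] := cf_inv u; apply: le_lt_trans h2. Qed.

Lemma cf_det u : det2 (Ph u) = 1 \/ det2 (Ph u) = -1.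
Proof.
elim: u => [|a u IH] /=; first by left.
rewrite det2_mul; have -> : det2 (cfF a) = -1 by rewrite /det2 /=; lia.
by case: IH => ->; [right|left].
Qed.

(** The second product in the expansion is nonnegative and at most the first; logarithmic heights
    are thus additive under concatenation up to ln 2. *)
Lemma cf_m00_cat u v : m00 (Ph u) * m00 (Ph v) <= m00 (Ph (u ++ v)) <= 2 * (m00 (Ph u) * m00 (Ph v)).
Proof.
rewrite Phi_cat /=.
have [/andP[a1 a2] a3 _] := cf_inv u; have [/andP[b1 b2] _ _] := cf_inv v.
have c := cf_m01 u.
have h1 : 0 <= m01 (Ph u) * m10 (Ph v) by rewrite mulr_ge0.
have h2 : m01 (Ph u) * m10 (Ph v) <= m00 (Ph u) * m00 (Ph v) by rewrite ler_pM// ltW.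
by apply/andP; split; lia.
Qed.

Lemma cf_m00_lower u : 2 ^+ size u <= m00 (Ph u).
Proof.
elim: u => [|a u IH] //=; rewrite exprS.
have [/andP[h1 _] _ _] := cf_inv u; have h := cf_m00_gt0 u.
have : 0 <= (enum_rank a : nat)%:Z * m00 (Ph u) by rewrite mulr_ge0// ltW.
have -> : (enum_rank a).+2%:Z = (enum_rank a : nat)%:Z + 2 by lia.
by rewrite mulrDl; lia.
Qed.

Local Notation q := (#|A|.+2%:Z).

Lemma cf_m00_upper u : m00 (Ph u) <= q ^+ size u.
Proof.
elim: u => [|a u IH] //=; rewrite exprS.
have [/andP[h1 h2] _ _] := cf_inv u; have h := cf_m00_gt0 u.
apply: (@le_trans _ _ (q * m00 (Ph u))); last by rewrite ler_pM2l.
apply: (@le_trans _ _ (((enum_rank a).+2%:Z + 1) * m00 (Ph u))).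
  by rewrite mulrDl lerD2l !mul1r ltW.
rewrite ler_pM2r//; have : (enum_rank a < #|A|)%N := ltn_ord _; move: (nat_of_ord _) => e; lia.
Qed.

Lemma cf_digit (i j : nat) (m x y : int) : 0 <= x < m -> 0 <= y < m ->
  i.+2%:Z * m + 1 * x = j.+2%:Z * m + 1 * y -> i = j.
Proof.
rewrite !mul1r => hx hy /(congr1 (divz^~ m)).
have m0 : 0 < m by move: hx; lia.
have mn : m != 0 by rewrite gt_eqF.
have dz z : 0 <= z < m -> (z %/ m)%Z = 0 by move=> hz; apply: divz_small; move: hz; lia.
rewrite !divzMDl// (dz x hx) (dz y hy) !addr0; lia.
Qed.

(** Uniqueness of continued fraction expansions: Euclidean division in the first column recovers the
    first letter. *)
Lemma cf_inj u v : size u = size v -> Ph u = Ph v -> u = v.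
Proof.
elim: u v => [|a u IH] [|b v] //= [sz] [e1 e2 e3 e4].
have E : m00 (Ph u) = m00 (Ph v) by move: e3; rewrite !mul1r !mul0r !addr0.
have E1 : m01 (Ph u) = m01 (Ph v) by move: e4; rewrite !mul1r !mul0r !addr0.
have [h1 _ _] := cf_inv u; have [h2 _ _] := cf_inv v.
rewrite E in e1 h1; have ab := cf_digit h1 h2 e1.
have ab' : a = b by apply: enum_rank_inj; apply: val_inj.
congr cons => //; apply: IH => //.
move: e1 e2; rewrite ab' E1 !mul1r => /addrI e1 /addrI e2.
by move: E E1 e1 e2; case: (Ph u) => ? ? ? ?; case: (Ph v) => ? ? ? ? /= -> -> -> ->.
Qed.

Variable w : nat -> A.
(** The first column holds denominator and numerator of the n-th convergent of [0; a_1, a_2, ...],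
    the second column those of the previous one. *)
Definition cfP n : m2 := Ph (mkseq w n).

Lemma mkseqS' n : mkseq w n.+1 = mkseq w n ++ [:: w n].
Proof. by rewrite /mkseq -addn1 iotaD map_cat. Qed.

Lemma cfPS n : [/\ m00 (cfP n.+1) = (enum_rank (w n)).+2%:Z * m00 (cfP n) + m01 (cfP n),
  m01 (cfP n.+1) = m00 (cfP n),
  m10 (cfP n.+1) = (enum_rank (w n)).+2%:Z * m10 (cfP n) + m11 (cfP n)
  & m11 (cfP n.+1) = m10 (cfP n)].
Proof. by rewrite /cfP mkseqS' Phi_cat Phi1 /=; split; ring. Qed.

Lemma cfP_gt0 n : 0 < m00 (cfP n). Proof. exact: cf_m00_gt0. Qed.

Lemma cfP_double n : 2 * m00 (cfP n) <= m00 (cfP n.+1).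
Proof.
have [-> _ _ _] := cfPS n; have [_ h _] := cf_inv (mkseq w n).
have h0 := cfP_gt0 n.
have : 0 <= (enum_rank (w n) : nat)%:Z * m00 (cfP n) by rewrite mulr_ge0// ltW.
have -> : (enum_rank (w n)).+2%:Z = (enum_rank (w n) : nat)%:Z + 2 by lia.
rewrite /cfP in h *; rewrite mulrDl; lia.
Qed.

Lemma cfP_succ_le n : m00 (cfP n.+1) <= q * m00 (cfP n).
Proof.
have [-> _ _ _] := cfPS n; have h := cf_m01 (mkseq w n); have h0 := cfP_gt0 n.
apply: (@le_trans _ _ (((enum_rank (w n)).+2%:Z + 1) * m00 (cfP n))).
  by rewrite mulrDl mul1r lerD2l; exact: ltW.
rewrite ler_pM2r//; have : (enum_rank (w n) < #|A|)%N := ltn_ord _; move: (nat_of_ord _) => e; lia.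
Qed.

Variable R : realType.
Let p n : R := (m00 (cfP n))%:~R.
Let r n : R := (m10 (cfP n))%:~R.

Let p_gt0 n : 0 < p n. Proof. by rewrite /p ltr0z cfP_gt0. Qed.
Let p_double n : 2 * p n <= p n.+1.
Proof. by rewrite /p -[2]/(2%:~R : R) -intrM ler_int cfP_double. Qed.

Let f n : R := r n / p n.

Let f_step n : `|f n.+1 - f n| <= 1 / (p n * p n.+1).
Proof.
have [_ e1 _ e3] := cfPS n.
have pn := p_gt0 n; have pn1 := p_gt0 n.+1.
have -> : f n.+1 - f n = (r n.+1 * p n - p n.+1 * r n) / (p n * p n.+1).
  by rewrite /f; field; rewrite !gt_eqF.
have pp : 0 < p n * p n.+1 by rewrite mulr_gt0.
rewrite normf_div (gtr0_norm pp) ler_pM2r ?invr_gt0//.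
have -> : r n.+1 * p n - p n.+1 * r n = (- det2 (cfP n.+1))%:~R.
  by rewrite /det2 e1 e3 /r /p; ring.
by case: (cf_det (mkseq w n.+1)) => ->; rewrite ?opprK ?intrN ?normrN normr1.
Qed.

Let lo n := f n - 1 / p n ^+ 2.
Let up n := f n + 1 / p n ^+ 2.

Let nested n : lo n <= lo n.+1 /\ up n.+1 <= up n.
Proof.
have pn := p_gt0 n; have pd := p_double n; have pn1 := p_gt0 n.+1.
have h1 : 1 / (p n * p n.+1) <= 1 / 2 * (1 / p n ^+ 2).
  have -> : 1 / 2 * (1 / p n ^+ 2) = 1 / (2 * p n ^+ 2) by field; rewrite gt_eqF.
  rewrite !div1r lef_pV2 ?posrE ?mulr_gt0 ?exprn_gt0//.
  by rewrite expr2 mulrCA ler_pM2l.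
have h2 : 1 / p n.+1 ^+ 2 <= 1 / 4 * (1 / p n ^+ 2).
  have -> : 1 / 4 * (1 / p n ^+ 2) = 1 / (4 * p n ^+ 2) by field; rewrite gt_eqF.
  rewrite !div1r lef_pV2 ?posrE ?mulr_gt0 ?exprn_gt0//.
  have -> : 4 * p n ^+ 2 = (2 * p n) ^+ 2 by ring.
  by rewrite lerXn2r ?nnegrE ?mulr_ge0 ?(ltW pn) ?(ltW pn1).
have h3 : 0 < 1 / p n ^+ 2 by rewrite divr_gt0// exprn_gt0.
have := f_step n; rewrite ler_norml => /andP[a1 a2].
by rewrite /lo /up; split; move: h1 h2 h3 a1 a2; lra.
Qed.

(** Denominators at least double, so the intervals of radius 1 / p^2 around the convergents are
    nested; [xi] is the supremum of their left ends. *)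
Lemma cf_limit : exists xi : R, `|xi| <= 2 /\
  forall n, `|(m00 (cfP n))%:~R * xi - (m10 (cfP n))%:~R| <= 1 / (m00 (cfP n))%:~R.
Proof.
have lo_mono m n : (m <= n)%N -> lo m <= lo n.
  by elim: n => [|n IH]; first (by rewrite leqn0 => /eqP->); rewrite leq_eqVlt => /orP[/eqP->//|/IH h];
     apply: le_trans h _; have [] := nested n.
have up_mono m n : (m <= n)%N -> up n <= up m.
  by elim: n => [|n IH]; first (by rewrite leqn0 => /eqP->); rewrite leq_eqVlt => /orP[/eqP->//|/IH h];
     apply: le_trans h; have [] := nested n.
have lo_up m n : lo m <= up n.
  have lu k : lo k <= up k.
    have h3 : 0 < 1 / p k ^+ 2 by rewrite divr_gt0// exprn_gt0.
    rewrite /lo /up; lra.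
  have [mn|/ltnW nm] := leqP m n.
    exact: le_trans (lo_mono _ _ mn) (lu n).
  exact: le_trans (lu m) (up_mono _ _ nm).
pose E := range lo.
have supE : has_sup E.
  by split; [exists (lo 0%N), 0%N|exists (up 0%N) => _ [n _ <-]; exact: lo_up].
set xi := sup E.
have xi_lo n : lo n <= xi by apply: sup_upper_bound => //; exists n.
have xi_up n : xi <= up n by apply: ge_sup; [by exists (lo 0%N), 0%N|move=> _ [m _ <-]; exact: lo_up].
exists xi; split.
  have p0 : p 0%N = 1 by [].
  have r0 : r 0%N = 0 by [].
  have := xi_lo 0%N; have := xi_up 0%N; rewrite /lo /up /f p0 r0 expr1n mul0r => h1 h2.
  rewrite ler_norml; apply/andP; split; move: h1 h2; lra.
move=> n; rewrite -/(p n) -/(r n); have pn := p_gt0 n.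
have -> : p n * xi - r n = p n * (xi - f n) by rewrite /f; field; rewrite gt_eqF.
rewrite normrM (gtr0_norm pn).
have -> : 1 / p n = p n * (1 / p n ^+ 2) by field; rewrite gt_eqF.
rewrite ler_pM2l// ler_norml.
have := xi_lo n; have := xi_up n; rewrite /lo /up => h1 h2; apply/andP; split; move: h1 h2; lra.
Qed.

End CFWords.

(** * Integer points attached to palindromic prefixes *)

Section PalindromePoints.
Variables (A : finType) (w : nat -> A).
Local Notation Ph := (Phi (@cfF A)).
Local Notation pal := (pal_prefix w).

Definition cfpt n := Pt (m00 (cfP w n)) (m10 (cfP w n)) (m11 (cfP w n)).

Lemma cfP_tr n : pal n -> tr2 (cfP w n) = cfP w n.
Proof. by move=> /eqP e; rewrite /cfP {2}e (Phi_rev (@cfF_sym A)). Qed.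

Lemma cfP_sym n : pal n -> m01 (cfP w n) = m10 (cfP w n).
Proof. by move/cfP_tr/sym2P. Qed.

Lemma mx_cfpt n : pal n -> mx_of (cfpt n) = cfP w n.
Proof. by move/cfP_sym; rewrite /mx_of /cfpt /=; case: (cfP w n) => a b c d /= ->. Qed.

Lemma cfpt_disc n : pal n -> disc (cfpt n) = 1 \/ disc (cfpt n) = -1.
Proof. by move=> pn; rewrite -det2_mx_of mx_cfpt//; exact: cf_det. Qed.

Lemma cfpt_disc_neq0 n : pal n -> disc (cfpt n) != 0.
Proof. by case/cfpt_disc => ->. Qed.

Lemma cfpt_primitive n : pal n -> primitive (cfpt n).
Proof.
case/cfpt_disc; rewrite /disc => h.
  by exists (c2 (cfpt n)), (- c1 (cfpt n)), 0; rewrite -h; ring.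
exists (- c2 (cfpt n)), (c1 (cfpt n)), 0; apply: (@oppr_inj _ _ 1); rewrite -h; ring.
Qed.

Lemma cfpt_gt0 n : 0 < c0 (cfpt n). Proof. exact: cfP_gt0. Qed.

Lemma cfpt_lt m n : (m < n)%N -> c0 (cfpt m) < c0 (cfpt n).
Proof.
elim: n => // n IH; rewrite ltnS leq_eqVlt => h.
have hd : m00 (cfP w n) < m00 (cfP w n.+1).
  by have := cfP_double w n; have := cfP_gt0 w n; lia.
by move: h => /orP[/eqP ->|/IH h]; [exact: hd|exact: lt_trans h hd].
Qed.

Lemma cfpt_ncol m n : pal m -> pal n -> (m < n)%N -> ~ collinear (cfpt m) (cfpt n).
Proof.
move=> pm pn mn cl; have := cfpt_lt mn.
by rewrite (primitive_collinear (cfpt_primitive pm) (cfpt_primitive pn) (cfpt_gt0 _) (cfpt_gt0 _) cl) ltxx.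
Qed.

Lemma mkseqD a k : mkseq w (a + k) = mkseq w a ++ map w (iota a k).
Proof. by rewrite /mkseq iotaD map_cat. Qed.

Lemma pal_mkseq a b : pal a -> pal b -> (a <= b)%N ->
  mkseq w b = mkseq w (b - a) ++ mkseq w a.
Proof.
move=> pa pb ab; rewrite -{1}(subnK ab) mkseqD; congr cat.
rewrite -[X in iota X _]addn0 iotaDl -map_comp; apply/eq_in_map => i.
by rewrite mem_iota /= => hi; rewrite addnC (pal_period pa pb ab).
Qed.

(* With [S], [SV], [SVU] the matrices of the three prefixes, coplanarity says that
   [SU] is symmetric; hence [SUV = SVU] and both identities descend to words. *)
Lemma pal_coplanar a b c : pal a -> pal b -> pal c -> (a <= b)%N -> (b <= c)%N ->
  det3 (cfpt a) (cfpt b) (cfpt c) = 0 -> pal (a + (c - b)).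
Proof.
move=> pa pb pc ab bc /trip_mx_sym.
rewrite /trip_mx !mx_cfpt//.
have [v vE] : exists v, v = map w (iota a (b - a)) by eexists.
have [u uE] : exists u, u = map w (iota b (c - b)) by eexists.
have eb : mkseq w b = mkseq w a ++ v by rewrite vE -mkseqD subnKC.
have ec : mkseq w c = mkseq w b ++ u by rewrite uE -mkseqD subnKC.
have := cfP_tr pa; have := cfP_tr pb; have := cfP_tr pc.
rewrite /cfP ec eb !Phi_cat; set S := Ph (mkseq w a); set V := Ph v; set U := Ph u.
move=> hc hb ha hs.
have hU : tr2 (mul2 S U) = mul2 S U.
  apply/sym2P; move: hs; apply: proj_eq_sym2.
  rewrite -mul2A (mul2A (adj2 _)) mul_adj2 scal2_mull mul12 scal2_mulr.
  apply: proj_eq_scal; rewrite det2_mul mulf_neq0//.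
    by case: (cf_det (mkseq w a)) => ->.
  by case: (cf_det v) => ->.
have VU : Ph (mkseq w a ++ v ++ u) = Ph (mkseq w a ++ u ++ v).
  rewrite !Phi_cat -/S -/U -/V !mul2A -hc tr2_mul hb mul2A.
  by congr mul2; rewrite -hU tr2_mul ha.
have vu : v ++ u = u ++ v.
  have /cf_inj := VU; rewrite !size_cat (addnC (size v)) => /(_ erefl) /eqP.
  by rewrite eqseq_cat// => /andP[_ /eqP].
have eau : mkseq w (a + (c - b)) = mkseq w a ++ u.
  have su : size u = (c - b)%N by rewrite uE size_map size_iota.
  have -> : mkseq w (a + (c - b)) = take (a + (c - b)) (mkseq w c).
    have -> : mkseq w c = mkseq w (a + (c - b)) ++ map w (iota (a + (c - b)) (b - a)).
      by rewrite -mkseqD; congr mkseq; move: ab bc; lia.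
    by rewrite take_size_cat// size_mkseq.
  by rewrite ec eb -catA vu catA take_size_cat// size_cat size_mkseq su.
rewrite /pal_prefix eau; apply/eqP; apply: cf_inj; first by rewrite size_rev.
by rewrite (Phi_rev (@cfF_sym A)) Phi_cat hU.
Qed.

Variable R : realType.
Local Notation W n := (lnht R (cfpt n)).

Lemma ln2_gt0 : 0 < ln 2 :> R. Proof. by rewrite ln_gt0// ltr1n. Qed.

Lemma W_lower n : n%:R * ln 2 <= W n.
Proof.
rewrite mulr_natl -lnXn// /lnht /ht ler_ln ?posrE ?exprn_gt0//; last by rewrite ltr0z cfpt_gt0.
have := cf_m00_lower (mkseq w n); rewrite size_mkseq => h.
by rewrite -[2]/(2%:~R : R) -rmorphXn /= ler_int.
Qed.

Lemma W_upper n : W n <= n%:R * ln (#|A|.+2%:R).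
Proof.
rewrite mulr_natl -lnXn ?ltr0n// /lnht /ht ler_ln ?posrE ?exprn_gt0 ?ltr0n//; last by rewrite ltr0z cfpt_gt0.
have := cf_m00_upper (mkseq w n); rewrite size_mkseq => h.
by rewrite -[#|A|.+2%:R]/(#|A|.+2%:Z%:~R : R) -rmorphXn /= ler_int.
Qed.

Lemma W_sub a b : pal a -> pal b -> (a <= b)%N ->
  W (b - a)%N + W a <= W b <= W (b - a)%N + W a + ln 2.
Proof.
move=> pa pb ab; have /andP[] := cf_m00_cat (mkseq w (b - a)) (mkseq w a).
rewrite -pal_mkseq// -!/(cfP w _) -!/(c0 (cfpt _)) => h1 h2.
have g n : 0 < (c0 (cfpt n))%:~R :> R by rewrite ltr0z cfpt_gt0.
rewrite /lnht /ht -lnM ?posrE// -[X in _ && (_ <= X)]lnM ?posrE ?mulr_gt0// !ler_ln ?posrE ?mulr_gt0//.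
by rewrite -!intrM ler_int h1 /= -[2]/(2%:~R : R) -intrM ler_int mulrC.
Qed.

(** The prefixes of lengths [b] and [c] arise from those of lengths [a] and [b] by prepending the
    same word, of length [b - a], so the additive errors of [W_sub] partly cancel. *)
Lemma W_rec a b c : pal a -> pal b -> pal c -> (a <= b)%N -> (c + a = 2 * b)%N ->
  `|W c - 2 * W b + W a| <= ln 2.
Proof.
move=> pa pb pc ab e; have bc : (b <= c)%N by lia.
have := W_sub pb pc bc; have := W_sub pa pb ab.
have -> : (c - b = b - a)%N by lia.
move=> /andP[h1 h2] /andP[h3 h4]; rewrite ler_norml; apply/andP; split; move: h1 h2 h3 h4; lra.
Qed.

Variable xi : R.
Hypothesis xi2 : `|xi| <= 2.
Hypothesis xiP : forall n,
  `|(m00 (cfP w n))%:~R * xi - (m10 (cfP w n))%:~R| <= 1 / (m00 (cfP w n))%:~R.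

(** Symmetry identifies the numerator of a convergent with the denominator of the previous one, so
    the approximation of xi^2 follows from two successive convergents. In the constant, the
    cardinality term bounds the ratio of successive denominators and 2 bounds [xi]. *)
Lemma cfpt_qual n : pal n -> (0 < n)%N -> qual xi (ln (#|A|.+2%:R + 2)) (cfpt n).
Proof.
move=> pn; case: n pn => // n pn _; split; first exact: cfpt_gt0.
have P0 : 0 < (m00 (cfP w n.+1))%:~R :> R by rewrite ltr0z cfP_gt0.
have p0 : 0 < (m00 (cfP w n))%:~R :> R by rewrite ltr0z cfP_gt0.
have K0 : 0 < #|A|.+2%:R + 2 :> R by rewrite addr_gt0// ltr0n.
rewrite expRD lnK ?posrE// expRN expR_lnht; last exact: cfpt_gt0.
have [_ e1 _ e3] := cfPS w n.
have h1 := xiP n.+1; have h2 := xiP n.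
have hq : 1 / (m00 (cfP w n))%:~R <= #|A|.+2%:R / (m00 (cfP w n.+1))%:~R :> R.
  rewrite ler_pdivrMr// mulrAC ler_pdivlMr// mul1r -[#|A|.+2%:R]/(#|A|.+2%:Z%:~R : R) -intrM ler_int.
  exact: cfP_succ_le.
rewrite /Lp /approx_L ge_max -[c0 _]/(m00 (cfP w n.+1)) -[c1 _]/(m10 (cfP w n.+1)) -[c2 _]/(m11 (cfP w n.+1)); apply/andP; split.
  apply: le_trans h1 _; rewrite ler_pM2r ?invr_gt0//.
  by have : 0 <= #|A|.+2%:R :> R by []; lra.
rewrite e3; move: h1; rewrite -(cfP_sym pn) e1 => h1.
have -> : (m00 (cfP w n.+1))%:~R * xi ^+ 2 - (m10 (cfP w n))%:~R =
  xi * ((m00 (cfP w n.+1))%:~R * xi - (m00 (cfP w n))%:~R) +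
  ((m00 (cfP w n))%:~R * xi - (m10 (cfP w n))%:~R) by ring.
apply: le_trans (ler_normD _ _) _; rewrite normrM mulrDl addrC; apply: lerD.
  exact: le_trans h2 hq.
have -> : 2 / ht R (cfpt n.+1) = 2 * (1 / (m00 (cfP w n.+1))%:~R) by rewrite mul1r.
by rewrite ler_pM.
Qed.

End PalindromePoints.

(** * The exponent of the number of a word *)

Section FromWord.
Variables (R : realType) (A : finType) (w : nat -> A) (delta xi : R).
Hypothesis w_inf : inf_pal_prefixes w.
Hypothesis d1 : 1 < delta.
Hypothesis d2 : delta < 2.
Local Notation pal := (pal_prefix w).
Local Notation n_ := (nthsat pal).
Local Notation N_ i := ((n_ i)%:R : R).
Hypothesis n_up : forall r : R, delta < r -> ev (fun i => N_ i.+1 / N_ i <= r).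
Hypothesis n_low : forall r : R, r < delta -> ~ ev (fun i => N_ i.+1 / N_ i <= r).
Hypothesis xi2 : `|xi| <= 2.
Hypothesis xiP : forall n,
  `|(m00 (cfP w n))%:~R * xi - (m10 (cfP w n))%:~R| <= 1 / (m00 (cfP w n))%:~R.

Let X i := cfpt w (n_ i).
Local Notation V i := (lnht R (X i)).

Let n_pal i : pal (n_ i). Proof. exact: (nthsat_sat w_inf). Qed.
Let n_lt i : (n_ i < n_ i.+1)%N. Proof. exact: (nthsat_lt w_inf). Qed.
Let n_mono i j : (i < j)%N -> (n_ i < n_ j)%N. Proof. exact: (nthsat_mono w_inf). Qed.
Let n_gt i : (i < n_ i)%N. Proof. exact: (nthsat_gt w_inf). Qed.
Let n_gt0 i : (0 < n_ i)%N. Proof. exact: leq_ltn_trans (n_gt i). Qed.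
Let N_gt0 i : 0 < N_ i. Proof. by rewrite ltr0n. Qed.
Let X_pos i : 0 < c0 (X i). Proof. exact: cfpt_gt0. Qed.
Let X_inc i : c0 (X i) < c0 (X i.+1). Proof. exact: cfpt_lt. Qed.
Let X_prim i : primitive (X i). Proof. exact: cfpt_primitive. Qed.
Let X_disc i : disc (X i) != 0. Proof. exact: cfpt_disc_neq0. Qed.
Let X_ncol i j : (i < j)%N -> ~ collinear (X i) (X j).
Proof. by move=> ij; apply: cfpt_ncol => //; exact: n_mono. Qed.

Let V_gt0 i : 0 < V i.
Proof. by apply: lt_le_trans (W_lower w R _); rewrite mulr_gt0// ln2_gt0. Qed.

Let V_mono i j : (i <= j)%N -> V i <= V j.
Proof.
rewrite leq_eqVlt => /orP[/eqP ->//|ij]; rewrite lnht_le//; apply: ltW; apply: cfpt_lt; exact: n_mono.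
Qed.

Let V_big M : ev (fun i => M <= V i).
Proof.
have l2 := ln2_gt0 R.
have [k hk] := archi_nat (M / ln 2); exists k => i ki.
apply: le_trans (W_lower w R _); rewrite -ler_pdivrMr//.
apply: le_trans (ltW hk) _; rewrite ler_nat; exact: leq_trans ki (ltnW (n_gt i)).
Qed.

Let X_good e : 0 < e -> ev (fun i => good xi e (X i)).
Proof.
move=> e0; have [m mE] : exists m : R, m = ln (#|A|.+2%:R + 2) by eexists.
have := V_big (m / e); apply: ev_imp => i h.
apply: (@qual_good _ _ _ m); first by rewrite mE; exact: cfpt_qual.
exact: le_of_large.
Qed.

(** [pal_coplanar] gives a palindromic prefix of length strictly between [n_ i] and [n_ i.+2], which
    can only be [n_ i.+1]. *)
Let stretch i : det3 (X i) (X i.+1) (X i.+2) = 0 -> (n_ i.+2 + n_ i = 2 * n_ i.+1)%N.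
Proof.
move=> h; have l1 := n_lt i; have l2 := n_lt i.+1.
have pm := pal_coplanar (n_pal i) (n_pal i.+1) (n_pal i.+2) (ltnW l1) (ltnW l2) h.
have g1 := nthsat_min w_inf (i := i) (m := (n_ i + (n_ i.+2 - n_ i.+1))%N) ltac:(lia) pm.
have [g2|//] : (n_ i.+1 < n_ i + (n_ i.+2 - n_ i.+1))%N \/ (n_ i.+2 + n_ i = 2 * n_ i.+1)%N by lia.
have := nthsat_min w_inf (i := i.+1) g2 pm; lia.
Qed.

(** In a fixed plane [stretch] turns the lengths into an arithmetic progression, whose ratios tend
    to 1 < delta. *)
Let nonplanar k : exists i, (k < i)%N && (det3 (X k) (X k.+1) (X i) != 0).
Proof.
apply: contrapT => nex.
have pl i : (k <= i)%N -> det3 (X k) (X k.+1) (X i) = 0.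
  rewrite leq_eqVlt => /orP[/eqP <-|ki]; first exact: det3aba.
  by apply/eqP; apply: contrapT => /negP h; apply: nex; exists i; rewrite ki.
have dif t : (n_ (k + t).+1 = n_ (k + t) + (n_ k.+1 - n_ k))%N.
  elim: t => [|t IH]; first by rewrite addn0; have := n_lt k; lia.
  rewrite addnS; have := n_lt (k + t).
  have := stretch (i := (k + t)%N) (coplanar3 (X_ncol (ltnSn k)) (pl (k + t)%N ltac:(lia))
    (pl (k + t).+1 ltac:(lia)) (pl (k + t).+2 ltac:(lia))).
  by move: IH; lia.
have [r rE] : exists r : R, r = (1 + delta) / 2 by eexists.
have hd1 := d1.
have r1 : 0 < r - 1 by lra.
apply: (@n_low r); first by lra.
have [d dE] : exists d : nat, d = (n_ k.+1 - n_ k)%N by eexists.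
have [M hM] := archi_nat (d%:R / (r - 1)).
exists (k + M)%N => i hi.
have := dif (i - k)%N; rewrite subnKC; last by lia.
rewrite -dE => ->; rewrite natrD ler_pdivrMr//.
have : d%:R <= (r - 1) * N_ i.
  apply: le_of_large => //; apply: le_trans (ltW hM) _; rewrite ler_nat.
  by have := n_gt i; lia.
lra.
Qed.

(** A relation between 1, xi, xi^2 vanishes, being a small integer, on all far points of the
    sequence; three of them are not coplanar, and Cramer's rule kills the coefficients. *)
Let xi_indep : indep xi.
Proof.
move=> a b c h.
have [B BE] : exists B : R, B = `|b%:~R| + `|c%:~R| + 1 by eexists.
have B1 : 1 <= B.
  by rewrite BE; have := normr_ge0 (b%:~R : R); have := normr_ge0 (c%:~R : R); lra.
have B0 : 0 < B by lra.
have ev0 : ev (fun i => a * c0 (X i) + b * c1 (X i) + c * c2 (X i) = 0).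
  have e0 : 0 < 1 / 2 :> R by lra.
  have := ev_and (X_good e0) (V_big (2 * (ln B + 1))).
  apply: ev_imp => i [[_ gi] vi]; apply: (@intr_lt1 R).
  have Li : B * Lp xi (X i) < 1.
    have : B * Lp xi (X i) <= B * expR (- (ln B + 1)).
      rewrite ler_pM2l//; apply: le_trans gi _; rewrite ler_expR; lra.
    have -> : B * expR (- (ln B + 1)) = expR (- 1).
      by rewrite opprD expRD expRN lnK ?posrE// mulrA divff ?mul1r// gt_eqF.
    by have := expRN1_lt_half R; lra.
  move: Li; rewrite /Lp /approx_L; set p := Num.max _ _ => Li.
  have p1 : `|(c0 (X i))%:~R * xi - (c1 (X i))%:~R| <= p by rewrite le_max lexx.
  have p2 : `|(c0 (X i))%:~R * xi ^+ 2 - (c2 (X i))%:~R| <= p by rewrite le_max lexx orbT.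
  have p0 : 0 <= p by exact: le_trans (normr_ge0 _) p1.
  have -> : (a * c0 (X i) + b * c1 (X i) + c * c2 (X i))%:~R =
    - (b%:~R * ((c0 (X i))%:~R * xi - (c1 (X i))%:~R) +
       c%:~R * ((c0 (X i))%:~R * xi ^+ 2 - (c2 (X i))%:~R)) :> R.
    rewrite !intrD !intrM.
    transitivity ((c0 (X i))%:~R * (a%:~R + b%:~R * xi + c%:~R * xi ^+ 2) - (b%:~R * ((c0 (X i))%:~R * xi - (c1 (X i))%:~R) +
       c%:~R * ((c0 (X i))%:~R * xi ^+ 2 - (c2 (X i))%:~R))); first by ring.
    by rewrite h mulr0 add0r.
  rewrite normrN; apply: le_lt_trans Li.
  apply: le_trans (ler_normD _ _) _; rewrite !normrM BE !mulrDl mul1r.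
  have q1 : `|b%:~R : R| * `|(c0 (X i))%:~R * xi - (c1 (X i))%:~R| <= `|b%:~R| * p by rewrite ler_wpM2l.
  have q2 : `|c%:~R : R| * `|(c0 (X i))%:~R * xi ^+ 2 - (c2 (X i))%:~R| <= `|c%:~R| * p by rewrite ler_wpM2l.
  by move: q1 q2 p0; lra.
have [N hN] := ev0.
have [i /andP[Ni dn]] := nonplanar N.
have e1 := hN N (leqnn N); have e2 := hN N.+1 (leqnSn N); have e3 := hN i (ltnW Ni).
have kill t : t * det3 (X N) (X N.+1) (X i) = 0 -> t = 0.
  by move/eqP; rewrite mulf_eq0 (negbTE dn) orbF => /eqP.
move: (X N) (X N.+1) (X i) e1 e2 e3 kill => p q s e1 e2 e3 kill.
split; apply: kill.
- transitivity ((a * c0 p + b * c1 p + c * c2 p) * (c1 q * c2 s - c2 q * c1 s)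
   - (a * c0 q + b * c1 q + c * c2 q) * (c1 p * c2 s - c2 p * c1 s)
   + (a * c0 s + b * c1 s + c * c2 s) * (c1 p * c2 q - c2 p * c1 q)); first by rewrite /det3; ring.
  by rewrite e1 e2 e3; ring.
- transitivity ((a * c0 p + b * c1 p + c * c2 p) * (c2 q * c0 s - c0 q * c2 s)
   - (a * c0 q + b * c1 q + c * c2 q) * (c2 p * c0 s - c0 p * c2 s)
   + (a * c0 s + b * c1 s + c * c2 s) * (c2 p * c0 q - c0 p * c2 q)); first by rewrite /det3; ring.
  by rewrite e1 e2 e3; ring.
transitivity ((a * c0 p + b * c1 p + c * c2 p) * (c0 q * c1 s - c1 q * c0 s)
   - (a * c0 q + b * c1 q + c * c2 q) * (c0 p * c1 s - c1 p * c0 s)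
   + (a * c0 s + b * c1 s + c * c2 s) * (c0 p * c1 q - c1 p * c0 q)); first by rewrite /det3; ring.
by rewrite e1 e2 e3; ring.
Qed.

Let lq := ln (#|A|.+2%:R : R).

Let reflect_ex : exists psi : nat -> nat, exists c : R, [/\ 0 < c, c <= 1 &
  ev (fun i => [/\ (psi i < i)%N, (n_ i.+1 + n_ (psi i) = 2 * n_ i)%N, c * V i <= V (psi i) &
     `|V i.+1 - 2 * V i + V (psi i)| <= ln 2])].
Proof.
have hd1 := d1; have hd2 := d2; have l2 := ln2_gt0 R.
have [r rE] : exists r : R, r = (delta + 2) / 2 by eexists.
have r2 : 0 < 2 - r by lra.
have [N hN] := n_up (r := r) ltac:(lra).
have hN' i : (N <= i)%N -> N_ i.+1 <= r * N_ i by move=> /hN; rewrite ler_pdivrMr.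
have H i : exists l, (N <= i)%N -> (n_ i.+1 + n_ l = 2 * n_ i)%N.
  have [Ni|] := leqP N i; last by exists 0%N.
  have lt2 : (n_ i.+1 < 2 * n_ i)%N.
    rewrite -(ltr_nat R) natrM; apply: le_lt_trans (hN' i Ni) _.
    by rewrite ltr_pM2r//; lra.
  have pp := pal_reflect (n_pal i) (n_pal i.+1) (ltnW (n_lt i)) (ltnW lt2).
  have [l hl] := nthsat_ex w_inf (m := (2 * n_ i - n_ i.+1)%N) ltac:(lia) pp.
  by exists l => _; rewrite hl; lia.
have [psi hpsi] := choice H.
have lq0 : 0 < lq by rewrite ln_gt0// ltr1n.
have llq : ln 2 <= lq by rewrite /lq ler_ln ?posrE ?ltr0n// ler_nat.
(* [2 - r] bounds the quotient of the lengths at [psi i] and [i] from below; [ln 2 / lq] is the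
   price of passing to heights by the bounds [W_lower] and [W_upper]. *)
exists psi, ((2 - r) * (ln 2 / lq)); split.
- by rewrite mulr_gt0// divr_gt0.
- have : (2 - r) * (ln 2 / lq) <= 1 * 1.
    by apply: ler_pM; rewrite ?divr_ge0 ?(ltW r2) ?(ltW l2) ?(ltW lq0) ?ler_pdivrMr ?mul1r//; lra.
  by rewrite mulr1.
exists N => i Ni; have e := hpsi i Ni.
have pl : (psi i < i)%N.
  rewrite ltnNge; apply/negP; rewrite leq_eqVlt => /orP[/eqP h|/n_mono h].
    by move: e; rewrite -h; have := n_lt i; lia.
  by have := n_lt i; lia.
split=> //.
  have h1 := W_upper w R (n_ i); have h2 := W_lower w R (n_ (psi i)).
  apply: le_trans h2; rewrite -mulrA.
  have h3 : (2 - r) * N_ i <= N_ (psi i).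
    have := congr1 (fun k : nat => k%:R : R) e; rewrite /= natrD natrM.
    by have := hN' i Ni; lra.
  apply: (@le_trans _ _ ((2 - r) * (N_ i * ln 2))); last by rewrite mulrA ler_pM2r.
  rewrite ler_pM2l// mulrAC ler_pdivrMr// [leRHS]mulrAC [leRHS]mulrC ler_pM2l//.
by apply: W_rec => //; apply: ltnW; exact: n_mono.
Qed.

Section Given.
Variables (psi : nat -> nat) (c b eta eps0 : R) (M : nat).
Hypothesis c_gt0 : 0 < c.
Hypothesis c_le1 : c <= 1.
Hypothesis psiP : forall i, (M <= i)%N ->
  [/\ (psi i < i)%N, (n_ i.+1 + n_ (psi i) = 2 * n_ i)%N, c * V i <= V (psi i) &
     `|V i.+1 - 2 * V i + V (psi i)| <= ln 2].

(** The recursion gives V_(i+1) at most (2 - c) V_i + ln 2, and half of [c] is spent on the additive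
    term. [eps0] is calibrated for [X_complete], where the total loss must stay below the margin 2 -
    b (b - 1). *)
Hypothesis bE : b = 2 - c / 2.
Hypothesis etaE : eta = (2 - b) / 2.
Hypothesis epsE : eps0 = eta ^+ 2 / 8.

Let b1 : 1 < b. Proof. by rewrite bE; have := c_le1; lra. Qed.
Let b2 : b < 2. Proof. by rewrite bE; have := c_gt0; lra. Qed.

Let V_ratio : ev (fun i => V i.+1 <= b * V i).
Proof.
have c2 : 0 < c / 2 by have := c_gt0; lra.
have := ev_and (V_big (ln 2 / (c / 2))) (ev_ge M); apply: ev_imp => i [/(le_of_large c2) h1 /psiP[_ _ h2]].
by rewrite ler_norml bE => /andP[h3 h4]; move: h1 h2 h4; lra.
Qed.

Let X_runlist e : 0 < e -> exists N0, runlist xi X e b N0.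
Proof.
move=> e0; have [N h] := ev_and (X_good e0) V_ratio; exists N; split=> //.
- by move=> i /h[].
- by move=> i /h[].
Qed.

Let eta_gt0 : 0 < eta. Proof. by rewrite etaE; have := b2; lra. Qed.
Let eta_le : eta <= 1 / 2. Proof. by rewrite etaE; have := b1; lra. Qed.
Let eps0_gt0 : 0 < eps0. Proof. by rewrite epsE divr_gt0// exprn_gt0. Qed.
Let eps0_le : 16 * eps0 <= eta.
Proof.
have : eta * eta <= 1 / 2 * eta by rewrite ler_pM2r.
by rewrite epsE expr2; lra.
Qed.
Let eps0_le' : 16 * eps0 <= 2 - b. Proof. by have := eps0_le; have := b2; rewrite etaE; lra. Qed.

Let V_grow : ev (fun i => eta * V i.+1 <= V i.+1 - V i).
Proof.
have [N0 rl] := X_runlist eps0_gt0.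
by have [N _ h] := growth1 rl b1 b2 (ltW eps0_gt0) eps0_le'; exists N => i /h; rewrite etaE.
Qed.

(** Makes the error k ln 2 accumulated along a run negligible against V_k. *)
Let V_superlinear (T : R) : 0 < T -> ev (fun i => i%:R * T <= V i).
Proof.
move=> T0; have [N h] := ev_and V_grow (V_big (2 * T / eta)).
have acc t : t%:R * (2 * T) <= V (N + t)%N.
  elim: t => [|t IH]; first by rewrite mul0r ltW.
  rewrite addnS -[t.+1%:R]natr1.
  have [h1 _] := h (N + t)%N (leq_addr _ _).
  have [_ h2] := h (N + t).+1 ltac:(nlia).
  have h3 := le_of_large eta_gt0 h2.
  by move: IH h1 h3; lra.
exists (N + N)%N => i hi; have := acc (i - N)%N; rewrite subnKC; last by nlia.
apply: le_trans; rewrite mulrA ler_pM2r// mulr_natr -mulrnA ler_nat; nlia.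
Qed.

(** Inside a run [stretch] makes the lengths arithmetic, so by [W_rec] each increment of [V] exceeds
    the preceding one by at most ln 2. *)
Let run_diff j k : (j < k)%N ->
  (forall i, (j < i)%N -> (i <= k.+1)%N -> det3 (X j.+1) (X j.+2) (X i) = 0) ->
  V k.+1 - V k <= V j.+2 - V j.+1 + k%:R * ln 2.
Proof.
move=> jk pl; have l2 := ln2_gt0 R.
have acc t : (j.+1 + t <= k)%N ->
   V (j.+1 + t).+1 - V (j.+1 + t)%N <= V j.+2 - V j.+1 + t%:R * ln 2.
  elim: t => [|t IH] ht; first by rewrite addn0 mul0r addr0.
  have IH' := IH ltac:(nlia).
  rewrite addnS -[t.+1%:R]natr1; set i := (j.+1 + t)%N in ht IH' *.
  have e := stretch (i := i) (coplanar3 (X_ncol (ltnSn j.+1)) (pl i ltac:(nlia) ltac:(nlia))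
     (pl i.+1 ltac:(nlia) ltac:(nlia)) (pl i.+2 ltac:(nlia) ltac:(nlia))).
  have := W_rec R (n_pal i) (n_pal i.+1) (n_pal i.+2) (ltnW (n_lt i)) e.
  rewrite ler_norml => /andP[_ h]; rewrite mulrDl mul1r; move: IH' h; rewrite /X; lra.
have := acc (k - j.+1)%N; rewrite subnKC// => /(_ (leqnn k)) h; apply: le_trans h _.
by rewrite lerD2l ler_pM2r// ler_nat leq_subr.
Qed.

(** A foreign point between [X k] and [X k.+1] lies in the plane of their run, and [double_gap]
    against [X j] makes 2 V_j at most V_(k+1) - V_k up to small errors. By [run_diff] and
    [run_bounds] this gap is at most b (b - 1) V_j, up to small errors, a contradiction. *)
Let X_complete : exists V0, forall z, primitive z -> good xi eps0 z -> V0 <= lnht R z ->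
  exists i, z = X i.
Proof.
have hb1 := b1; have hb2 := b2; have he0 := eta_gt0; have he1 := eta_le.
have p0 := eps0_gt0; have p1 := eps0_le; have hl := lcst_ge0 xi; have l2 := ln2_gt0 R.
have hetaE := etaE.
have [N0 rl] := X_runlist p0.
have [N1 N01 rb] := run_bounds rl b1 b2 (ltW p0) eps0_le'.
have [N2 rs] := run_start rl N1.
have T0 : 0 < 2 * ln 2 / eta ^+ 2 by rewrite divr_gt0 ?mulr_gt0 ?exprn_gt0.
have e20 : 0 < eta ^+ 2 by rewrite exprn_gt0.
have [N3 hN3] := ev_and (V_superlinear T0) (ev_and (V_big (4 * lcst xi / eta ^+ 2 + (lcst xi + 1) / eta + 1)) (ev_and V_ratio (V_big 4))).
have [K KE] : exists K, K = maxn N0 (maxn N2 N3) by eexists.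
exists (V K) => z zp zg zV.
have z0 : 0 < c0 z by case: zg.
have [k [Kk zk1 zk2]] := bracket rl z0 zV.
have [[sk [bk [rk fk]]] [k0 k2]] : (k%:R * (2 * ln 2 / eta ^+ 2) <= V k /\
   (4 * lcst xi / eta ^+ 2 + (lcst xi + 1) / eta + 1 <= V k /\ (V k.+1 <= b * V k /\ 4 <= V k))) /\
   ((N0 <= k)%N /\ (N2 <= k)%N).
  split; first by apply: hN3; move: Kk; rewrite KE; nlia.
  by move: Kk; rewrite KE; nlia.
have g i : (N0 <= i)%N -> good xi eps0 (X i) by apply: (rl_good rl).
have lo : V k <= lnht R z by rewrite lnht_le.
have hi : lnht R z <= V k.+1 by rewrite lnht_le// ltW.
have e4 : eps0 <= 1 / 4 by move: p1 he1; lra.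
have [zk|zk] := eqVneq (c0 (X k)) (c0 z).
  exists k; symmetry; apply: (same_height zk).
    by apply: (good_Lp_small e4 (g k k0)).
  by apply: (good_Lp_small e4 zg); exact: le_trans lo.
exfalso.
have nk : ~ collinear (X k) z.
  by move=> cl; move: zk; rewrite (primitive_collinear (X_prim k) zp (X_pos k) z0 cl) eqxx.
have nk1 : ~ collinear z (X k.+1).
  by move=> cl; move: zk2; rewrite (primitive_collinear zp (X_prim k.+1) z0 (X_pos k.+1) cl) ltxx.
have [m mE] : exists m, m = eps0 * V k.+1 by eexists.
have Q y : good xi eps0 y -> lnht R y <= V k.+1 -> qual xi m y.
  by move=> gy hy; apply: good_qual gy _; rewrite mE ler_pM2l.
have QX i : (N0 <= i)%N -> (i <= k.+1)%N -> qual xi m (X i).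
  by move=> h1 h2; apply: Q (g i h1) (V_mono h2).
have Qz := Q z zg hi.
have lce : lcst xi + 1 <= eta * V k.
  apply: le_of_large he0 _; apply: le_trans bk.
  have : 0 <= 4 * lcst xi / eta ^+ 2 by rewrite divr_ge0 ?(ltW e20)// mulr_ge0.
  lra.
have lce2 : 4 * lcst xi <= eta ^+ 2 * V k.
  apply: le_of_large e20 _; apply: le_trans bk.
  have : 0 <= (lcst xi + 1) / eta by rewrite divr_ge0 ?(ltW he0)//; lra.
  lra.
have Vk0 := V_gt0 k.
have bV : b * V k <= 2 * V k by rewrite ler_pM2r// ltW.
have d0 : det3 (X k) z (X k.+1) = 0.
  apply/eqP; apply: contrapT => /negP dn.
  have := plane (QX k k0 (leqnSn k)) Qz (QX k.+1 (leqW k0) (leqnn _)) lo hi dn.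
  have m2 : 16 * m <= eta * (2 * V k).
    rewrite mE mulrA; apply: (@le_trans _ _ (eta * V k.+1)); first by rewrite ler_pM2r.
    by rewrite ler_pM2l//; move: rk bV; lra.
  have : 2 * eta * V k = 2 * V k - b * V k by rewrite etaE; field.
  by move: lo rk lce m2; lra.
have [j [Nj jk pl pn]] := rs k k2.
have j0 : (N0 <= j)%N by nlia.
have [_ _ B3 B4] := rb j k Nj jk pl.
have na := X_ncol (ltnSn j.+1).
have nkk := X_ncol (ltnSn k).
have pj1 : det3 (X k) (X k.+1) (X j.+1) = 0 by apply: (coplanar3 na); apply: pl; nlia.
have pj2 : det3 (X k) (X k.+1) (X j.+2) = 0 by apply: (coplanar3 na); apply: pl; nlia.
have pz : det3 (X k) (X k.+1) z = 0 by rewrite det3_swap23 d0 oppr0.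
have pz' := coplanar3 nkk pj1 pj2 pz.
have dg := double_gap na pn (pl k.+1 ltac:(nlia) ltac:(nlia)) (pl k ltac:(nlia) ltac:(nlia)) pz'
  (pl k.+1 ltac:(nlia) ltac:(nlia)) nk nk1 (QX k k0 (leqnSn k)) Qz (QX k.+1 (leqW k0) (leqnn _))
  (QX k.+1 (leqW k0) (leqnn _)) (QX j j0 ltac:(nlia)) lo hi (V_mono (i := j) (j := k.+1) ltac:(nlia)).
have rd := run_diff jk pl.
rewrite -etaE in B4.
have sk' : k%:R * (2 * ln 2) <= eta ^+ 2 * V k.
  by move: sk; rewrite [2 * ln 2 / _]mulrC mulrCA -ler_pdivlMl ?invr_gt0// invrK.
have Vkk : eta ^+ 2 * V k <= eta ^+ 2 * V k.+1 by rewrite ler_pM2l// V_mono.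
have mE' : 8 * m = eta ^+ 2 * V k.+1 by rewrite mE epsE; field.
have B5 : eta * (eta * V k.+1) <= eta * (2 * V j) by rewrite ler_pM2l.
have B6 : 2 * eta * V j <= (2 - b) * V j by rewrite etaE ler_pM2r//; lra.
have B7 : 2 * ((2 - b) * V j) <= (2 - b * (b - 1)) * V j.
  have -> : 2 - b * (b - 1) = (2 - b) * (1 + b) by ring.
  by rewrite mulrA ler_pM2r// mulrC ler_pM2l ?subr_gt0//; lra.
have e2V : 0 < eta ^+ 2 * V k.+1 by rewrite mulr_gt0.
move: B5; rewrite mulrA -expr2.
by move: dg rd B3 B6 B7 sk' Vkk mE' e2V lce2; lra.
Qed.

Let memory : exists C, ev (fun i => (i <= psi i + C)%N).
Proof.
have hc := c_gt0; have he := eta_gt0.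
have [N hN] := V_grow.
have [C hC] := archi_nat ((c * eta)^-1); exists (N + C)%N.
exists (M + (N + C))%N => i hi; have [pl e pr _] := psiP (i := i) ltac:(nlia).
(* Growth is known only from [N] on; a smaller [psi i] is excluded because [c * V i] would exceed
   [V N]. *)
have [Np|Np] := leqP N (psi i); last first.
  have acc n : V N + n%:R * (eta * V N) <= V (N + n)%N.
    elim: n => [|n IH]; first by rewrite mul0r addr0 addn0.
    rewrite addnS -[n.+1%:R]natr1; have g := hN (N + n)%N (leq_addr _ _).
    have : eta * V N <= eta * V (N + n).+1 by rewrite ler_pM2l// V_mono//; nlia.
    by move: IH g; lra.
  have VN : V (psi i) <= V N by rewrite V_mono// ltnW.
  have VN0 := V_gt0 N.
  exfalso; have := acc C; have : V (N + C)%N <= V i by apply: V_mono; nlia.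
  have : c * V (N + C)%N <= c * V i by rewrite ler_pM2l// V_mono//; nlia.
  move=> h1 h2 h3.
  have h4 : c * (V N + C%:R * (eta * V N)) <= c * V (N + C)%N by rewrite ler_pM2l.
  have h5 : 1 * V N < C%:R * (c * eta) * V N.
    by rewrite ltr_pM2r// -ltr_pdivrMr ?mulr_gt0// mul1r.
  have h6 : 0 < c * V N by rewrite mulr_gt0.
  by move: h1 h4 h5 h6 pr VN; lra.
have acc n : V (psi i) + n%:R * (eta * V (psi i)) <= V (psi i + n)%N.
  elim: n => [|n IH]; first by rewrite mul0r addr0 addn0.
  rewrite addnS -[n.+1%:R]natr1; have g := hN (psi i + n)%N ltac:(nlia).
  have : eta * V (psi i) <= eta * V (psi i + n).+1 by rewrite ler_pM2l// V_mono//; nlia.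
  by move: IH g; lra.
rewrite leqNgt; apply/negP => lt.
have Vp := V_gt0 (psi i).
have h1 := acc C; have h2 : V (psi i + C)%N <= V i by apply: V_mono; nlia.
have h4 : c * (V (psi i) + C%:R * (eta * V (psi i))) <= c * V i by rewrite ler_pM2l//; lra.
have h5 : 1 * V (psi i) < C%:R * (c * eta) * V (psi i).
  by rewrite ltr_pM2r// -ltr_pdivrMr ?mulr_gt0// mul1r.
have h6 : 0 < c * V (psi i) by rewrite mulr_gt0.
by move: h4 h5 h6 pr; lra.
Qed.

Let ratio_diff e : 0 < e -> ev (fun i => `|N_ i.+1 / N_ i - V i.+1 / V i| <= e).
Proof.
move=> e0; have [C hC] := memory.
have hb2 := b2.
have [N hN] := ev_and (ev_and hC (ev_ge M)) (ev_and V_grow V_ratio).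
apply: (@ratio_asymp R (fun i => N_ i) (fun i => V i) psi N C.+2 eta) => //.
- by move=> i; rewrite ltr_nat.
- by move=> i /hN[[_ /psiP[]]].
- by move=> i /hN[[h _] _]; nlia.
- move=> i /hN[[_ /psiP[_ h _ _]] _]; have := congr1 (fun k : nat => k%:R : R) h.
  by rewrite /= natrD natrM; lra.
- move=> i /hN[_ [_ h]]; apply: le_trans h _; rewrite ler_pM2r//; lra.
- move=> i /hN[_ [h _]]; apply: le_trans h; rewrite ler_pM2l// V_mono//.
move=> e' e'0; have := ev_and (V_big (ln 2 / e')) (ev_ge M); apply: ev_imp => i [h1 /psiP[_ _ _ h2]].
by apply: le_trans h2 _; exact: le_of_large.
Qed.

(** For the lower bound the single level [eps0] suffices: the list [X] is complete there, so an
    exponent [b' < delta] would, through [list_ratio], keep the ratios of heights, hence those of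
    lengths, away from delta. *)
Lemma beta0_word_given : beta0 xi = delta%:E.
Proof.
have hd1 := d1; have hd2 := d2.
apply/eqP; rewrite eq_le; apply/andP; split.
  apply/lee_addgt0Pr => e e0; rewrite -EFinD; apply: beta0_le => eps /andP[eps1 _].
  have e4 : 0 < e / 4 by lra.
  apply: (@list_beta_set _ _ X (delta + e / 2)) => //; try lra.
  have := ev_and (ratio_diff e4) (n_up (r := delta + e / 4) ltac:(lra)); apply: ev_imp => i [].
  rewrite ler_norml => /andP[h1 h2] h3; rewrite -ler_pdivrMr//; move: h1 h2 h3; lra.
have e1 : eps0 < 1 by have := eps0_le; have := eta_le; lra.
apply: (@le_trans _ _ (beta_eps xi eps0)); last first.
  by apply: ereal_sup_ubound; exists eps0 => //=; rewrite eps0_gt0.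
apply: le_ereal_inf_tmp => _ [b' hb' <-]; rewrite lee_fin leNgt; apply/negP => lt.
have b'0 : 0 < b' by case: hb'.
have cv := beta_set_cov e1 hb'.
have [V0 comp] := X_complete.
have [cc hcc] := list_ratio xi_indep b'0 cv X_pos X_inc comp (N := 0%N) (fun i _ => X_disc i).
have [g gE] : exists g : R, g = (delta - b') / 4 by eexists.
have g0 : 0 < g by lra.
apply: (@n_low (b' + 2 * g)); first by lra.
have := ev_and (ev_and hcc (V_big (cc / g))) (ratio_diff g0); apply: ev_imp => i [[h1 h2] h3].
have h4 := le_of_large g0 h2.
have h5 : V i.+1 / V i <= b' + g by rewrite ler_pdivrMr//; move: h1 h4; lra.
by move: h3; rewrite ler_norml => /andP[_ h3]; move: h3 h5; lra.
Qed.

End Given.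

Lemma beta0_word : indep xi /\ beta0 xi = delta%:E.
Proof.
split=> //.
have [psi [c [c0 c1 [M h]]]] := reflect_ex.
exact: (@beta0_word_given psi c _ _ _ M c0 c1 h erefl erefl erefl).
Qed.

End FromWord.

Lemma word_to_number (R : realType) (A : finType) (w : nat -> A) (delta : R) :
  1 < delta -> delta < 2 -> delta_word R w = delta%:E ->
  exists xi : R, [/\ irrational xi, nonquadratic xi & beta0 xi = delta%:E].
Proof.
move=> d1 d2; rewrite /delta_word; case: pselect => // w_inf /= dE.
have [xi [xi2 xiP]] := cf_limit w R.
have [] := @beta0_word R A w delta xi w_inf d1 d2 _ _ xi2 xiP.
- move=> r dr; have : (limn_esup (fun i => ((pal_len w i.+1)%:R / (pal_len w i)%:R : R)%:E) < r%:E)%E.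
    by rewrite dE lte_fin.
  exact: limn_esup_lt_ev.
- move=> r rd h; have : (limn_esup (fun i => ((pal_len w i.+1)%:R / (pal_len w i)%:R : R)%:E) <= r%:E)%E.
    exact: limn_esup_ev_le h.
  by rewrite dE lee_fin leNgt rd.
by move=> /indep_nonquadratic[irr nq] be; exists xi.
Qed.

Theorem theorem1p1 (R : realType) :
  beta0_values R `&` [set d : \bar R | (1%:E < d)%E /\ (d < 2%:E)%E] =
  delta_values R `&` [set d : \bar R | (1%:E < d)%E /\ (d < 2%:E)%E].
Proof.
apply/seteqP; split=> [d [[xi [irr nq] dE] [d1 d2]]|d [[A [w dE]] [d1 d2]]]; split=> //=.
  have [r rE] : exists r, d = r%:E.
    by move: d1 d2; case: (d) => [r _ _|//|//]; exists r.
  rewrite rE in d1 d2 dE *; rewrite !lte_fin in d1 d2.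
  by have [A [w h]] := number_to_word irr nq d1 d2 dE; exists A, w.
have [r rE] : exists r, d = r%:E.
  by move: d1 d2; case: (d) => [r _ _|//|//]; exists r.
rewrite rE in d1 d2 dE *; rewrite !lte_fin in d1 d2.
by have [xi [irr nq be]] := word_to_number d1 d2 (esym dE); exists xi.
Qed.
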